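(* Let $q\in\mathbb{C}\setminus\{0\}$ with $|q|\neq 1$, and let $a_0(z),\ldots,a_{n+1}(z)$ be meromorphic functions of finite $\varphi$-order with $a_0a_n\not\equiv0$, at least one of which is non-constant. Put $\rho_\varphi=\max_{0\le j\le n+1}\rho_\varphi(a_j)$. Suppose $s$ is convex and differentiable with $$\limsup_{r\to\infty}\frac{r^2s'(r)}{s(r)^2}<\infty,$$ and that $\varphi$ is subadditive and differentiable and that one of the following holds: $$\limsup_{r\to\infty}\frac{\varphi'(s(r))s'(r)r}{\varphi(s(r))}<\frac1\lambda\quad\text{or}\quad \liminf_{r\to\infty}\frac{\varphi'(s(r))s'(r)r}{\varphi(s(r))}\ge\frac1\lambda,$$ where $\lambda$ is the $\varphi$-exponent of convergence of the zeros of $a_0$ (with $1/0=\infty$). Suppose $\alpha_{\varphi,s}>0$. If $f$ is a meromorphic solution of $$\sum_{j=0}^n a_j(z)f(q^jz)=a_{n+1}(z),$$ then $$\rho_\varphi(f)\le\frac{\rho_\varphi}{\alpha_{\varphi,s}^2}-\frac{\gamma_{\varphi,s}}{\alpha_{\varphi,s}}+2\beta_\varphi.$$ If all of $a_0,\ldots,a_{n+1}$ are constants, then every meromorphic solution $f$ satisfies $\rho_\varphi(f)\le\beta_\varphi$.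
   Context: Let $R_0>0$. Throughout, $\varphi:(R_0,\infty)\to(0,\infty)$ is a non-decreasing unbounded function with $\log r\le\varphi(r)\le r$ for $r\ge R_0$. For a non-decreasing function $T$ with positive values, its $\varphi$-order is $\rho_\varphi(T)=\limsup_{r\to\infty}\frac{\log T(r)}{\log\varphi(r)}$; for a meromorphic function $f$ in $\mathbb{C}$, $\rho_\varphi(f)=\rho_\varphi(T(r,f))$ where $T(r,f)$ is the Nevanlinna characteristic. $\varphi$ is subadditive if $\varphi(a+b)\le\varphi(a)+\varphi(b)$ for all $a,b\ge R_0$. The function $s:(R_0,\infty)\to(0,\infty)$ is non-decreasing with $r<s(r)\le r^2$ for $r\ge R_0$ and $\liminf_{r\to\infty}s(r)/r>1$. Standing assumption: every meromorphic function of finite $\varphi$-order considered has classical order $\rho(f)<1$. Define $$\alpha_{\varphi,s}=\liminf_{r\to\infty}\frac{\log\varphi(r)}{\log\varphi(s(r))},\quad \beta_\varphi=\limsup_{r\to\infty}\frac{\log\log r}{\log\varphi(r)},\quad \gamma_{\varphi,s}=\liminf_{r\to\infty}\frac{\log\log\frac{s(r)}{r}}{\log\varphi(r)}.$$ The $\varphi$-exponent of convergence of a sequence $\{z_n\}$ with $|z_n|\to\infty$ is $\lambda_\varphi=\inf\{\mu>0:\sum_n\varphi(|z_n|)^{-\mu}<\infty\}$, and $\lambda_\varphi=\infty$ if the sum diverges for all $\mu>0$ (for a finite sequence it is $0$). *)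

(* Defs.v *)
(* The complex plane is R[i] (mathcomp-real-closed)
   over an arbitrary R : realType, viewed through the regular-module alias ^o
   so that it carries the normed/topological structure over itself (complex
   differentiability = mathcomp-analysis [derivable] with complex scalars). *)
From HB Require Import structures.
From mathcomp Require Import all_boot all_order all_algebra.
From mathcomp Require Import all_classical all_reals all_analysis.
From mathcomp Require Import complex.
Import Order.TTheory GRing.Theory Num.Theory.
Import numFieldNormedType.Exports.

Set Implicit Arguments.
Unset Strict Implicit.
Unset Printing Implicit Defensive.

Local Open Scope classical_set_scope.
Local Open Scope ring_scope.

Section NevanlinnaDefs.
Variable R : realType.

Definition cplx := (R[i])^o.

Definition cmod (z : cplx) : R := let: Complex a b := (z : R[i]) in Num.sqrt (a ^+ 2 + b ^+ 2).

Definition polar (r t : R) : cplx := ((r * cos t) +i* (r * sin t))%C.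

Definition is_pole (f : cplx -> cplx) (p : cplx) : Prop :=
  exists m : nat, (0 < m)%N /\
    exists2 c : cplx, c != 0 & (fun z => (z - p) ^+ m * f z) @ p^' --> c.

Definition is_meromorphic (f : cplx -> cplx) : Prop :=
  (forall z : cplx, exists2 e : R, 0 < e &
     forall w : cplx, is_pole f w -> cmod (w - z) < e -> w = z) /\
  (forall z : cplx, ~ is_pole f z -> derivable f z 1).

(* multiplicity of a pole (0 if p is not a pole) *)
Definition pole_order (f : cplx -> cplx) (p : cplx) : nat :=
  xget 0%N [set m : nat | (0 < m)%N /\
    exists2 c : cplx, c != 0 & (fun z => (z - p) ^+ m * f z) @ p^' --> c].

(* multiplicity of a zero (0 if p is not a zero) *)
Definition zero_order (f : cplx -> cplx) (p : cplx) : nat :=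
  xget 0%N [set m : nat | (0 < m)%N /\
    exists2 c : cplx, c != 0 & (fun z => f z / (z - p) ^+ m) @ p^' --> c].

Definition logp (x : R) : R := Num.max 0 (ln x).

Definition proximity (f : cplx -> cplx) (r : R) : R :=
  (2 * pi)^-1 * fine (\int[lebesgue_measure]_(t in `[0%R, (2 * pi)%R])
                        (logp (cmod (f (polar r t))))%:E)%E.

Definition npoles (f : cplx -> cplx) (t : R) : R :=
  fine (\esum_(p in [set p : cplx | (cmod p <= t)%R]) ((pole_order f p)%:R : R)%:E)%E.

Definition counting_fn (f : cplx -> cplx) (r : R) : R :=
  fine (\int[lebesgue_measure]_(t in `]0%R, r]) ((npoles f t - npoles f 0) / t)%:E)%E
  + npoles f 0 * ln r.

Definition charT (f : cplx -> cplx) (r : R) : R := proximity f r + counting_fn f r.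

Definition limsup_oo (g : R -> R) : \bar R := limf_esup (fun r => (g r)%:E) (pinfty_nbhs R).
Definition liminf_oo (g : R -> R) : \bar R := limf_einf (fun r => (g r)%:E) (pinfty_nbhs R).

Definition phi_order_fun (phi T : R -> R) : \bar R :=
  limsup_oo (fun r => ln (T r) / ln (phi r)).

Definition phi_order (phi : R -> R) (f : cplx -> cplx) : \bar R :=
  phi_order_fun phi (charT f).

Definition classical_order (f : cplx -> cplx) : \bar R := phi_order id f.

(* phi-exponent of convergence of the zeros (with multiplicity) of f;
   zeros with |z| <= R0 (outside the domain of phi) are finitely many and
   do not affect convergence; inf of the empty set is +oo. *)
Definition zeros_exponent (R0 : R) (phi : R -> R) (f : cplx -> cplx) : \bar R :=
  ereal_inf [set mu%:E | mu in [set mu : R | 0 < mu /\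
     (\esum_(p in [set p : cplx | (R0 < cmod p)%R])
        ((zero_order f p)%:R * powR (phi (cmod p)) (- mu))%:E < +oo)%E]].

Definition inv_ext (x : \bar R) : \bar R :=
  match x with
  | EFin y => if y == 0 then +oo%E else (y^-1)%:E
  | +oo%E => 0%E
  | -oo%E => 0%E
  end.

Definition alpha_phi_s (phi s : R -> R) : \bar R :=
  liminf_oo (fun r => ln (phi r) / ln (phi (s r))).
Definition beta_phi (phi : R -> R) : \bar R :=
  limsup_oo (fun r => ln (ln r) / ln (phi r)).
Definition gamma_phi_s (phi s : R -> R) : \bar R :=
  liminf_oo (fun r => ln (ln (s r / r)) / ln (phi r)).

Definition admissible_phi (R0 : R) (phi : R -> R) : Prop :=
  (forall r, R0 < r -> 0 < phi r) /\
  (forall r r', R0 < r -> r <= r' -> phi r <= phi r') /\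
  (forall M, exists r, R0 < r /\ M < phi r) /\
  (forall r, R0 < r -> ln r <= phi r <= r).

Definition admissible_s (R0 : R) (s : R -> R) : Prop :=
  (forall r r', R0 < r -> r <= r' -> s r <= s r') /\
  (forall r, R0 < r -> r < s r <= r ^+ 2) /\
  (1%:E < liminf_oo (fun r => (s r / r)%R))%E.

Definition phi_subadditive (R0 : R) (phi : R -> R) : Prop :=
  forall a b, R0 < a -> R0 < b -> phi (a + b) <= phi a + phi b.

Definition convex_on_gt (R0 : R) (s : R -> R) : Prop :=
  forall x y t, R0 < x -> R0 < y -> 0 <= t <= 1 ->
    s (t * x + (1 - t) * y) <= t * s x + (1 - t) * s y.

Definition differentiable_on_gt (R0 : R) (g : R -> R) : Prop :=
  forall r, R0 < r -> derivable g r 1.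

Definition is_constant (f : cplx -> cplx) : Prop := exists c : cplx, forall z, f z = c.

End NevanlinnaDefs.

(* Main.v *)
(** Let [p] be whichever of [q], [1/q] has modulus less than 1.  Solving the
    equation for [f z] expresses it through the coefficients and the values
    [f (p^j z)], [1 <= j <= n]; hence both log+|f| and the multiplicity of the
    poles of [f] satisfy

      V z <= U (c z) + max_(1 <= j <= n) V (p^j z),

    where [U] only involves the coefficients (and 1/a_0, resp. the zeros of
    a_0).  Iterating this K = O(log r) times moves the arguments into a fixed
    annulus; averaging over the circle |z| = r, respectively summing over the
    poles, and applying the first main theorem to 1/a_0 gives

      T(r, f) = O ((1 + max_j T(C r, a_j)) log r).

    By subadditivity phi (C r) = O (phi r), so the phi-order of [f] is at most
    rho + beta, and at most beta when all coefficients are constant.  Finally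
    0 < alpha <= 1, gamma <= beta and beta <= rho (a non-constant meromorphic
    function has T(r) >= log r - O(1)) make rho + beta smaller than the
    claimed bound.

    The Nevanlinna theory used here rests on Goursat's lemma in the coordinates
    z = exp (u + i t), which makes circle means of holomorphic functions
    independent of the radius.  Jensen's formula needs no complex logarithm:
    for a zero-free [g], ln |g| has the mean value property because
    ln |1 + h| <= Re h + |h|^2 / 2 applied to h = g z / g (l z) - 1 telescopes
    along radii tending to 0. *)
Require Import Defs.
From HB Require Import structures.
From mathcomp Require Import all_boot all_order all_algebra.
From mathcomp Require Import all_classical all_reals all_analysis.
From mathcomp Require Import complex measurable_realfun.
From mathcomp Require Import ring lra zify.
Import Order.TTheory GRing.Theory Num.Theory.
Import numFieldNormedType.Exports.
Set Implicit Arguments.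
Unset Strict Implicit.
Unset Printing Implicit Defensive.
Local Open Scope classical_set_scope.
Local Open Scope ring_scope.

(** The maximum in the inequality for [V] is kept pointwise. With the sum of the V (p^j z) in its
    place, K steps would produce exponentially many terms in K, that is a power of r; with the
    maximum each point follows a single path through the indices, and the loads add up linearly in
    K. The path depends on the point, so the iteration comes before the averaging over a circle and
    before the summation over poles. The path stops in an annulus and not in a disc about 0, since
    the proximity of f may be unbounded as the radius tends to 0. Proximity and pole count are added
    before the coefficients are estimated: 1/a_0 contributes its proximity to the one and the zeros
    of a_0 to the other, and it is their sum that T(r, a_0) + O(1) bounds. The equation is given
    only away from poles. On a circle this excludes finitely many points, a null set; multiplicities
    are compared through limits in punctured neighbourhoods. *)

Section ComplexModulus.
Variable R : realType.
Local Notation C := (cplx R).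
Implicit Types (z w : C) (r t : R).

Lemma cmodE z : (cmod z)%:C%C = `|z|.
Proof. by case: z => a b; rewrite normc_def. Qed.

Lemma cmod0 : cmod (0 : C) = 0.
Proof. by apply: complexI; rewrite cmodE normr0. Qed.

Lemma cmod1 : cmod (1 : C) = 1.
Proof. by apply: complexI; rewrite cmodE normr1. Qed.

Lemma cmod_ge0 z : 0 <= cmod z.
Proof. by rewrite -lecR cmodE normr_ge0. Qed.

Lemma cmod_eq0 z : (cmod z == 0) = (z == 0).
Proof. by rewrite -(inj_eq (@complexI R)) cmodE normr_eq0. Qed.

Lemma cmod_gt0 z : (0 < cmod z) = (z != 0).
Proof. by rewrite lt_def cmod_ge0 andbT cmod_eq0. Qed.

Lemma cmodM z w : cmod (z * w) = cmod z * cmod w.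
Proof. by apply: complexI; rewrite rmorphM/= !cmodE normrM. Qed.

Lemma cmodV z : cmod z^-1 = (cmod z)^-1.
Proof. by apply: complexI; rewrite fmorphV/= !cmodE normfV. Qed.

Lemma cmodX z n : cmod (z ^+ n) = cmod z ^+ n.
Proof. by apply: complexI; rewrite rmorphXn/= !cmodE normrX. Qed.

Lemma cmodN z : cmod (- z) = cmod z.
Proof. by apply: complexI; rewrite !cmodE normrN. Qed.

Lemma cmodBC z w : cmod (z - w) = cmod (w - z).
Proof. by rewrite -cmodN opprB. Qed.

Lemma cmodD z w : cmod (z + w) <= cmod z + cmod w.
Proof. by rewrite -lecR rmorphD/= !cmodE ler_normD. Qed.

Lemma cmodB z w : cmod (z - w) <= cmod z + cmod w.
Proof. by rewrite -(cmodN w) cmodD. Qed.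

Lemma cmodB_ge z w : cmod z - cmod w <= cmod (z - w).
Proof. by rewrite lerBlDr -{1}(subrK w z) cmodD. Qed.

Lemma cmod_real r : cmod (r%:C%C : C) = `|r|.
Proof. by rewrite /cmod/= expr0n/= addr0 sqrtr_sqr. Qed.

Lemma cmod_sqr z : cmod z ^+ 2 = complex.Re z ^+ 2 + complex.Im z ^+ 2.
Proof. by case: z => a b /=; rewrite sqr_sqrtr// addr_ge0// sqr_ge0. Qed.

Lemma norm_Re_le z : `|complex.Re z| <= cmod z.
Proof.
rewrite -(ler_pXn2r (_ : 0 < 2)%N) ?nnegrE ?cmod_ge0// cmod_sqr real_normK ?num_real//.
by rewrite lerDl sqr_ge0.
Qed.

Lemma norm_Im_le z : `|complex.Im z| <= cmod z.
Proof.
rewrite -(ler_pXn2r (_ : 0 < 2)%N) ?nnegrE ?cmod_ge0// cmod_sqr real_normK ?num_real//.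
by rewrite lerDr sqr_ge0.
Qed.

Lemma ReD z w : complex.Re (z + w) = complex.Re z + complex.Re w.
Proof. by case: z; case: w. Qed.
Lemma ReN z : complex.Re (- z) = - complex.Re z.
Proof. by case: z. Qed.
Lemma ReB z w : complex.Re (z - w) = complex.Re z - complex.Re w.
Proof. by rewrite ReD ReN. Qed.
Lemma ImD z w : complex.Im (z + w) = complex.Im z + complex.Im w.
Proof. by case: z; case: w. Qed.
Lemma ImN z : complex.Im (- z) = - complex.Im z.
Proof. by case: z. Qed.
Lemma ImB z w : complex.Im (z - w) = complex.Im z - complex.Im w.
Proof. by rewrite ImD ImN. Qed.
Lemma ReM z w : complex.Re (z * w) =
  complex.Re z * complex.Re w - complex.Im z * complex.Im w.
Proof. by case: z; case: w. Qed.
Lemma ImM z w : complex.Im (z * w) =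
  complex.Re z * complex.Im w + complex.Im z * complex.Re w.
Proof. by case: z => a b; case: w => c d /=. Qed.

Lemma cmod_le_ReIm z : cmod z <= `|complex.Re z| + `|complex.Im z|.
Proof.
rewrite -(ler_pXn2r (_ : 0 < 2)%N) ?nnegrE ?cmod_ge0 ?addr_ge0// cmod_sqr.
rewrite sqrrD !real_normK ?num_real// -addrA lerD2l lerDr.
by rewrite mulrn_wge0// mulr_ge0.
Qed.

Lemma cmod_polar r t : 0 <= r -> cmod (polar r t) = r.
Proof.
move=> r0; rewrite /cmod/= !exprMn -mulrDr cos2Dsin2 mulr1.
by rewrite sqrtr_sqr ger0_norm.
Qed.

Lemma polarM r t r' t' : polar r t * polar r' t' = polar (r * r') (t + t').
Proof.
apply/eqP; rewrite eq_complex /polar /= cosD sinD; apply/andP; split; apply/eqP; ring.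
Qed.

Lemma polar_periodic r t : polar r (t + 2 * pi) = polar r t.
Proof. by rewrite /polar mulr_natl sinD2pi cosD2pi. Qed.

Lemma polar_exists z : exists2 t, 0 <= t <= 2 * pi & z = polar (cmod z) t.
Proof.
have [->|z0] := eqVneq z 0.
  by exists 0; rewrite ?lexx ?mulr_ge0 ?pi_ge0// cmod0 /polar !mul0r.
have c0 : 0 < cmod z by rewrite cmod_gt0.
set x := complex.Re z / cmod z; set y := complex.Im z / cmod z.
have xy : x ^+ 2 + y ^+ 2 = 1.
  by rewrite /x /y !exprMn -mulrDl -cmod_sqr -exprMn mulfV ?gt_eqF// expr1n.
have x1 : -1 <= x <= 1.
  by rewrite -ler_norml /x normrM normfV (gtr0_norm c0) ler_pdivrMr// mul1r norm_Re_le.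
have sx : Num.sqrt (1 - x ^+ 2) = `|y| by rewrite -xy addrAC subrr add0r sqrtr_sqr.
have zE : z = ((cmod z * x) +i* (cmod z * y))%C.
  apply/eqP; rewrite eq_complex /= /x /y; apply/andP; split; apply/eqP; field;
  by rewrite gt_eqF.
(* [acos] reaches the upper half circle only; below the real axis its angle is reflected and brought
   back into [0, 2 pi]. *)
have [y0|y0] := leP 0 y.
  exists (acos x); first by have := acos_ge0 x1; have := acos_lepi x1; lra.
  by rewrite {1}zE /polar acosK ?in_itv//= sin_acos// sx ger0_norm.
exists (- acos x + 2 * pi); first by have := acos_ge0 x1; have := acos_lepi x1; lra.
rewrite polar_periodic {1}zE /polar cosN sinN acosK ?in_itv//= sin_acos// sx.
by rewrite ltr0_norm// opprK.
Qed.

End ComplexModulus.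

(** * Limits, continuity and complex derivatives in epsilon-delta form *)

Section EpsilonDelta.
Variable R : realType.
Local Notation C := (cplx R).
Implicit Types (f g : C -> C) (z w l m : C).

(** Real radii and the real modulus, because the norm of [R[i]] is complex-valued and its order
    partial, out of reach of linear arithmetic. *)
Definition clim f z l := forall e : R, 0 < e -> exists2 d : R, 0 < d &
  forall w, 0 < cmod (w - z) < d -> cmod (f w - l) < e.

Definition ccont f z := forall e : R, 0 < e -> exists2 d : R, 0 < d &
  forall w, cmod (w - z) < d -> cmod (f w - f z) < e.

(** Multiplied out and with a weak inequality, so that w = z is no exception. *)
Definition cderiv f z (l : C) := forall e : R, 0 < e -> exists2 d : R, 0 < d &
  forall w, cmod (w - z) < d -> cmod (f w - f z - l * (w - z)) <= e * cmod (w - z).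

Definition cdiff f z := exists l, cderiv f z l.

Lemma Cpos_ex (e : R[i]) : 0 < e -> exists2 e' : R, 0 < e' & e'%:C%C = e.
Proof.
by case: e => a b; rewrite ltcE/= => /andP[/eqP -> a0]; exists a.
Qed.

Lemma cvg_climP f z l : (f @ z^' --> l) <-> clim f z l.
Proof.
split.
  move=> /cvgrPdist_lt H e e0.
  have := H (e%:C)%C; rewrite (ltcR 0 e) e0 => /(_ erefl).
  rewrite /= near_withinE => -[d /Cpos_ex[d' d'0 <-]] /= Hd.
  exists d' => // w /andP[wz0 wd].
  have := Hd w; rewrite /= -!cmodE !ltcR [cmod (z - w)]cmodBC [cmod (l - _)]cmodBC.
  by apply=> //; rewrite -subr_eq0 -cmod_eq0 gt_eqF.
move=> H; apply/cvgrPdist_lt => e /Cpos_ex[e' e'0 <-].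
have [d d0 Hd] := H e' e'0.
rewrite near_withinE; exists (d%:C)%C => /=; first by rewrite (ltcR 0 d).
move=> w; rewrite /ball/= -cmodE ltcR cmodBC => wd wz.
rewrite -cmodE ltcR cmodBC; apply: Hd.
by rewrite wd andbT cmod_gt0 subr_eq0.
Qed.

Lemma derivable_cdiff f z : derivable f z 1 <-> cdiff f z.
Proof.
split.
  move=> /cvg_ex[l /cvg_climP Hl]; exists l => e e0.
  have [d d0 Hd] := Hl e e0; exists d => // w wd.
  have [->|wz] := eqVneq w z.
    by rewrite !subrr mulr0 subr0 cmod0 mulr0.
  have wz0 : 0 < cmod (w - z) by rewrite cmod_gt0 subr_eq0.
  have := Hd (w - z); rewrite subr0 wz0 wd => /(_ erefl).
  rewrite /= /shift /GRing.scale/= mulr1 subrK => /ltW.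
  rewrite -(ler_pM2r wz0) -cmodM mulrBl mulrAC mulVf ?mul1r//.
  by rewrite subr_eq0.
move=> [l Hl]; apply/cvg_ex; exists l; apply/cvg_climP => e e0.
have [d d0 Hd] := Hl (e / 2) ltac:(by rewrite divr_gt0).
exists d => // h; rewrite subr0 => /andP[h0 hd].
have hn0 : h != 0 by rewrite -cmod_gt0.
have := Hd (h + z); rewrite addrK => /(_ hd) H2.
rewrite /= /shift /GRing.scale/= mulr1.
rewrite -(ltr_pM2r h0) -cmodM mulrBl mulrAC mulVf ?mul1r//.
apply: le_lt_trans H2 _; rewrite ltr_pM2r//; lra.
Qed.

Lemma clim_unique f z l l' : clim f z l -> clim f z l' -> l = l'.
Proof.
move=> Hl Hl'; apply/eqP/negPn/negP => ll'.
have e0 : 0 < cmod (l - l') / 2 by rewrite divr_gt0// cmod_gt0 subr_eq0.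
have [d d0 Hd] := Hl _ e0; have [d' d'0 Hd'] := Hl' _ e0.
set x : R := Num.min d d' / 2.
have m0 : 0 < Num.min d d' by rewrite lt_min d0.
have x0 : 0 < x by rewrite divr_gt0.
have xm : x < Num.min d d' by rewrite /x; lra.
move: (xm); rewrite lt_min => /andP[xd xd'].
have cx : cmod (z + (x%:C)%C - z) = x.
  by rewrite addrC addKr cmod_real gtr0_norm.
have h1 := Hd (z + (x%:C)%C); rewrite cx x0 xd in h1.
have h2 := Hd' (z + (x%:C)%C); rewrite cx x0 xd' in h2.
have := cmodB (f (z + (x%:C)%C) - l') (f (z + (x%:C)%C) - l).
rewrite opprB addrC subrKA => h3.
have := h1 erefl; have := h2 erefl; lra.
Qed.

Lemma ccont_clim f z : ccont f z <-> clim f z (f z).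
Proof.
split=> H e e0; have [d d0 Hd] := H e e0; exists d => // w.
  by move=> /andP[_]; exact: Hd.
move=> wd; have [->|wz] := eqVneq w z; first by rewrite subrr cmod0.
by apply: Hd; rewrite wd andbT cmod_gt0 subr_eq0.
Qed.

Lemma eq_clim f g z l (d : R) : 0 < d ->
  (forall w, 0 < cmod (w - z) < d -> f w = g w) -> clim f z l -> clim g z l.
Proof.
move=> d0 fg H e e0; have [d' d'0 Hd] := H e e0.
exists (Num.min d d'); first by rewrite lt_min d0.
by move=> w; rewrite lt_min => /and3P[w0 wd wd']; rewrite -fg ?w0// Hd// w0.
Qed.

Lemma eq_ccont f g z (d : R) : 0 < d ->
  (forall w, cmod (w - z) < d -> f w = g w) -> ccont f z -> ccont g z.
Proof.
move=> d0 fg /ccont_clim H; apply/ccont_clim.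
rewrite -fg ?subrr ?cmod0//; apply: (eq_clim d0 _ H) => w /andP[_]; exact: fg.
Qed.

Lemma eq_cderiv f g z l (d : R) : 0 < d ->
  (forall w, cmod (w - z) < d -> f w = g w) -> cderiv f z l -> cderiv g z l.
Proof.
move=> d0 fg H e e0; have [d' d'0 Hd] := H e e0.
exists (Num.min d d'); first by rewrite lt_min d0.
move=> w; rewrite lt_min => /andP[wd wd'].
by rewrite -fg// -(fg z) ?subrr ?cmod0// Hd.
Qed.

Lemma eq_cdiff f g z (d : R) : 0 < d ->
  (forall w, cmod (w - z) < d -> f w = g w) -> cdiff f z -> cdiff g z.
Proof. by move=> d0 fg [l H]; exists l; apply: eq_cderiv fg H. Qed.

Lemma cdiff_ccont f z : cdiff f z -> ccont f z.
Proof.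
move=> [l H] e e0; have [d d0 Hd] := H 1 ltr01.
have K0 : 0 < cmod l + 1 by rewrite ltr_pwDr// cmod_ge0.
exists (Num.min d (e / (cmod l + 1))); first by rewrite lt_min d0 divr_gt0.
move=> w; rewrite lt_min ltr_pdivlMr// => /andP[wd we].
apply: le_lt_trans we.
rewrite -(subrK (l * (w - z)) (f w - f z)).
apply: le_trans (cmodD _ _) _; rewrite (mulrDr (cmod _)) mulr1 cmodM.
by have := Hd _ wd; rewrite mul1r mulrC; lra.
Qed.

Lemma clim_cst (c : C) z : clim (fun=> c) z c.
Proof. by move=> e e0; exists 1 => // w _; rewrite subrr cmod0. Qed.

Lemma clim_id z : clim id z z.
Proof. by move=> e e0; exists e => // w /andP[]. Qed.

Lemma climD f g z l m : clim f z l -> clim g z m ->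
  clim (fun w => f w + g w) z (l + m).
Proof.
move=> F G e e0; have e2 : 0 < e / 2 by rewrite divr_gt0.
have [d d0 Hd] := F _ e2; have [d' d'0 Hd'] := G _ e2.
exists (Num.min d d'); first by rewrite lt_min d0.
move=> w; rewrite lt_min => /and3P[w0 wd wd'].
have := Hd w; rewrite w0 wd => /(_ erefl) h1.
have := Hd' w; rewrite w0 wd' => /(_ erefl) h2.
rewrite opprD addrACA; apply: le_lt_trans (cmodD _ _) _; lra.
Qed.

Lemma clim_bounded f z l : clim f z l -> exists2 d : R, 0 < d &
  forall w, 0 < cmod (w - z) < d -> cmod (f w) < cmod l + 1.
Proof.
move=> F; have [d d0 Hd] := F 1 ltr01; exists d => // w /Hd h.
rewrite -(subrK l (f w)); apply: le_lt_trans (cmodD _ _) _; lra.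
Qed.

Lemma climM f g z l m : clim f z l -> clim g z m ->
  clim (fun w => f w * g w) z (l * m).
Proof.
move=> F G e e0.
have [d1 d10 B] := clim_bounded F.
have l0 := cmod_ge0 l; have m0 := cmod_ge0 m.
have e2 : 0 < e / 2 / (cmod l + 1) by rewrite !divr_gt0// ltr_pwDr.
have e3 : 0 < e / 2 / (cmod m + 1) by rewrite !divr_gt0// ltr_pwDr.
have [d2 d20 H2] := G _ e2; have [d3 d30 H3] := F _ e3.
exists (Num.min d1 (Num.min d2 d3)); first by rewrite !lt_min d10 d20.
move=> w; rewrite !lt_min => /and4P[w0 w1 w2 w3].
have := B w; rewrite w0 w1 => /(_ erefl) h1.
have := H2 w; rewrite w0 w2 => /(_ erefl); rewrite ltr_pdivlMr ?ltr_pwDr// => h2.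
have := H3 w; rewrite w0 w3 => /(_ erefl); rewrite ltr_pdivlMr ?ltr_pwDr// => h3.
have -> : f w * g w - l * m = (g w - m) * f w + (f w - l) * m by ring.
apply: le_lt_trans (cmodD _ _) _; rewrite !cmodM.
have a1 : cmod (g w - m) * cmod (f w) <= cmod (g w - m) * (cmod l + 1).
  by apply: ler_wpM2l; [exact: cmod_ge0|exact: ltW].
have a2 : cmod (f w - l) * cmod m <= cmod (f w - l) * (cmod m + 1).
  by apply: ler_wpM2l; [exact: cmod_ge0|rewrite lerDl].
lra.
Qed.

Lemma climV f z l : l != 0 -> clim f z l -> clim (fun w => (f w)^-1) z l^-1.
Proof.
move=> l0 F e e0.
have cl0 : 0 < cmod l by rewrite cmod_gt0.
have [d1 d10 H1] := F (cmod l / 2) ltac:(by rewrite divr_gt0).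
have [d2 d20 H2] := F (e * (cmod l ^+ 2 / 2)) ltac:(by rewrite mulr_gt0// divr_gt0// exprn_gt0).
exists (Num.min d1 d2); first by rewrite lt_min d10.
move=> w; rewrite lt_min => /and3P[w0 w1 w2].
have := H1 w; rewrite w0 w1 => /(_ erefl) h1.
have := H2 w; rewrite w0 w2 => /(_ erefl) h2.
have fl : cmod l / 2 < cmod (f w).
  have := cmodB_ge l (l - f w); have -> : l - (l - f w) = f w by ring.
  by rewrite (cmodBC l); lra.
have fw0 : f w != 0 by rewrite -cmod_gt0; lra.
have -> : (f w)^-1 - l^-1 = (l - f w) / (f w * l) by field; rewrite fw0 l0.
rewrite cmodM cmodV cmodM cmodBC ltr_pdivrMr ?mulr_gt0 ?cmod_gt0//.
apply: lt_le_trans h2 _; rewrite ler_pM2l//; nra.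
Qed.

Lemma climX f z l n : clim f z l -> clim (fun w => f w ^+ n) z (l ^+ n).
Proof.
move=> F; elim: n => [|n IH]; first exact: clim_cst.
by rewrite exprS; apply: (@eq_clim (fun w => f w * f w ^+ n) _ _ _ 1) => //;
  [move=> w _; rewrite exprS | exact: climM].
Qed.

Lemma clim_comp_scale f z l (c : C) : c != 0 -> clim f (c * z) l ->
  clim (fun w => f (c * w)) z l.
Proof.
move=> c0 F e e0; have [d d0 H] := F e e0.
have cc : 0 < cmod c by rewrite cmod_gt0.
exists (d / cmod c); first by rewrite divr_gt0.
move=> w /andP[w0 wd]; apply: H.
by rewrite -mulrBr cmodM mulr_gt0//= -ltr_pdivlMl// mulrC.
Qed.

Lemma ccontM f g z : ccont f z -> ccont g z -> ccont (fun w => f w * g w) z.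
Proof. by move=> /ccont_clim F /ccont_clim G; apply/ccont_clim/climM. Qed.

Lemma ccontD f g z : ccont f z -> ccont g z -> ccont (fun w => f w + g w) z.
Proof. by move=> /ccont_clim F /ccont_clim G; apply/ccont_clim/climD. Qed.

Lemma ccontV f z : f z != 0 -> ccont f z -> ccont (fun w => (f w)^-1) z.
Proof. by move=> f0 /ccont_clim F; apply/ccont_clim/climV. Qed.

Lemma ccont_cst (c : C) z : ccont (fun=> c) z.
Proof. by apply/ccont_clim/clim_cst. Qed.

Lemma ccont_id z : ccont id z.
Proof. by apply/ccont_clim/clim_id. Qed.

(* Caratheodory's form of differentiability, which reduces the rules of
   differentiation to those of continuity. *)
Lemma cderivP f z l : cderiv f z l <->
  clim (fun w => (f w - f z) / (w - z)) z l.
Proof.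
split=> H e e0.
  have [d d0 Hd] := H (e / 2) ltac:(by rewrite divr_gt0).
  exists d => // w /andP[w0 wd].
  have wz : w - z != 0 by rewrite -cmod_gt0.
  rewrite -(ltr_pM2r w0) -cmodM mulrBl mulfVK//.
  by apply: le_lt_trans (Hd _ wd) _; rewrite ltr_pM2r//; lra.
have [d d0 Hd] := H e e0; exists d => // w wd.
have [->|wz] := eqVneq w z; first by rewrite !subrr mulr0 subr0 cmod0 mulr0.
have w0 : 0 < cmod (w - z) by rewrite cmod_gt0 subr_eq0.
have := Hd w; rewrite w0 wd => /(_ erefl) /ltW.
by rewrite -(ler_pM2r w0) -cmodM mulrBl mulfVK// subr_eq0.
Qed.

Lemma cdiff_cst (c : C) z : cdiff (fun=> c) z.
Proof.
by exists 0 => e e0; exists 1 => // w _; rewrite subrr mul0r subr0 cmod0 mulr_ge0 ?cmod_ge0 ?ltW.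
Qed.

Lemma cdiff_id z : cdiff id z.
Proof.
by exists 1 => e e0; exists 1 => // w _; rewrite mul1r subrr cmod0 mulr_ge0 ?cmod_ge0 ?ltW.
Qed.

Lemma cdiffD f g z : cdiff f z -> cdiff g z -> cdiff (fun w => f w + g w) z.
Proof.
move=> [l /cderivP F] [m /cderivP G]; exists (l + m); apply/cderivP.
apply: (eq_clim (ltr01 : 0 < (1 : R)) _ (climD F G)) => w _; ring.
Qed.

Lemma cdiffM f g z : cdiff f z -> cdiff g z -> cdiff (fun w => f w * g w) z.
Proof.
move=> dF dG; have /ccont_clim cF := cdiff_ccont dF.
case: dF => [l /cderivP F]; case: dG => [m /cderivP G].
exists (f z * m + l * g z); apply/cderivP.
apply: (eq_clim (ltr01 : 0 < (1 : R)) _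
  (climD (climM cF G) (climM F (clim_cst (g z) z)))) => w _; ring.
Qed.

Lemma cdiffN f z : cdiff f z -> cdiff (fun w => - f w) z.
Proof.
move=> F; have H := cdiffM (cdiff_cst (-1) z) F.
by apply: (eq_cdiff (ltr01 : 0 < (1 : R)) _ H) => w _; rewrite mulN1r.
Qed.

Lemma cdiffB f g z : cdiff f z -> cdiff g z -> cdiff (fun w => f w - g w) z.
Proof. by move=> F G; apply: cdiffD => //; exact: cdiffN. Qed.

Lemma cdiffV f z : f z != 0 -> cdiff f z -> cdiff (fun w => (f w)^-1) z.
Proof.
move=> f0 dF; have cF := cdiff_ccont dF.
have /ccont_clim cV := ccontV f0 cF.
case: dF => [l /cderivP F].
exists (- (l * ((f z)^-1 * (f z)^-1))); apply/cderivP.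
have := cF (cmod (f z)); rewrite cmod_gt0 => /(_ f0) [d d0 Hd].
have G := climM (clim_cst (-1) z) (climM F (climM cV (clim_cst (f z)^-1 z))).
rewrite -[- (l * _)]mulN1r; apply: (eq_clim d0 _ G) => w /andP[w0 wd].
have fw0 : f w != 0.
  apply/negP => /eqP fw; have := Hd _ wd.
  by rewrite fw sub0r cmodN ltxx.
have wz : w - z != 0 by rewrite -cmod_gt0.
by field; rewrite fw0 f0 wz.
Qed.

Lemma cdiffX f z n : cdiff f z -> cdiff (fun w => f w ^+ n) z.
Proof.
move=> F; elim: n => [|n IH]; first exact: cdiff_cst.
by apply: (eq_cdiff (ltr01 : 0 < (1 : R)) _ (cdiffM F IH)) => w _; rewrite exprS.
Qed.

Lemma cdiff_affine f z (c b : C) : cdiff f (c * z + b) ->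
  cdiff (fun w => f (c * w + b)) z.
Proof.
move=> [l F]; exists (l * c) => e e0.
have K0 : 0 < cmod c + 1 by rewrite ltr_pwDr// cmod_ge0.
have [d d0 H] := F (e / (cmod c + 1)) ltac:(by rewrite divr_gt0).
exists (d / (cmod c + 1)); first by rewrite divr_gt0.
move=> w; rewrite ltr_pdivlMr// => wd.
have E : c * w + b - (c * z + b) = c * (w - z) by ring.
have := H (c * w + b); rewrite E cmodM.
have h1 : cmod c * cmod (w - z) < d.
  apply: le_lt_trans wd; rewrite mulrC ler_wpM2l ?cmod_ge0// lerDl//.
move=> /(_ h1); rewrite mulrA => h2; apply: le_trans h2 _.
rewrite -!mulrA ler_wpM2l ?(ltW e0)// ler_pdivrMl//.
by rewrite ler_wpM2r ?cmod_ge0//; lra.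
Qed.

Lemma cdiff_scale f z (c : C) : cdiff f (c * z) -> cdiff (fun w => f (c * w)) z.
Proof.
rewrite -[c * z]addr0 => /cdiff_affine.
by apply: (eq_cdiff (ltr01 : 0 < (1 : R))) => w _; rewrite addr0.
Qed.

End EpsilonDelta.

(** * Bisection of rectangles *)

Section Bisection.
Variable R : realType.

Lemma exp2_archi (x d : R) : 0 < d -> exists n, x / 2 ^+ n < d.
Proof.
move=> d0; have [n Hn] : exists n : nat, x / d < n%:R.
  exists (Num.truncn (Num.max 0 (x / d))).+1.
  have m0 : 0 <= Num.max 0 (x / d) by rewrite le_max lexx.
  have /andP[_] := truncn_itv m0.
  by apply: le_lt_trans; rewrite le_max lexx orbT.
exists n; rewrite ltr_pdivrMr ?exprn_gt0// mulrC -ltr_pdivrMr//.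
apply: lt_le_trans Hn _; rewrite -natrX ler_nat; exact/ltnW/ltn_expl.
Qed.

Lemma nested_intervals (x w : nat -> R) :
  (forall n, x n <= x n.+1) -> (forall n, x n.+1 + w n.+1 <= x n + w n) ->
  (forall n, 0 <= w n) -> exists a, forall n, x n <= a <= x n + w n.
Proof.
move=> xn wn w0.
have xm n m : (n <= m)%N -> x n <= x m.
  elim: m => [|m IH]; first by rewrite leqn0 => /eqP ->.
  by rewrite leq_eqVlt => /predU1P[->//|/IH h]; exact: le_trans h _.
have wm n m : (n <= m)%N -> x m + w m <= x n + w n.
  elim: m => [|m IH]; first by rewrite leqn0 => /eqP ->.
  by rewrite leq_eqVlt => /predU1P[->//|/IH h]; exact: le_trans (wn m) h.
have xw n m : x n <= x m + w m.
  have [nm|mn] := leqP n m.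
    by apply: le_trans (xm _ _ nm) _; rewrite lerDl.
  by apply: le_trans (wm _ _ (ltnW mn)); rewrite lerDl.
have hs : has_sup (range x).
  split; first by exists (x 0%N), 0%N.
  by exists (x 0%N + w 0%N) => _ [n _ <-].
exists (sup (range x)) => n; apply/andP; split.
  by apply: ub_le_sup; [case: hs|exists n].
apply: ge_sup; first by exists (x 0%N), 0%N.
by move=> _ [m _ <-].
Qed.

(** If [Q] failed, a failing quarter could be chosen again and again, and the common point of these
    nested rectangles would contradict the local hypothesis. This plays the role of compactness: it
    yields Goursat's lemma, boundedness and uniform continuity on circles, the identity theorem and
    the local finiteness of zeros and poles. Width or height 0 is allowed, which covers
    intervals. *)
Lemma bisect_rect (Q : R -> R -> R -> R -> Prop) (x0 y0 w0 h0 : R) :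
  0 <= w0 -> 0 <= h0 ->
  (forall x y w h, x0 <= x -> x + 2 * w <= x0 + w0 ->
     y0 <= y -> y + 2 * h <= y0 + h0 -> 0 <= w -> 0 <= h ->
     Q x y w h -> Q (x + w) y w h -> Q x (y + h) w h ->
     Q (x + w) (y + h) w h -> Q x y (2 * w) (2 * h)) ->
  (forall a b, x0 <= a <= x0 + w0 -> y0 <= b <= y0 + h0 ->
     exists2 d, 0 < d & forall x y w h,
       x0 <= x -> x + w <= x0 + w0 -> y0 <= y -> y + h <= y0 + h0 ->
       x <= a <= x + w -> y <= b <= y + h ->
       0 <= w < d -> 0 <= h < d -> Q x y w h) ->
  Q x0 y0 w0 h0.
Proof.
move=> w00 h00 Qsplit Qloc; apply: contrapT => nQ.
pose wn n := w0 / 2 ^+ n; pose hn n := h0 / 2 ^+ n.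
have wn0 n : 0 <= wn n by rewrite divr_ge0// exprn_ge0.
have hn0 n : 0 <= hn n by rewrite divr_ge0// exprn_ge0.
have wnS n : wn n = 2 * wn n.+1.
  by rewrite /wn exprS; field; rewrite expf_neq0.
have hnS n : hn n = 2 * hn n.+1.
  by rewrite /hn exprS; field; rewrite expf_neq0.
pose bad n (p : R * R) := [/\ x0 <= p.1, p.1 + wn n <= x0 + w0, y0 <= p.2,
  p.2 + hn n <= y0 + h0 & ~ Q p.1 p.2 (wn n) (hn n)].
pose next n (p p' : R * R) := [/\ p.1 <= p'.1, p'.1 + wn n.+1 <= p.1 + wn n,
  p.2 <= p'.2 & p'.2 + hn n.+1 <= p.2 + hn n].
(* The successor exists for every rectangle, with an irrelevant value on the good ones, so that
   [choice] yields a total function. *)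
have step (np : nat * (R * R)) : exists p', bad np.1 np.2 ->
    bad np.1.+1 p' /\ next np.1 np.2 p'.
  case: np => n [x y] /=; have [[/= b1 b2 b3 b4 b5]|nb] := pselect (bad n (x, y));
    last by exists (x, y).
  have := wn0 n.+1; have := hn0 n.+1 => hh ww.
  rewrite wnS in b2 b5; rewrite hnS in b4 b5.
  apply: contrapT => np.
  have child x' y' : x <= x' -> x' + wn n.+1 <= x + 2 * wn n.+1 -> y <= y' ->
      y' + hn n.+1 <= y + 2 * hn n.+1 -> Q x' y' (wn n.+1) (hn n.+1).
    move=> c1 c2 c3 c4; apply: contrapT => nq; apply: np.
    exists (x', y') => _; rewrite /bad /next/= (wnS n) (hnS n).
    by split; split => //; lra.
  by apply: b5; apply: Qsplit => //; apply: child; lra.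
have [nx Hnx] := choice step.
pose s := fix s n := if n is n'.+1 then nx (n', s n') else (x0, y0).
have sbad n : bad n (s n).
  elim: n => [|n IH]; last by case: (Hnx (n, s n) IH).
  by rewrite /bad /wn /hn expr0 !divr1/=; split.
have snext n : next n (s n) (s n.+1) by case: (Hnx (n, s n) (sbad n)).
have [a Ha] := @nested_intervals (fun n => (s n).1) wn
  ltac:(by move=> n; case: (snext n)) ltac:(by move=> n; case: (snext n)) wn0.
have [b Hb] := @nested_intervals (fun n => (s n).2) hn
  ltac:(by move=> n; case: (snext n)) ltac:(by move=> n; case: (snext n)) hn0.
have /= := Ha 0%N; rewrite /wn expr0 divr1 => a0.
have /= := Hb 0%N; rewrite /hn expr0 divr1 => b0.
have [d d0 Hd] := Qloc a b a0 b0.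
have [n Hn] := exp2_archi (w0 + h0) d0.
have wh : wn n + hn n < d by rewrite /wn /hn -mulrDl.
have := wn0 n; have := hn0 n => hn0' wn0'.
case: (sbad n) => c1 c2 c3 c4; apply; apply: Hd => //; lra.
Qed.

End Bisection.

(** * Integrals over segments *)

Section SegmentIntegral.
Variable R : realType.
Local Notation mu := (@lebesgue_measure R).

Definition seg (a b : R) (F : R -> R) := \int[mu]_(t in `[a, b]) F t.

Definition contR (F : R -> R) (t : R) := forall e : R, 0 < e ->
  exists2 d : R, 0 < d & forall t', `|t' - t| < d -> `|F t' - F t| < e.

Lemma contRP F t : contR F t <-> {for t, continuous F}.
Proof.
split=> H.
  apply/cvgrPdist_lt => e e0; have [d d0 Hd] := H e e0.
  by exists d => //= t' /= ; rewrite distrC => /Hd; rewrite distrC.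
move=> e e0; have /cvgrPdist_lt /(_ e e0)[d /= d0 Hd] := H.
by exists d => // t'; rewrite distrC => /Hd; rewrite distrC.
Qed.

Lemma seg_integrable a b F : (forall t, a <= t <= b -> contR F t) ->
  mu.-integrable `[a, b] (EFin \o F).
Proof.
move=> H; apply: continuous_compact_integrable; first exact: segment_compact.
apply: continuous_in_subspaceT => t; rewrite inE/= in_itv/= => /H.
by move/contRP.
Qed.

Lemma segB a b F G : (forall t, a <= t <= b -> contR F t) ->
  (forall t, a <= t <= b -> contR G t) ->
  seg a b (fun t => F t - G t) = seg a b F - seg a b G.
Proof. by move=> hF hG; rewrite /seg RintegralB//; exact: seg_integrable. Qed.

Lemma seg_chasles a b c F : a <= b -> b <= c ->
  (forall t, a <= t <= c -> contR F t) -> seg a c F = seg a b F + seg b c F.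
Proof.
move=> ab bc hF; have iF := seg_integrable hF.
have := Rintegral_itvB iF (x := b); rewrite !bnd_simp => /(_ ab bc).
rewrite Rintegral_itv_obnd_cbnd; last first.
  apply: integrableS iF => //; apply: subset_itvr; rewrite bnd_simp//.
by rewrite /seg => <-; rewrite addrC subrK.
Qed.

Lemma contR_cst c t : contR (fun=> c) t.
Proof. by move=> e e0; exists 1 => // t' _; rewrite subrr normr0. Qed.

Lemma seg_cst a b c : a <= b -> seg a b (fun=> c) = c * (b - a).
Proof.
move=> ab; rewrite /seg Rintegral_cst//= lebesgue_measure_itv/= lte_fin.
move: ab; rewrite le_eqVlt => /predU1P[->|->]; last by rewrite -EFinD.
by rewrite ltxx subrr.
Qed.

Lemma seg_bound a b c M F : a <= b -> (forall t, a <= t <= b -> contR F t) ->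
  (forall t, a <= t <= b -> `|F t - c| <= M) ->
  `|seg a b F - c * (b - a)| <= M * (b - a).
Proof.
move=> ab hF hM; rewrite -seg_cst// -segB//; last by move=> *; exact: contR_cst.
have hFc t : a <= t <= b -> contR (fun t => F t - c) t.
  by move=> /hF H e /H[d d0 Hd]; exists d => // t' /Hd; rewrite opprB addrA subrK.
apply: le_trans (le_normr_Rintegral _ (seg_integrable hFc)) _ => //.
rewrite -seg_cst//; apply: le_Rintegral => //.
- apply: seg_integrable => t /hFc H e /H[d d0 Hd]; exists d => // t' /Hd.
  by apply: le_lt_trans; exact: ler_dist_dist.
by apply: seg_integrable => *; exact: contR_cst.
Qed.

End SegmentIntegral.

(** * Goursat's lemma on rectangles *)

Section Goursat.
Variable R : realType.


Local Notation C := (cplx R).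
Implicit Types (f F : C -> C).

Definition reF F (u t : R) : R := complex.Re (F (u +i* t)%C).
Definition imF F (u t : R) : R := complex.Im (F (u +i* t)%C).

Lemma ccont_slices F u t : ccont F (u +i* t)%C ->
  [/\ contR (reF F u) t, contR (imF F u) t, contR ((reF F)^~ t) u & contR ((imF F)^~ t) u].
Proof.
move=> H; split=> e /H[d d0 Hd]; exists d => // x xd.
- rewrite /reF -ReB; apply: le_lt_trans (norm_Re_le _) _; apply: Hd.
  apply: le_lt_trans (cmod_le_ReIm _) _.
  by rewrite ReB ImB /= subrr normr0 add0r.
- rewrite /imF -ImB; apply: le_lt_trans (norm_Im_le _) _; apply: Hd.
  apply: le_lt_trans (cmod_le_ReIm _) _.
  by rewrite ReB ImB /= subrr normr0 add0r.
- rewrite /reF -ReB; apply: le_lt_trans (norm_Re_le _) _; apply: Hd.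
  apply: le_lt_trans (cmod_le_ReIm _) _.
  by rewrite ReB ImB /= subrr normr0 addr0.
- rewrite /imF -ImB; apply: le_lt_trans (norm_Im_le _) _; apply: Hd.
  apply: le_lt_trans (cmod_le_ReIm _) _.
  by rewrite ReB ImB /= subrr normr0 addr0.
Qed.

(* The imaginary part of the integral of [F] along the boundary of the
   rectangle [u1, u2] x [t1, t2]. *)
Definition rect_int F u1 u2 t1 t2 : R :=
  seg t1 t2 (fun t => reF F u2 t - reF F u1 t) +
  seg u1 u2 (fun u => imF F u t1 - imF F u t2).

Lemma contRB (g h : R -> R) t : contR g t -> contR h t ->
  contR (fun x => g x - h x) t.
Proof.
move=> /contRP G /contRP H; apply/contRP.
by apply: continuousB.
Qed.

Lemma rect_int_splitu F u1 u2 u3 t1 t2 : u1 <= u2 -> u2 <= u3 -> t1 <= t2 ->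
  (forall u t, u1 <= u <= u3 -> t1 <= t <= t2 -> ccont F (u +i* t)%C) ->
  rect_int F u1 u3 t1 t2 = rect_int F u1 u2 t1 t2 + rect_int F u2 u3 t1 t2.
Proof.
move=> u12 u23 t12 cF.
have u13 := le_trans u12 u23.
have cA u : u1 <= u <= u3 -> forall t, t1 <= t <= t2 -> contR (reF F u) t.
  by move=> hu t ht; have [] := ccont_slices (cF _ _ hu ht).
have cB u : u1 <= u <= u3 -> contR (fun u => imF F u t1 - imF F u t2) u.
  by move=> hu; apply: contRB; [have [] := ccont_slices (cF u t1 hu _)|
    have [] := ccont_slices (cF u t2 hu _)]; rewrite ?lexx ?t12.
have h1 := cA u1; rewrite lexx u13 in h1.
have h2 := cA u2; rewrite u12 u23 in h2.
have h3 := cA u3; rewrite lexx u13 in h3.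
rewrite /rect_int (segB (h3 isT) (h1 isT)) (segB (h2 isT) (h1 isT)) (segB (h3 isT) (h2 isT)).
by rewrite (seg_chasles u12 u23 cB); ring.
Qed.

Lemma rect_int_splitt F u1 u2 t1 t2 t3 : u1 <= u2 -> t1 <= t2 -> t2 <= t3 ->
  (forall u t, u1 <= u <= u2 -> t1 <= t <= t3 -> ccont F (u +i* t)%C) ->
  rect_int F u1 u2 t1 t3 = rect_int F u1 u2 t1 t2 + rect_int F u1 u2 t2 t3.
Proof.
move=> u12 t12 t23 cF.
have t13 := le_trans t12 t23.
have cB t : t1 <= t <= t3 -> forall u, u1 <= u <= u2 -> contR ((imF F)^~ t) u.
  by move=> ht u hu; have [] := ccont_slices (cF _ _ hu ht).
have cA t : t1 <= t <= t3 -> contR (fun t => reF F u2 t - reF F u1 t) t.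
  by move=> ht; apply: contRB; [have [] := ccont_slices (cF u2 t _ ht)|
    have [] := ccont_slices (cF u1 t _ ht)]; rewrite ?lexx ?u12.
have h1 := cB t1; rewrite lexx t13 in h1.
have h2 := cB t2; rewrite t12 t23 in h2.
have h3 := cB t3; rewrite lexx t13 in h3.
rewrite /rect_int (segB (h1 isT) (h3 isT)) (segB (h1 isT) (h2 isT)) (segB (h2 isT) (h3 isT)).
by rewrite (seg_chasles t12 t23 cA); ring.
Qed.

(** The bound e (w + h)^2 is compatible with quartering, as (2w + 2h)^2 = 4 (w + h)^2, and holds for
    small rectangles because a linear function has boundary integral 0. So it holds for the whole
    rectangle, with e arbitrary. *)
Lemma goursat_rect F u1 u2 t1 t2 : u1 <= u2 -> t1 <= t2 ->
  (forall u t, u1 <= u <= u2 -> t1 <= t <= t2 -> cdiff F (u +i* t)%C) ->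
  rect_int F u1 u2 t1 t2 = 0.
Proof.
move=> u12 t12 dF.
have cF u t : u1 <= u <= u2 -> t1 <= t <= t2 -> ccont F (u +i* t)%C.
  by move=> hu ht; apply: cdiff_ccont; exact: dF.
have cA u t : u1 <= u <= u2 -> t1 <= t <= t2 -> contR (reF F u) t.
  by move=> hu ht; have [] := ccont_slices (cF _ _ hu ht).
have cB u t : u1 <= u <= u2 -> t1 <= t <= t2 -> contR ((imF F)^~ t) u.
  by move=> hu ht; have [] := ccont_slices (cF _ _ hu ht).
suff H (e : R) : 0 < e -> `|rect_int F u1 u2 t1 t2| <= e * ((u2 - u1) + (t2 - t1)) ^+ 2.
  apply/eqP; rewrite -normr_le0; apply/ler_addgt0Pl => e e0; rewrite addr0.
  set K := ((u2 - u1) + (t2 - t1)) ^+ 2 in H.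
  have K0 : 0 <= K by rewrite sqr_ge0.
  have e' : 0 < e / (K + 1) by rewrite divr_gt0// ltr_pwDr.
  apply: le_trans (H _ e') _.
  by rewrite mulrAC ler_pdivrMr ?ltr_pwDr// ler_wpM2l ?(ltW e0)// lerDl.
move=> e0.
pose Q (x y w h : R) := `|rect_int F x (x + w) y (y + h)| <= e * (w + h) ^+ 2 : Prop.
have E1 : u1 + (u2 - u1) = u2 by ring.
have E2 : t1 + (t2 - t1) = t2 by ring.
suff : Q u1 t1 (u2 - u1) (t2 - t1) by rewrite /Q E1 E2.
apply: (@bisect_rect _ Q); rewrite ?subr_ge0//.
  move=> x y w h; rewrite E1 E2 => x1 x2 y1 y2 w0 h0.
  rewrite /Q => q1 q2 q3 q4.
  have E : rect_int F x (x + 2 * w) y (y + 2 * h) =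
     rect_int F x (x + w) y (y + h) + rect_int F (x + w) (x + w + w) y (y + h) +
     rect_int F x (x + w) (y + h) (y + h + h) +
     rect_int F (x + w) (x + w + w) (y + h) (y + h + h).
    have -> : x + 2 * w = x + w + w by ring.
    have -> : y + 2 * h = y + h + h by ring.
    have cF' u t : x <= u <= x + w + w -> y <= t <= y + h + h -> ccont F (u +i* t)%C.
      by move=> /andP[? ?] /andP[? ?]; apply: cF; apply/andP; split; lra.
    rewrite (@rect_int_splitt F x _ y (y + h)); [|lra|lra|lra|exact: cF'].
    rewrite (@rect_int_splitu F x (x + w) _ y (y + h)); [|lra|lra|lra|]; last first.
      by move=> u t hu /andP[? ?]; apply: cF' => //; apply/andP; split; lra.
    rewrite (@rect_int_splitu F x (x + w) _ (y + h) (y + h + h)); [|lra|lra|lra|]; last first.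
      by move=> u t hu /andP[? ?]; apply: cF' => //; apply/andP; split; lra.
    by rewrite addrA.
  rewrite E.
  have n1 := ler_normD (rect_int F x (x + w) y (y + h) +
     rect_int F (x + w) (x + w + w) y (y + h) +
     rect_int F x (x + w) (y + h) (y + h + h))
     (rect_int F (x + w) (x + w + w) (y + h) (y + h + h)).
  have n2 := ler_normD (rect_int F x (x + w) y (y + h) +
     rect_int F (x + w) (x + w + w) y (y + h))
     (rect_int F x (x + w) (y + h) (y + h + h)).
  have n3 := ler_normD (rect_int F x (x + w) y (y + h))
     (rect_int F (x + w) (x + w + w) y (y + h)).
  have -> : e * (2 * w + 2 * h) ^+ 2 = 4 * (e * (w + h) ^+ 2) by ring.
  lra.
move=> a b; rewrite E1 E2 => ha hb.
have [l Hl] := dF _ _ ha hb.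
have e2 : 0 < e / 2 by rewrite divr_gt0.
have [d d0 Hd] := Hl _ e2.
exists (d / 2); first by rewrite divr_gt0.
move=> x y w h => x1 x2 y1 y2 xa yb wd hd.
have rem u t : x <= u <= x + w -> y <= t <= y + h ->
    `|reF F u t - reF F a b - (complex.Re l * (u - a) - complex.Im l * (t - b))|
       <= e / 2 * (w + h) /\ `|imF F u t - imF F a b - (complex.Re l * (t - b) + complex.Im l * (u - a))|
       <= e / 2 * (w + h).
  move=> hu ht; pose z : C := (u +i* t)%C; pose z0 : C := (a +i* b)%C.
  have zz : cmod (z - z0) <= w + h.
    apply: le_trans (cmod_le_ReIm _) _; rewrite ReB ImB /=.
    by apply: lerD; rewrite ler_norml; lra.
  have zd : cmod (z - z0) < d by apply: le_lt_trans zz _; lra.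
  have := Hd _ zd => Hz.
  have Hz' : cmod (F z - F z0 - l * (z - z0)) <= e / 2 * (w + h).
    by apply: le_trans Hz _; rewrite ler_pM2l.
  split.
    apply: le_trans Hz'; apply: le_trans (norm_Re_le _).
    by rewrite !ReB ReM !ReB !ImB /= le_eqVlt eqxx.
  apply: le_trans Hz'; apply: le_trans (norm_Im_le _).
  by rewrite !ImB ImM !ReB !ImB /= le_eqVlt eqxx.
rewrite /Q /rect_int.
set Re_l := complex.Re l in rem.
(* The linear part contributes [Re_l * w * h] on the vertical sides and its opposite on the
   horizontal ones. What is left is an error e (w + h) per unit length over the total length w +
   h. *)
have b1 : `|seg y (y + h) (fun t => reF F (x + w) t - reF F x t) -
    Re_l * w * (y + h - y)| <= e * (w + h) * (y + h - y).
  apply: seg_bound; first by lra.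
    by move=> t ht; apply: contRB; apply: cA; lra.
  move=> t ht; have [r1 _] := rem (x + w) t ltac:(lra) ht.
  have [r2 _] := rem x t ltac:(lra) ht.
  set A1 := reF F (x + w) t - _ - _ in r1; set A2 := reF F x t - _ - _ in r2.
  have -> : reF F (x + w) t - reF F x t - Re_l * w = A1 - A2 by rewrite /A1 /A2; ring.
  apply: le_trans (ler_normB _ _) _; lra.
have b2 : `|seg x (x + w) (fun u => imF F u y - imF F u (y + h)) -
    (- (Re_l * h)) * (x + w - x)| <= e * (w + h) * (x + w - x).
  apply: seg_bound; first by lra.
    by move=> t ht; apply: contRB; apply: cB; lra.
  move=> u hu; have [_ r1] := rem u y hu ltac:(lra).
  have [_ r2] := rem u (y + h) hu ltac:(lra).
  set A1 := imF F u y - _ - _ in r1; set A2 := imF F u (y + h) - _ - _ in r2.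
  have -> : imF F u y - imF F u (y + h) - (- (Re_l * h)) = A1 - A2 by rewrite /A1 /A2; ring.
  apply: le_trans (ler_normB _ _) _; lra.
set S1 := seg _ _ _ in b1 *; set S2 := seg _ _ _ in b2 *.
have -> : S1 + S2 = (S1 - Re_l * w * (y + h - y)) + (S2 - (- (Re_l * h)) * (x + w - x)) by ring.
apply: le_trans (ler_normD _ _) _; nra.
Qed.

End Goursat.

(** * The complex exponential *)

Section ComplexExponential.
Variable R : realType.
Local Notation C := (cplx R).

Lemma is_derive_eps (f : R -> R) (x l : R) : is_derive x 1 f l ->
  forall e : R, 0 < e -> exists2 d : R, 0 < d &
    forall h, `|h| < d -> `|f (x + h) - f x - l * h| <= e * `|h|.
Proof.
move=> [df fl] e e0.
have Hc : h^-1 *: (f (h *: 1 + x) - f x) @[h --> 0^'] --> l by rewrite -fl.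
have /cvgrPdist_le /(_ e e0) := Hc.
rewrite near_withinE => -[d /= d0 Hd]; exists d => // h hd.
have [->|h0] := eqVneq h 0; first by rewrite addr0 subrr mulr0 subr0 normr0 mulr0.
have := Hd h; rewrite /= sub0r normrN => /(_ hd h0).
rewrite /GRing.scale/= mulr1 [h + x]addrC => H.
have -> : f (x + h) - f x - l * h = (h^-1 * (f (x + h) - f x) - l) * h by field.
by rewrite normrM ler_wpM2r// distrC.
Qed.

Definition cexp (w : C) : C := polar (expR (complex.Re w)) (complex.Im w).

Lemma cexpD w z : cexp (w + z) = cexp w * cexp z.
Proof. by rewrite /cexp ReD ImD polarM expRD. Qed.

Lemma cexp0_deriv : cderiv cexp 0 1.
Proof.
move=> e e0.
(* The real part will cost 3 k |w| and the imaginary part 4 k |w|, so e / 12 leaves room; k <= 1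
   gives |1 + h| <= 2, and |w| < k makes the product h t small. *)
pose k := Num.min (e / 12) 1.
have k0 : 0 < k by rewrite lt_min ltr01 andbT divr_gt0.
have k1 : k <= 1 by rewrite ge_min lexx orbT.
have ke : 12 * k <= e.
  by rewrite -ler_pdivlMl// mulrC ge_min lexx.
have [d1 d10 H1] := is_derive_eps (is_derive_expR (0 : R)) k0.
have [d2 d20 H2] := is_derive_eps (is_derive_sin (0 : R)) k0.
have [d3 d30 H3] := is_derive_eps (is_derive_cos (0 : R)) k0.
exists (Num.min k (Num.min d1 (Num.min d2 d3))).
  by rewrite lt_min k0 !lt_min d10 d20.
move=> w; rewrite !subr0 lt_min => /andP[wk]; rewrite !lt_min => /and3P[w1 w2 w3].
have -> : cexp 0 = 1.
  by rewrite /cexp /polar /= expR0 cos0 sin0 mulr1 mulr0.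
rewrite mul1r; set h := complex.Re w; set t := complex.Im w.
have hw : `|h| <= cmod w := norm_Re_le w.
have tw : `|t| <= cmod w := norm_Im_le w.
have := H1 h (le_lt_trans hw w1); rewrite add0r expR0 mul1r => E1.
have := H2 t (le_lt_trans tw w2); rewrite add0r sin0 cos0 mul1r subr0 => E2.
have := H3 t (le_lt_trans tw w3); rewrite add0r sin0 cos0 oppr0 mul0r subr0 => E3.
apply: le_trans (cmod_le_ReIm _) _.
rewrite !ReB !ImB /cexp /polar /= -/h -/t subr0.
have E1' : `|expR h - 1 - h| <= k * cmod w by apply: le_trans E1 _; rewrite ler_pM2l.
have E2' : `|sin t - t| <= k * cmod w by apply: le_trans E2 _; rewrite ler_pM2l.
have E3' : `|cos t - 1| <= k * cmod w by apply: le_trans E3 _; rewrite ler_pM2l.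
have h1 : `|1 + h| <= 2.
  apply: le_trans (ler_normD _ _) _; rewrite normr1; clear -hw wk k1; lra.
have -> : expR h * cos t - 1 - h = (expR h - 1 - h) * cos t + (1 + h) * (cos t - 1) by ring.
have -> : expR h * sin t - t = (expR h - 1 - h) * sin t + (1 + h) * (sin t - t) + h * t by ring.
have b1 : `|(expR h - 1 - h) * cos t| <= k * cmod w.
  by rewrite normrM; apply: le_trans E1'; rewrite ler_piMr// cos_max.
have b2 : `|(expR h - 1 - h) * sin t| <= k * cmod w.
  by rewrite normrM; apply: le_trans E1'; rewrite ler_piMr// sin_max.
have b3 : `|(1 + h) * (cos t - 1)| <= 2 * (k * cmod w).
  by rewrite normrM ler_pM.
have b4 : `|(1 + h) * (sin t - t)| <= 2 * (k * cmod w).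
  by rewrite normrM ler_pM.
have b5 : `|h * t| <= k * cmod w.
  by rewrite normrM ler_pM// (le_trans hw)// ltW.
have X0 : 12 * (k * cmod w) <= e * cmod w by rewrite mulrA ler_wpM2r// cmod_ge0.
have X1 : 0 <= k * cmod w by rewrite mulr_ge0// ?cmod_ge0// ltW.
apply: le_trans X0.
have -> : 12 * (k * cmod w) = 3 * (k * cmod w) + 9 * (k * cmod w) by ring.
apply: lerD.
  apply: le_trans (ler_normD _ _) (le_trans (lerD b1 b3) _).
  by move: (k * cmod w) X1 => X X1; clear -X1; lra.
apply: le_trans (ler_normD _ _) (le_trans (lerD (ler_normD _ _) b5) _).
apply: le_trans (lerD (lerD b2 b4) (lexx _)) _.
by move: (k * cmod w) X1 => X X1; clear -X1; lra.
Qed.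

(** The functional equation carries the derivative at 0 to every point. *)
Lemma cderiv_cexp w : cderiv cexp w (cexp w).
Proof.
apply/cderivP; have /cderivP := cexp0_deriv => H e e0.
have c0 : cexp w != 0 by rewrite -cmod_gt0 cmod_polar ?expR_gt0 ?expR_ge0.
have cc0 : 0 < cmod (cexp w) by rewrite cmod_gt0.
have [d d0 Hd] := H (e / cmod (cexp w)) ltac:(by rewrite divr_gt0).
exists d => // z zd; have := Hd (z - w); rewrite !subr0 => /(_ zd).
rewrite ltr_pdivlMr// -cmodM; congr (cmod _ < _).
have -> : cexp z = cexp w * cexp (z - w) by rewrite -cexpD addrC subrK.
have -> : cexp 0 = 1 by rewrite /cexp /polar /= expR0 cos0 sin0 mulr1 mulr0.
have zw : z - w != 0 by rewrite -cmod_gt0; case/andP: zd.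
by field.
Qed.

Lemma cdiff_comp (f g : C -> C) z : cdiff g z -> cdiff f (g z) ->
  cdiff (fun w => f (g w)) z.
Proof.
move=> dg [l Hl]; have cg := cdiff_ccont dg; case: dg => m Hm.
exists (l * m) => e e0.
have lc := cmod_ge0 l; have mc := cmod_ge0 m.
have e1 : 0 < e / 2 / (cmod l + 1) by rewrite !divr_gt0// ltr_pwDr.
set k1 := e / 2 / (cmod l + 1) in e1.
have mk : 0 < cmod m + 1 + k1 by rewrite addr_gt0// ltr_pwDr.
have e2 : 0 < e / 2 / (cmod m + 1 + k1) by rewrite !divr_gt0.
set k2 := e / 2 / _ in e2.
have [d1 d10 H1] := Hm _ e1; have [d2 d20 H2] := Hl _ e2.
have [d3 d30 H3] := cg _ d20.
exists (Num.min d1 d3); first by rewrite lt_min d10.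
move=> w; rewrite lt_min => /andP[w1 w3].
have a1 := H1 _ w1; have a2 := H2 _ (H3 _ w3).
have -> : f (g w) - f (g z) - l * m * (w - z) =
  (f (g w) - f (g z) - l * (g w - g z)) + l * (g w - g z - m * (w - z)) by ring.
apply: le_trans (cmodD _ _) _; rewrite (cmodM l).
have gb : cmod (g w - g z) <= (cmod m + k1) * cmod (w - z).
  rewrite -(subrK (m * (w - z)) (g w - g z)).
  by apply: le_trans (cmodD _ _) _; rewrite (mulrDl (cmod m)) cmodM addrC lerD2l.
have h1 : cmod (f (g w) - f (g z) - l * (g w - g z)) <= e / 2 * cmod (w - z).
  apply: le_trans a2 _; apply: le_trans (_ : k2 * ((cmod m + k1) * cmod (w - z)) <= _).
    by rewrite ler_pM2l.
  rewrite mulrA ler_wpM2r ?cmod_ge0// /k2 mulrAC ler_pdivrMr//.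
  by rewrite ler_pM2l ?divr_gt0//; lra.
have h2 : cmod l * cmod (g w - g z - m * (w - z)) <= e / 2 * cmod (w - z).
  apply: le_trans (ler_wpM2l lc a1) _; rewrite mulrA ler_wpM2r ?cmod_ge0//.
  rewrite /k1 mulrC mulrAC ler_pdivrMr ?ltr_pwDr//.
  by rewrite ler_pM2l ?divr_gt0// lerDl.
move: h1 h2; set X := cmod _; set Y := cmod l * _; clear; lra.
Qed.

End ComplexExponential.

(** * Means over circles *)

Section CircleMean.
Variable R : realType.
Local Notation C := (cplx R).
Local Notation mu := (@lebesgue_measure R).
Implicit Types (F G : C -> R) (f : C -> C) (r : R).

Definition circ F r : R :=
  (2 * pi)^-1 * \int[mu]_(t in `[0, 2 * pi]) F (polar r t).

(** Integrability has to accompany [circ], where an infinite integral is silently sent to 0. *)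
Definition circ_int F r :=
  mu.-integrable `[0, 2 * pi] (EFin \o (fun t => F (polar r t))).

Definition rcont F z := forall e : R, 0 < e -> exists2 d : R, 0 < d &
  forall w : C, cmod (w - z) < d -> `|F w - F z| < e.

Lemma rcont_Re f z : ccont f z -> rcont (fun w => complex.Re (f w)) z.
Proof.
move=> H e /H[d d0 Hd]; exists d => // w /Hd; apply: le_lt_trans.
by rewrite -ReB norm_Re_le.
Qed.

Lemma rcont_cmod f z : ccont f z -> rcont (fun w => cmod (f w)) z.
Proof.
move=> H e /H[d d0 Hd]; exists d => // w /Hd; apply: le_lt_trans.
rewrite ler_norml cmodB_ge andbT lerNl opprB cmodBC cmodB_ge//.
Qed.

Lemma rcont_comp (h : R -> R) F z : rcont F z -> contR h (F z) ->
  rcont (fun w => h (F w)) z.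
Proof.
move=> HF Hh e /Hh[d d0 Hd]; have [d' d'0 Hd'] := HF _ d0.
by exists d' => // w /Hd'/Hd.
Qed.

Lemma twopi_gt0 : 0 < 2 * pi :> R.
Proof. by rewrite mulr_gt0// pi_gt0. Qed.

Lemma polar_cont r t : forall e : R, 0 < e -> exists2 d : R, 0 < d &
  forall t', `|t' - t| < d -> cmod (polar r t' - polar r t) < e.
Proof.
move=> e e0; have K : 0 < `|r| + 1 by rewrite ltr_pwDr.
have e2 : 0 < e / 2 / (`|r| + 1) by rewrite !divr_gt0.
have /contRP /(_ _ e2)[d1 d10 H1] := @continuous_cos R t.
have /contRP /(_ _ e2)[d2 d20 H2] := @continuous_sin R t.
exists (Num.min d1 d2); first by rewrite lt_min d10.
move=> t'; rewrite lt_min => /andP[/H1 h1 /H2 h2].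
apply: le_lt_trans (cmod_le_ReIm _) _; rewrite ReB ImB /= -!mulrBr !normrM.
have aux (x : R) : `|x| < e / 2 / (`|r| + 1) -> `|r| * `|x| < e / 2.
  rewrite ltr_pdivlMr// => h; apply: le_lt_trans h.
  by rewrite mulrC ler_wpM2l//; lra.
by have := aux _ h1; have := aux _ h2; lra.
Qed.

Lemma contR_polar F r t : rcont F (polar r t) -> contR (fun t => F (polar r t)) t.
Proof.
move=> H e /H[d d0 Hd]; have [d' d'0 Hd'] := polar_cont r t d0.
by exists d' => // t' /Hd'/Hd.
Qed.

Lemma circ_int_cont F r : 0 <= r -> (forall z, cmod z = r -> rcont F z) ->
  circ_int F r.
Proof.
move=> r0 H; apply: seg_integrable => t _; apply: contR_polar; apply: H.
by rewrite cmod_polar.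
Qed.

Lemma circ_cst c r : circ (fun=> c) r = c.
Proof.
rewrite /circ -/(seg _ _ _) seg_cst ?ltW ?twopi_gt0//.
by rewrite subr0 mulrC mulfK// gt_eqF// twopi_gt0.
Qed.

Lemma circ_int_cst c r : circ_int (fun=> c) r.
Proof. by apply: seg_integrable => t _; exact: contR_cst. Qed.

Lemma circ_intD F G r : circ_int F r -> circ_int G r ->
  circ_int (fun z => F z + G z) r.
Proof.
move=> iF iG; have := @integrableD _ _ _ mu _ (measurable_itv `[0, 2 * pi]%R) _ _ iF iG.
by apply: eq_integrable => // t _.
Qed.

Lemma circ_intZ F r c : circ_int F r -> circ_int (fun z => c * F z) r.
Proof.
move=> iF; have := @integrableZl _ _ _ mu _ (measurable_itv `[0, 2 * pi]%R) c _ iF.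
by apply: eq_integrable => // t _.
Qed.

Lemma circD F G r : circ_int F r -> circ_int G r ->
  circ (fun z => F z + G z) r = circ F r + circ G r.
Proof. by move=> iF iG; rewrite /circ RintegralD// mulrDr. Qed.

Lemma circZ F r c : circ_int F r -> circ (fun z => c * F z) r = c * circ F r.
Proof. by move=> iF; rewrite /circ RintegralZl// mulrCA. Qed.

Lemma circ_intN F r : circ_int F r -> circ_int (fun z => - F z) r.
Proof.
move=> /(@circ_intZ _ _ (-1)); apply: eq_integrable => // t _ /=.
by rewrite mulN1r.
Qed.

Lemma circN F r : circ_int F r -> circ (fun z => - F z) r = - circ F r.
Proof.
move=> iF; rewrite -mulN1r -circZ//; congr (_ * _).
by apply: eq_Rintegral => t _; rewrite mulN1r.
Qed.

Lemma circB F G r : circ_int F r -> circ_int G r ->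
  circ (fun z => F z - G z) r = circ F r - circ G r.
Proof. by move=> iF iG; rewrite circD ?circN//; exact: circ_intN. Qed.

Lemma circ_le F G r : 0 <= r -> circ_int F r -> circ_int G r ->
  (forall z, cmod z = r -> F z <= G z) -> circ F r <= circ G r.
Proof.
move=> r0 iF iG H; rewrite /circ ler_pM2l ?invr_gt0 ?twopi_gt0//.
apply: le_Rintegral => // t _; apply: H; exact: cmod_polar.
Qed.

Lemma circ_ext F G r : 0 <= r -> (forall z, cmod z = r -> F z = G z) ->
  circ F r = circ G r.
Proof.
move=> r0 H; rewrite /circ; congr (_ * _); apply: eq_Rintegral => t _.
by rewrite H// cmod_polar.
Qed.

Lemma circ_int_ext F G r : 0 <= r -> (forall z, cmod z = r -> F z = G z) ->
  circ_int F r -> circ_int G r.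
Proof.
by move=> r0 H; apply: eq_integrable => // t _ /=; rewrite H// cmod_polar.
Qed.

Lemma circ_bound F r (M : R) : 0 <= r -> circ_int F r ->
  (forall z, cmod z = r -> `|F z| <= M) -> `|circ F r| <= M.
Proof.
move=> r0 iF H; rewrite ler_norml.
have -> : - M = circ (fun=> - M) r by rewrite circ_cst.
have {2}-> : M = circ (fun=> M) r by rewrite circ_cst.
apply/andP; split; apply: circ_le => //; try exact: circ_int_cst.
  by move=> z /H; rewrite ler_norml => /andP[].
by move=> z /H; rewrite ler_norml => /andP[].
Qed.

(* Goursat's lemma for f(exp w) on [ln r1, ln r2] x [0, 2 pi]: the two sides
   parallel to the real axis cancel by periodicity. *)
Lemma circ_annulus f r1 r2 : 0 < r1 -> r1 <= r2 ->
  (forall z, r1 <= cmod z <= r2 -> cdiff f z) ->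
  circ (fun z => complex.Re (f z)) r1 = circ (fun z => complex.Re (f z)) r2.
Proof.
move=> r10 r12 df; have r20 := lt_le_trans r10 r12.
pose F w := f (cexp w).
have dF u t : ln r1 <= u <= ln r2 -> 0 <= t <= 2 * pi -> cdiff F (u +i* t)%C.
  move=> /andP[u1 u2] _; apply: cdiff_comp.
    by exists (cexp (u +i* t)%C); exact: cderiv_cexp.
  apply: df; rewrite cmod_polar ?expR_ge0//=.
  have -> : r1 = expR (ln r1) by rewrite lnK.
  have -> : r2 = expR (ln r2) by rewrite lnK.
  by rewrite !ler_expR u1.
have := goursat_rect (_ : ln r1 <= ln r2) (ltW twopi_gt0) dF.
rewrite ler_ln ?posrE// => /(_ r12); rewrite /rect_int.
have E2 : (fun u => imF F u 0 - imF F u (2 * pi)) = fun=> 0.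
  apply/funext => u; rewrite /imF /F /cexp /= -[2 * pi]add0r polar_periodic.
  by rewrite subrr.
rewrite E2 seg_cst ?ler_ln// mul0r addr0.
rewrite segB.
- rewrite /seg /reF /F /cexp/= !lnK ?posrE// => /eqP; rewrite subr_eq0 => /eqP.
  by rewrite /circ => ->.
- move=> t ht; have [] // := ccont_slices (cdiff_ccont (dF (ln r2) t _ ht)).
  by rewrite lexx andbT ler_ln.
- move=> t ht; have [] // := ccont_slices (cdiff_ccont (dF (ln r1) t _ ht)).
  by rewrite lexx ler_ln.
Qed.

Lemma ccont_unif_circ f r : 0 <= r -> (forall z, cmod z = r -> ccont f z) ->
  forall e : R, 0 < e -> exists2 d : R, 0 < d & forall r' t, `|r' - r| < d ->
    0 <= t <= 2 * pi -> cmod (f (polar r' t) - f (polar r t)) < e.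
Proof.
move=> r0 cf e e0.
(* [Q] ignores y and h: only the angle is bisected. *)
pose Q (x y w h : R) := exists2 d : R, 0 < d & forall r' t, `|r' - r| < d ->
  x <= t <= x + w -> cmod (f (polar r' t) - f (polar r t)) < e.
suff : Q 0 0 (2 * pi) 0.
  by move=> [d d0 Hd]; exists d => // r' t; rewrite -(add0r (2 * pi)); exact: Hd.
apply: (@bisect_rect _ Q); rewrite ?(ltW twopi_gt0)//.
  move=> x y w h _ _ _ _ w0 h0 [d1 d10 H1] [d2 d20 H2] _ _.
  exists (Num.min d1 d2); first by rewrite lt_min d10.
  move=> r' t; rewrite lt_min => /andP[h1 h2] /andP[t1 t2].
  have [tw|tw] := leP t (x + w); first by apply: H1 => //; rewrite t1.
  by apply: H2 => //; rewrite ltW//=; lra.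
move=> a b _ _; have [d d0 Hd] := cf (polar r a) (cmod_polar a r0) (e / 2)
  ltac:(by rewrite divr_gt0).
have d2 : 0 < d / 2 by rewrite divr_gt0.
have [d' d'0 Hd'] := polar_cont r a d2.
exists d' => // x y w h _ _ _ _ xa _ wd _.
exists (d / 2) => // r' t rd ht.
have ta : `|t - a| < d' by rewrite ltr_norml; lra.
have p1 := Hd' _ ta.
have p2 : cmod (polar r' t - polar r t) < d / 2.
  have -> : polar r' t - polar r t = polar (r' - r) t.
    by apply/eqP; rewrite eq_complex /= !mulrBl !eqxx.
  apply: le_lt_trans rd.
  have -> : polar (r' - r) t = ((r' - r)%:C)%C * polar 1 t.
    by apply/eqP; rewrite eq_complex /=; apply/andP; split; apply/eqP; ring.
  by rewrite cmodM cmod_real cmod_polar// mulr1.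
have q1 := Hd (polar r t) ltac:(by lra).
have q2 : cmod (f (polar r' t) - f (polar r a)) < e / 2.
  apply: Hd; rewrite -(subrKA (polar r t)).
  by apply: le_lt_trans (cmodD _ _) _; lra.
rewrite -(subrKA (f (polar r a))).
apply: le_lt_trans (cmodD _ _) _; rewrite (cmodBC (f (polar r a))); lra.
Qed.

Lemma circ_close f r1 r2 e : 0 <= r1 -> 0 <= r2 ->
  circ_int (fun z => complex.Re (f z)) r1 -> circ_int (fun z => complex.Re (f z)) r2 ->
  (forall t, 0 <= t <= 2 * pi -> cmod (f (polar r1 t) - f (polar r2 t)) <= e) ->
  `|circ (fun z => complex.Re (f z)) r1 - circ (fun z => complex.Re (f z)) r2| <= e.
Proof.
move=> r10 r20 i1 i2 H.
rewrite /circ -mulrBr -RintegralB// normrM ger0_norm; last first.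
  by rewrite invr_ge0 ltW// twopi_gt0.
rewrite mulrC ler_pdivrMr ?twopi_gt0//.
have i12 : mu.-integrable `[0, 2 * pi] (EFin \o (fun t =>
    complex.Re (f (polar r1 t)) - complex.Re (f (polar r2 t)))).
  have := @integrableB _ _ _ mu _ (measurable_itv `[0, 2 * pi]%R) _ _ i1 i2.
  by apply: eq_integrable => // t _.
apply: le_trans (le_normr_Rintegral _ i12) _ => //.
have := @seg_cst R 0 (2 * pi) e (ltW twopi_gt0); rewrite subr0 => <-.
apply: le_Rintegral => //.
- by apply: integrable_norm.
- by apply: seg_integrable => *; exact: contR_cst.
by move=> t; rewrite /= in_itv/= => /H; apply: le_trans; rewrite -ReB norm_Re_le.
Qed.

(** The mean is constant in the radius on either side of rho, continuous at rho, and tends to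
    [Re (f 0)] at radius 0. An exceptional circle is allowed because the difference quotient in
    Cauchy's formula is at first only continuous at one point, and the argument by annuli cannot
    tell that point from its whole circle. *)
Lemma circ_disc f r rho R1 : 0 < r < R1 ->
  (forall z, cmod z < R1 -> ccont f z) ->
  (forall z, 0 < cmod z < R1 -> cmod z != rho -> cdiff f z) ->
  circ (fun z => complex.Re (f z)) r = complex.Re (f 0).
Proof.
move=> /andP[r0 rR] cf df.
set M := circ _.
have iM s : 0 <= s < R1 -> circ_int (fun z => complex.Re (f z)) s.
  by move=> /andP[s0 sR]; apply: circ_int_cont => // z zs; apply/rcont_Re/cf; rewrite zs.
have eqM s1 s2 : 0 < s1 -> s1 <= s2 -> s2 < R1 -> (s2 < rho) || (rho < s1) -> M s1 = M s2.
  move=> s10 s12 s2R h; apply: circ_annulus => // z /andP[z1 z2]; apply: df.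
    by rewrite (lt_le_trans s10 z1) (le_lt_trans z2 s2R).
  by case/orP: h => h; [rewrite lt_eqF// (le_lt_trans z2)|rewrite gt_eqF// (lt_le_trans h)].
suff H (e : R) : 0 < e -> `|M r - complex.Re (f 0)| <= 3 * e.
  apply/eqP; rewrite -subr_eq0 -normr_le0; apply/ler_addgt0Pl => e e0; rewrite addr0.
  by have := H (e / 3) ltac:(by rewrite divr_gt0); rewrite mulrC divfK.
move=> e0.
have near s : 0 < s < R1 -> exists2 d : R, 0 < d &
    forall s', `|s' - s| < d -> 0 < s' < R1 -> `|M s' - M s| <= e.
  move=> /andP[s0 sR].
  have [d d0 Hd] := @ccont_unif_circ f s (ltW s0) ltac:(by move=> z zs; apply: cf; rewrite zs) e e0.
  exists d => // s' s's /andP[s'0 s'R]; apply: circ_close; rewrite ?(ltW s0) ?(ltW s'0)//.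
  - by apply: iM; rewrite ltW.
  - by apply: iM; rewrite ltW.
  by move=> t ht; apply/ltW/Hd.
have [d d0 Hd] := cf 0 ltac:(by rewrite cmod0 (lt_trans r0)) e e0.
have near0 s : 0 < s -> s < d -> s < R1 -> `|M s - complex.Re (f 0)| <= e.
  move=> s0 sd sR; rewrite -(circ_cst (complex.Re (f 0)) s) -circB.
  - apply: circ_bound; rewrite ?(ltW s0)//.
      by apply: circ_intD; [apply: iM; rewrite ltW|exact: circ_int_cst].
    by move=> z zs; rewrite -ReB (le_trans (norm_Re_le _))// ltW// Hd// subr0 zs.
  - by apply: iM; rewrite ltW.
  - exact: circ_int_cst.
have [rr|rr] := boolP ((r < rho) || (rho <= 0)).
  pose s := Num.min r d / 2.
  have m0 : 0 < Num.min r d by rewrite lt_min r0.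
  have : Num.min r d <= r by rewrite ge_min lexx.
  have : Num.min r d <= d by rewrite ge_min lexx orbT.
  move=> md mr; have s0 : 0 < s by rewrite divr_gt0.
  rewrite -(eqM s r)//; [|rewrite /s; lra|].
    by apply: le_trans (near0 s s0 _ _) _; rewrite /s; lra.
  by case/orP: rr => [->//|h]; rewrite (le_lt_trans h) ?orbT.
move: rr; rewrite negb_or -leNgt -ltNge => /andP[rr rho0].
have rhoR : 0 < rho < R1 by rewrite rho0 (le_lt_trans rr).
have [d1 d10 H1] := near rho rhoR.
(* The same s serves as a radius close to 0 and as a distance from rho; s <= rho / 2 keeps s below
   rho - s, and the mean is constant between these radii. *)
pose s := Num.min rho (Num.min d d1) / 2.
have m0 : 0 < Num.min rho (Num.min d d1) by rewrite !lt_min rho0 d0.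
have mrho : Num.min rho (Num.min d d1) <= rho by rewrite ge_min lexx.
have md : Num.min rho (Num.min d d1) <= d by rewrite !ge_min lexx orbT.
have md1 : Num.min rho (Num.min d d1) <= d1 by rewrite !ge_min lexx !orbT.
have s0 : 0 < s by rewrite divr_gt0.
have sm : s = Num.min rho (Num.min d d1) / 2 by [].
have h1 : `|M s - complex.Re (f 0)| <= e by apply: near0 => //; lra.
have h2 : `|M (rho - s) - M rho| <= e.
  by apply: H1; [rewrite addrC addKr normrN gtr0_norm//; lra|apply/andP; split; lra].
have h3 : M s = M (rho - s) by apply: eqM => //; [lra|lra|apply/orP; left; lra].
have h4 : `|M r - M rho| <= e.
  move: rr; rewrite le_eqVlt => /predU1P[->|rr]; first by rewrite subrr normr0 ltW.
  pose s' := Num.min (r - rho) d1 / 2.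
  have m'0 : 0 < Num.min (r - rho) d1 by rewrite lt_min d10 andbT subr_gt0.
  have m'1 : Num.min (r - rho) d1 <= r - rho by rewrite ge_min lexx.
  have m'2 : Num.min (r - rho) d1 <= d1 by rewrite ge_min lexx orbT.
  have s'0 : 0 < s' by rewrite divr_gt0.
  have s'm : s' = Num.min (r - rho) d1 / 2 by [].
  rewrite -(eqM (rho + s') r)//; [|lra|lra|apply/orP; right; lra].
  by apply: H1; [rewrite addrC addKr gtr0_norm//; lra|apply/andP; split; lra].
rewrite h3 in h1.
have -> : M r - complex.Re (f 0) = (M r - M rho) - (M (rho - s) - M rho) +
   (M (rho - s) - complex.Re (f 0)) by ring.
apply: le_trans (ler_normD _ _) _.
have := ler_normB (M r - M rho) (M (rho - s) - M rho); lra.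
Qed.

End CircleMean.

(** * Cauchy's formula, removable singularities and orders of zeros *)

Section CauchyFormula.
Variable R : realType.
Local Notation C := (cplx R).
Implicit Types (f g : C -> C) (r : R) (z w p : C).

Lemma bounded_circ f r : 0 <= r -> (forall z, cmod z = r -> ccont f z) ->
  exists2 M : R, 0 <= M & forall z, cmod z = r -> cmod (f z) <= M.
Proof.
move=> r0 cf.
pose Q (x y w h : R) := exists M : R, forall t, x <= t <= x + w ->
  cmod (f (polar r t)) <= M.
suff [M HM] : Q 0 0 (2 * pi) 0.
  exists (Num.max 0 M); first by rewrite le_max lexx.
  move=> z zr; have [t ht zt] := polar_exists z.
  by rewrite le_max zt zr HM ?add0r ?orbT.
apply: (@bisect_rect _ Q); rewrite ?(ltW (twopi_gt0 R))//.
  move=> x y w h _ _ _ _ w0 h0 [M1 H1] [M2 H2] _ _.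
  exists (Num.max M1 M2) => t /andP[t1 t2]; rewrite le_max.
  have [tw|tw] := leP t (x + w); first by rewrite H1// t1.
  by rewrite H2 ?orbT// ltW//=; lra.
move=> a b _ _; have [d d0 Hd] := cf (polar r a) (cmod_polar a r0) 1 ltr01.
have [d' d'0 Hd'] := polar_cont r a d0.
exists d' => // x y w h _ _ _ _ xa _ wd _.
exists (cmod (f (polar r a)) + 1) => t ht.
have ta : `|t - a| < d' by rewrite ltr_norml; lra.
have := Hd _ (Hd' _ ta) => h1.
have := cmodD (f (polar r t) - f (polar r a)) (f (polar r a)).
by rewrite subrK; lra.
Qed.

Definition cmean f r : C :=
  (circ (fun z => complex.Re (f z)) r +i* circ (fun z => complex.Im (f z)) r)%C.

Definition cont_circ f r := forall z, cmod z = r -> ccont f z.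

Lemma rcont_Im f z : ccont f z -> rcont (fun w => complex.Im (f w)) z.
Proof.
move=> H e /H[d d0 Hd]; exists d => // w /Hd; apply: le_lt_trans.
by rewrite -ImB norm_Im_le.
Qed.

Lemma cont_circ_int f r : 0 <= r -> cont_circ f r ->
  circ_int (fun z => complex.Re (f z)) r /\ circ_int (fun z => complex.Im (f z)) r.
Proof.
move=> r0 H; split; apply: circ_int_cont => // z /H.
  exact: rcont_Re.
exact: rcont_Im.
Qed.

Lemma cmean_ext f g r : 0 <= r -> (forall z, cmod z = r -> f z = g z) ->
  cmean f r = cmean g r.
Proof.
by move=> r0 H; congr (_ +i* _)%C; apply: circ_ext => // z zr; rewrite H.
Qed.

Lemma cmeanD f g r : 0 <= r -> cont_circ f r -> cont_circ g r ->
  cmean (fun z => f z + g z) r = cmean f r + cmean g r.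
Proof.
move=> r0 /(cont_circ_int r0)[f1 f2] /(cont_circ_int r0)[g1 g2].
apply/eqP; rewrite eq_complex /=; apply/andP; split; apply/eqP.
  by rewrite -circD//; apply: circ_ext => // z _; rewrite ReD.
by rewrite -circD//; apply: circ_ext => // z _; rewrite ImD.
Qed.

Lemma cmeanZ f r c : 0 <= r -> cont_circ f r ->
  cmean (fun z => c * f z) r = c * cmean f r.
Proof.
move=> r0 /(cont_circ_int r0)[f1 f2].
apply/eqP; rewrite eq_complex ReM ImM /=; apply/andP; split; apply/eqP.
  rewrite -!circZ// -circB//; try exact: circ_intZ.
  by apply: circ_ext => // z _; rewrite ReM.
rewrite -!circZ// -circD//; try exact: circ_intZ.
by apply: circ_ext => // z _; rewrite ImM.
Qed.

Lemma cmean_cst c r : cmean (fun=> c) r = c.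
Proof. by rewrite /cmean !circ_cst; case: c. Qed.

Lemma cont_circZ f r c : cont_circ f r -> cont_circ (fun z => c * f z) r.
Proof. by move=> H z /H cf; apply: ccontM => //; exact: ccont_cst. Qed.

Lemma cmeanB f g r : 0 <= r -> cont_circ f r -> cont_circ g r ->
  cmean (fun z => f z - g z) r = cmean f r - cmean g r.
Proof.
move=> r0 cf cg; rewrite -mulN1r -cmeanZ// -cmeanD//; last exact: cont_circZ.
by apply: cmean_ext => // z _; rewrite mulN1r.
Qed.

Lemma cmean_bound f r (M : R) : 0 <= r -> cont_circ f r ->
  (forall z, cmod z = r -> cmod (f z) <= M) -> cmod (cmean f r) <= 2 * M.
Proof.
move=> r0 /(cont_circ_int r0)[f1 f2] H.
apply: le_trans (cmod_le_ReIm _) _; rewrite mulr_natl mulr2n; apply: lerD.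
  by apply: circ_bound => // z /H; apply: le_trans; exact: norm_Re_le.
by apply: circ_bound => // z /H; apply: le_trans; exact: norm_Im_le.
Qed.

(** Applying a result on real parts to -i f yields the one on imaginary parts. *)
Lemma ReiIm (z : C) : complex.Re (- 'i%C * z) = complex.Im z.
Proof. by case: z => a b /=; ring. Qed.

Lemma cmean_annulus f r1 r2 : 0 < r1 -> r1 <= r2 ->
  (forall z, r1 <= cmod z <= r2 -> cdiff f z) -> cmean f r1 = cmean f r2.
Proof.
move=> r10 r12 df; congr (_ +i* _)%C; first exact: circ_annulus.
have r20 := lt_le_trans r10 r12.
have := @circ_annulus R (fun z => - 'i%C * f z) r1 r2 r10 r12.
rewrite (@circ_ext _ _ (fun z => complex.Im (f z)) r1) ?ltW//; last by move=> z _; exact: ReiIm.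
rewrite (@circ_ext _ _ (fun z => complex.Im (f z)) r2) ?ltW//; last by move=> z _; exact: ReiIm.
by apply=> z /df dz; apply: cdiffM => //; exact: cdiff_cst.
Qed.

Lemma cmean_disc f r rho R1 : 0 < r < R1 ->
  (forall z, cmod z < R1 -> ccont f z) ->
  (forall z, 0 < cmod z < R1 -> cmod z != rho -> cdiff f z) ->
  cmean f r = f 0.
Proof.
move=> rR cf df; apply/eqP; rewrite eq_complex /=; apply/andP; split; apply/eqP.
  exact: circ_disc rR cf df.
have r0 : 0 <= r by case/andP: rR => /ltW.
have := @circ_disc R (fun z => - 'i%C * f z) r rho R1 rR.
rewrite (@circ_ext _ _ (fun z => complex.Im (f z)) r) //; last by move=> z _; exact: ReiIm.
rewrite ReiIm; apply=> z hz.
  by apply: ccontM; [exact: ccont_cst|exact: cf].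
by move=> zr; apply: cdiffM; [exact: cdiff_cst|exact: df].
Qed.

Lemma circ_ne z0 z r : cmod z0 < r -> cmod z = r -> z - z0 != 0.
Proof.
move=> z0r zr; rewrite subr_eq0; apply/negP => /eqP zz.
by move: z0r; rewrite -zr zz ltxx.
Qed.

(** The kernel is 1 + z0 / (w - z0). The mean of the second term is the same for all radii s >= r
    and is O(1/s), hence 0. *)
Lemma cauchy_kernel z0 r : cmod z0 < r -> cmean (fun w => w / (w - z0)) r = 1.
Proof.
move=> z0r; have r0 : 0 < r := le_lt_trans (cmod_ge0 _) z0r.
have dk s z : r <= s -> cmod z = s -> cdiff (fun w => z0 / (w - z0)) z.
  move=> rs zs; apply: cdiffM; first exact: cdiff_cst.
  apply: cdiffV; first by apply: (@circ_ne _ _ s) => //; exact: lt_le_trans rs.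
  by apply: cdiffB; [exact: cdiff_id|exact: cdiff_cst].
have ck s : r <= s -> cont_circ (fun w => z0 / (w - z0)) s.
  by move=> rs z zs; apply: cdiff_ccont; exact: dk rs zs.
rewrite (@cmean_ext _ (fun w => 1 + z0 / (w - z0))) ?ltW//; last first.
  by move=> z zr; have := circ_ne z0r zr => zz; field.
rewrite cmeanD ?(ltW r0)//; [|by move=> *; exact: ccont_cst|exact: ck].
rewrite cmean_cst -[RHS]addr0; congr (1 + _).
have K s : r <= s -> cmod (cmean (fun w => z0 / (w - z0)) r) <= 2 * (cmod z0 / (s - cmod z0)).
  move=> rs; have sz : 0 < s - cmod z0 by rewrite subr_gt0 (lt_le_trans z0r).
  rewrite (cmean_annulus r0 rs); last first.
    by move=> z /andP[rz _]; exact: (dk (cmod z)).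
  apply: cmean_bound; rewrite ?(le_trans (ltW r0))//; first exact: ck.
  move=> z zs; rewrite cmodM cmodV ler_wpM2l ?cmod_ge0// lef_pV2 ?posrE//.
    by rewrite -zs cmodB_ge.
  by rewrite cmod_gt0; apply: (@circ_ne _ _ s) => //; exact: lt_le_trans rs.
apply/eqP; rewrite -cmod_eq0 -(@ger0_norm _ (cmod _)) ?cmod_ge0// -normr_le0 normr_id.
rewrite ger0_norm ?cmod_ge0//; apply/ler_addgt0Pl => e e0; rewrite addr0.
have h0 : 0 <= 2 * cmod z0 / e.
  by apply: divr_ge0; [rewrite mulr_ge0// cmod_ge0|exact: ltW].
(* At this radius s the denominator s - |z0| is r + 2 |z0| / e, which makes the bound at most e. *)
apply: le_trans (K (r + cmod z0 + 2 * cmod z0 / e) _) _.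
  by have := cmod_ge0 z0; lra.
have p : 0 < r + 2 * cmod z0 / e by lra.
have -> : r + cmod z0 + 2 * cmod z0 / e - cmod z0 = r + 2 * cmod z0 / e by ring.
rewrite mulrA ler_pdivrMr// mulrDr [e * (_ / e)]mulrC divfK ?gt_eqF//.
by rewrite lerDr mulr_ge0// ltW.
Qed.

(** With dt = dw / (i w), the factor w / (w - z0) is the usual Cauchy kernel. At 0 only continuity
    of f is assumed, which lets the formula prove that a singularity at 0 is removable. *)
Lemma cauchy_formula f r R1 z0 : r < R1 ->
  (forall z, cmod z < R1 -> ccont f z) ->
  (forall z, 0 < cmod z < R1 -> cdiff f z) -> cmod z0 < r ->
  cmean (fun w => f w * (w / (w - z0))) r = f z0.
Proof.
move=> rR cf df z0r; have r0 : 0 < r := le_lt_trans (cmod_ge0 _) z0r.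
have rr : 0 < r < R1 by rewrite r0.
have [z00|z00] := eqVneq z0 0.
  rewrite z00; have <- : cmean f r = f 0.
    by apply: (cmean_disc (rho := 0) rr) => // z hz _; exact: df.
  apply: cmean_ext; first exact: ltW.
  move=> z zr; rewrite subr0 divff ?mulr1//.
  by rewrite -cmod_gt0 zr.
have cz0 : 0 < cmod z0 by rewrite cmod_gt0.
have [l /cderivP Hl] := df z0 ltac:(by rewrite cz0 (lt_trans z0r)).
(* The factor z makes [h] vanish at 0, so its mean is 0. Differentiability of [h] is shown off the
   circle |z| = |z0| only, the exceptional radius that [cmean_disc] admits. *)
pose h z := if z == z0 then z0 * l else z * ((f z - f z0) / (z - z0)).
have hE z : z != z0 -> h z = z * ((f z - f z0) / (z - z0)).
  by move=> zz; rewrite /h (negbTE zz).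
have nearE z : z != z0 -> forall w, cmod (w - z) < cmod (z - z0) ->
    w * ((f w - f z0) / (w - z0)) = h w.
  move=> zz w wz; rewrite hE//; apply/negP => /eqP wz0.
  by move: wz; rewrite wz0 cmodBC ltxx.
have zgt z : z != z0 -> 0 < cmod (z - z0) by rewrite cmod_gt0 subr_eq0.
have hc z : cmod z < R1 -> ccont h z.
  move=> zR; have [->|zz] := eqVneq z z0.
    apply/ccont_clim; rewrite {2}/h eqxx.
    apply: (eq_clim (ltr01 : 0 < (1 : R)) _ (climM (clim_id z0) Hl)) => w /andP[w0 _].
    by rewrite hE// -subr_eq0 -cmod_gt0.
  apply: (eq_ccont (zgt _ zz) (nearE _ zz)).
  apply: ccontM; first exact: ccont_id.
  apply: ccontM; first by apply: ccontD; [exact: cf|exact: ccont_cst].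
  apply: ccontV; first by rewrite subr_eq0.
  by apply: ccontD; [exact: ccont_id|exact: ccont_cst].
have hd z : 0 < cmod z < R1 -> cmod z != cmod z0 -> cdiff h z.
  move=> zR zr; have zz : z != z0 by apply/negP => /eqP z1; rewrite z1 eqxx in zr.
  apply: (eq_cdiff (zgt _ zz) (nearE _ zz)).
  apply: cdiffM; first exact: cdiff_id.
  apply: cdiffM; first by apply: cdiffB; [exact: df|exact: cdiff_cst].
  apply: cdiffV; first by rewrite subr_eq0.
  by apply: cdiffB; [exact: cdiff_id|exact: cdiff_cst].
have := cmean_disc rr hc hd.
rewrite hE 1?eq_sym// mul0r.
have ck : cont_circ (fun w => w / (w - z0)) r.
  move=> z zr; apply: ccontM; first exact: ccont_id.
  apply: ccontV; first exact: circ_ne z0r zr.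
  by apply: ccontD; [exact: ccont_id|exact: ccont_cst].
rewrite (@cmean_ext _ (fun w => f w * (w / (w - z0)) - f z0 * (w / (w - z0)))) ?ltW//; last first.
  move=> z zr; rewrite hE; last by rewrite -subr_eq0; exact: circ_ne z0r zr.
  ring.
rewrite cmeanB ?(ltW r0)//; last 2 first.
- by move=> z zr; apply: ccontM; [apply: cf; rewrite zr|exact: ck].
- exact: cont_circZ.
rewrite cmeanZ ?(ltW r0)// cauchy_kernel// mulr1.
by move=> /eqP; rewrite subr_eq0 => /eqP.
Qed.

Lemma cont_kernel r z0 k : cmod z0 < r -> cont_circ (fun w => ((w - z0) ^+ k)^-1) r.
Proof.
move=> z0r z zr; apply: ccontV.
  by rewrite expf_neq0//; exact: circ_ne z0r zr.
apply: cdiff_ccont; apply: cdiffX.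
by apply: cdiffB; [exact: cdiff_id|exact: cdiff_cst].
Qed.

(** Cauchy's formula suggests the derivative: it is the mean of f w / w. The remainder of the
    kernel, w / (w - z) - 1 - z / w = z^2 / (w (w - z)), is quadratic in z. *)
Lemma removable0 f R1 : 0 < R1 -> ccont f 0 ->
  (forall z, 0 < cmod z < R1 -> cdiff f z) -> cdiff f 0.
Proof.
move=> R10 cf0 df.
have cf z : cmod z < R1 -> ccont f z.
  move=> zR; have [->//|z0] := eqVneq z 0.
  by apply: cdiff_ccont; apply: df; rewrite cmod_gt0 z0.
pose r : R := R1 / 2; have r0 : 0 < r by rewrite divr_gt0.
have rR : r < R1 by rewrite /r; lra.
clearbody r.
have ccf : cont_circ f r by move=> z zr; apply: cf; rewrite zr.
have [M M0 HM] := bounded_circ (ltW r0) ccf.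
exists (cmean (fun w => f w * (w ^+ 1)^-1) r).
move=> e e0.
(* For |z| < r / 2 the distance |w - z| is at least r / 2; the leading 2 comes from [cmean_bound],
   which treats real and imaginary parts separately. *)
pose K := 2 * (M / (r * (r / 2))).
have K0 : 0 <= K by rewrite mulr_ge0// divr_ge0// mulr_ge0// ltW// divr_gt0.
exists (Num.min (r / 2) (e / (K + 1))).
  by rewrite lt_min divr_gt0//= divr_gt0// ltr_pwDr.
move=> z; rewrite subr0 lt_min => /andP[zr ze].
have zr' : cmod z < r by apply: lt_trans zr _; lra.
have c1 : cont_circ (fun w => (w ^+ 1)^-1) r.
  move=> w wr; have := @cont_kernel r 0 1 _ w wr; rewrite cmod0 => /(_ r0).
  by apply: eq_ccont ltr01 _ => u _; rewrite subr0.
have c2 : cont_circ (fun w => f w * (w / (w - z))) r.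
  move=> w wr; apply: ccontM; first exact: ccf.
  apply: ccontM; first exact: ccont_id.
  by apply: (eq_ccont (ltr01 : 0 < (1 : R)) _ (cont_kernel 1 zr' wr)).
have c3 : cont_circ (fun w => f w * (w ^+ 1)^-1) r.
  by move=> w wr; apply: ccontM; [exact: ccf|exact: c1].
rewrite -(cauchy_formula rR cf df zr') -{1}(@cauchy_formula f r R1 0)//; last by rewrite cmod0.
rewrite (@cmean_ext (fun w => f w * (w / (w - 0))) f) ?(ltW r0)//; last first.
  by move=> w wr; rewrite subr0 divff ?mulr1// -cmod_gt0 wr.
rewrite -cmeanB ?(ltW r0)// mulrC -cmeanZ ?(ltW r0)//.
rewrite -cmeanB ?(ltW r0)//; last 2 first.
- by move=> w wr; apply: ccontD; [exact: c2|]; have := cont_circZ (-1) ccf wr;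
    apply: eq_ccont ltr01 _ => u _; rewrite mulN1r.
- exact: cont_circZ.
have bound w : cmod w = r -> cmod (f w * (w / (w - z)) - f w - z * (f w * (w ^+ 1)^-1))
    <= M / (r * (r / 2)) * cmod z ^+ 2.
  move=> wr; have w0 : w != 0 by rewrite -cmod_gt0 wr.
  have wz := circ_ne zr' wr.
  have -> : f w * (w / (w - z)) - f w - z * (f w * (w ^+ 1)^-1) =
    f w * z ^+ 2 / (w * (w - z)) by field; rewrite w0 wz.
  rewrite (cmodM (f w * z ^+ 2)) (cmodM (f w)) cmodV (cmodM w) cmodX wr mulrAC.
  rewrite ler_wpM2r ?exprn_ge0 ?cmod_ge0//.
  apply: ler_pM; [exact: cmod_ge0| |exact: HM|].
    by rewrite invr_ge0; apply: mulr_ge0; [exact: ltW|exact: cmod_ge0].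
  have := cmodB_ge w z; rewrite wr => h.
  rewrite lef_pV2 ?posrE ?mulr_gt0// ?ler_pM2l//; lra.
have cb := cmean_bound (ltW r0) _ bound; apply: (le_trans (cb _)).
  move=> w wr; have h1 := c2 w wr; have h2 := cont_circZ (-1) ccf wr.
  have h3 := cont_circZ (- z) c3 wr.
  apply: (eq_ccont (ltr01 : 0 < (1 : R)) _ (ccontD (ccontD h1 h2) h3)) => u _.
  by rewrite mulN1r mulNr.
rewrite mulrA -/K expr2 mulrA ler_wpM2r ?cmod_ge0//.
apply: le_trans (ler_wpM2l K0 (ltW ze)) _.
by rewrite mulrA ler_pdivrMr ?ltr_pwDr// mulrC ler_pM2l// lerDl.
Qed.

Lemma cdiff_shift f p z : cdiff f (z + p) -> cdiff (fun w => f (w + p)) z.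
Proof.
rewrite -{1}[z]mul1r => /cdiff_affine; apply: eq_cdiff (ltr01 : 0 < (1 : R)) _.
by move=> w _; rewrite mul1r.
Qed.

Lemma removable f p R1 : 0 < R1 -> ccont f p ->
  (forall z, 0 < cmod (z - p) < R1 -> cdiff f z) -> cdiff f p.
Proof.
move=> R10 cf df.
have : cdiff (fun w => f (w + p)) 0.
  apply: (removable0 R10).
    move=> e /cf[d d0 Hd]; exists d => // w; rewrite subr0 add0r => wd.
    by apply: Hd; rewrite addrK.
  by move=> z hz; apply: cdiff_shift; apply: df; rewrite addrK.
have -> : (0 : C) = p - p by rewrite subrr.
move=> /cdiff_shift; apply: eq_cdiff (ltr01 : 0 < (1 : R)) _ => w _.
by rewrite subrK.
Qed.

Lemma cauchy_estimate f r R1 (M : R) z : r < R1 ->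
  (forall w, cmod w < R1 -> cdiff f w) ->
  (forall w, cmod w = r -> cmod (f w) <= M) -> cmod z < r ->
  cmod (f z) <= 2 * (M * (r / (r - cmod z))).
Proof.
move=> rR df HM zr; have r0 : 0 < r := le_lt_trans (cmod_ge0 _) zr.
have cf w : cmod w < R1 -> ccont f w by move=> /df/cdiff_ccont.
rewrite -(@cauchy_formula f r R1 z rR cf) ?zr//; last by move=> w /andP[_ /df].
apply: cmean_bound; first exact: ltW.
  move=> w wr; apply: ccontM; first by apply: cf; rewrite wr.
  apply: ccontM; first exact: ccont_id.
  by apply: (eq_ccont (ltr01 : 0 < (1 : R)) _ (cont_kernel 1 zr wr)).
move=> w wr; rewrite !cmodM cmodV wr.
apply: ler_pM; [exact: cmod_ge0|by rewrite divr_ge0 ?(ltW r0)// cmod_ge0|exact: HM|].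
rewrite ler_pM2l// lef_pV2 ?posrE ?subr_gt0//; first by rewrite -wr cmodB_ge.
by rewrite cmod_gt0; exact: circ_ne zr wr.
Qed.

(** The difference of two Cauchy kernels contains the factor z - z'. This later controls g z - g (l
    z) uniformly along the telescoping radii. *)
Lemma holo_lipschitz f r s R1 : 0 <= s < r -> r < R1 ->
  (forall w, cmod w < R1 -> cdiff f w) ->
  exists2 K : R, 0 <= K & forall z z', cmod z <= s -> cmod z' <= s ->
    cmod (f z - f z') <= K * cmod (z - z').
Proof.
move=> /andP[s0 sr] rR df; have r0 : 0 < r := le_lt_trans s0 sr.
have cf w : cmod w < R1 -> ccont f w by move=> /df/cdiff_ccont.
have ccf : cont_circ f r by move=> z zr; apply: cf; rewrite zr.
have [M M0 HM] := bounded_circ (ltW r0) ccf.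
have df' w : 0 < cmod w < R1 -> cdiff f w by move=> /andP[_ /df].
have rs : 0 < r - s by rewrite subr_gt0.
exists (2 * (M * (r / ((r - s) * (r - s))))).
  by rewrite !mulr_ge0// ?invr_ge0 ?mulr_ge0 ?(ltW r0) ?(ltW rs).
move=> z z' zs z's.
have zr := le_lt_trans zs sr; have z'r := le_lt_trans z's sr.
have cc u : cmod u < r -> cont_circ (fun w => f w * (w / (w - u))) r.
  move=> ur w wr; apply: ccontM; first by apply: cf; rewrite wr.
  apply: ccontM; first exact: ccont_id.
  by apply: (eq_ccont (ltr01 : 0 < (1 : R)) _ (cont_kernel 1 ur wr)).
rewrite -(cauchy_formula rR cf df' zr) -(cauchy_formula rR cf df' z'r).
rewrite -cmeanB ?(ltW r0)//; try exact: cc.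
rewrite -!mulrA; apply: cmean_bound; first exact: ltW.
  move=> w wr; have h2 := cont_circZ (-1) (cc _ z'r) wr.
  apply: (eq_ccont (ltr01 : 0 < (1 : R)) _ (ccontD (cc _ zr _ wr) h2)) => u _.
  by rewrite mulN1r.
move=> w wr; have wz := circ_ne zr wr; have wz' := circ_ne z'r wr.
have -> : f w * (w / (w - z)) - f w * (w / (w - z')) =
  f w * (w * ((w - z) * (w - z'))^-1 * (z - z')) by field; rewrite wz wz'.
rewrite !cmodM cmodV cmodM wr !mulrA ler_wpM2r ?cmod_ge0//.
rewrite -!mulrA; apply: ler_pM; rewrite ?cmod_ge0 ?HM//.
  by rewrite mulr_ge0 ?(ltW r0)// invr_ge0 mulr_ge0 ?cmod_ge0.
rewrite ler_pM2l// lef_pV2 ?posrE ?mulr_gt0 ?cmod_gt0//.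
have := cmodB_ge w z; have := cmodB_ge w z'; rewrite wr => h1 h2.
by apply: ler_pM; rewrite ?(ltW rs)//; lra.
Qed.

Lemma holo_div f R1 : 0 < R1 -> (forall z, cmod z < R1 -> cdiff f z) -> f 0 = 0 ->
  exists2 g : C -> C, forall z, cmod z < R1 -> cdiff g z &
    forall z, cmod z < R1 -> f z = z * g z.
Proof.
move=> R10 df f0; have [l /cderivP Hl] := df 0 ltac:(by rewrite cmod0).
pose g z := if z == 0 then l else f z / z.
have gE z : z != 0 -> g z = f z / z by move=> z0; rewrite /g (negbTE z0).
have nearE z : z != 0 -> forall w, cmod (w - z) < cmod z -> f w / w = g w.
  move=> z0 w wz; rewrite gE//; apply/negP => /eqP w0.
  by move: wz; rewrite w0 sub0r cmodN ltxx.
have dg z : 0 < cmod z < R1 -> cdiff g z.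
  move=> /andP[z0 zR]; have z0' : z != 0 by rewrite -cmod_gt0.
  apply: (eq_cdiff z0 (nearE _ z0')); apply: cdiffM; first exact: df.
  by apply: cdiffV => //; exact: cdiff_id.
exists g => z zR; last first.
  have [->|z0] := eqVneq z 0; first by rewrite f0 mul0r.
  by rewrite gE// mulrC divfK.
have [->|z0] := eqVneq z 0; last by apply: dg; rewrite cmod_gt0 z0.
apply: (removable0 R10) => //; apply/ccont_clim.
have {1}-> : g 0 = l by rewrite /g eqxx.
apply: (eq_clim (ltr01 : 0 < (1 : R)) _ Hl) => w /andP[]; rewrite subr0 cmod_gt0 => w0 _.
by rewrite f0 !subr0 gE.
Qed.

Lemma expr_small (x e : R) : 0 <= x < 1 -> 0 < e -> exists n, x ^+ n < e.
Proof.
move=> /andP[x0 x1] e0.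
have := @cvg_expr R x; rewrite ger0_norm// => /(_ x1)/cvgrPdist_lt/(_ e e0).
case=> N _ /(_ N (leqnn N)) /=; rewrite sub0r normrN ger0_norm ?exprn_ge0// => h.
by exists N.
Qed.

(** If f can be divided by z indefinitely, then f = z^m g_m for every m, and the Cauchy estimate for
    g_m gives |f z| <= K (|z| / r)^m, as in Schwarz's lemma; letting m grow, f vanishes. No power
    series is involved. *)
Lemma holo_order0 f R1 : 0 < R1 -> (forall z, cmod z < R1 -> cdiff f z) ->
  (forall z, cmod z < R1 -> f z = 0) \/
  exists (m : nat) (g : C -> C), [/\ forall z, cmod z < R1 -> cdiff g z,
    g 0 != 0 & forall z, cmod z < R1 -> f z = z ^+ m * g z].
Proof.
move=> R10 df; apply: contrapT => /not_orP[nz no]; apply: nz => z zR.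
have gm (m : nat) : exists2 g : C -> C, forall z, cmod z < R1 -> cdiff g z &
    forall z, cmod z < R1 -> f z = z ^+ m * g z.
  elim: m => [|m [g dg gE]]; first by exists f => // w _; rewrite mul1r.
  have g0 : g 0 = 0.
    by apply/eqP/negPn/negP => g0; apply: no; exists m, g; split.
  have [h dh hE] := holo_div R10 dg g0; exists h => // w wR.
  by rewrite gE// hE// exprSr mulrA.
pose r := (cmod z + R1) / 2.
have zr : cmod z < r by rewrite /r; lra.
have rR : r < R1 by rewrite /r; lra.
clearbody r; have r0 : 0 < r := le_lt_trans (cmod_ge0 _) zr.
have ccf : cont_circ f r by move=> w wr; apply/cdiff_ccont/df; rewrite wr.
have [M M0 HM] := bounded_circ (ltW r0) ccf.
pose K := 2 * (M * (r / (r - cmod z))).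
have rz : 0 < r - cmod z by rewrite subr_gt0.
have K0 : 0 <= K.
  by apply: mulr_ge0 => //; apply: mulr_ge0 => //; apply: divr_ge0; exact: ltW.
have est m : cmod (f z) <= K * (cmod z / r) ^+ m.
  have [g dg gE] := gm m; rewrite gE// cmodM cmodX.
  have gM w : cmod w = r -> cmod (g w) <= M / r ^+ m.
    move=> wr; rewrite ler_pdivlMr ?exprn_gt0// mulrC -{1}wr -cmodX -cmodM -gE ?wr//.
    exact: HM.
  have := cauchy_estimate rR dg gM zr => h.
  apply: le_trans (ler_wpM2l _ h) _; first by rewrite exprn_ge0 ?cmod_ge0.
  rewrite expr_div_n /K; move: (r / (r - cmod z)) (r ^- m) => q u.
  by rewrite le_eqVlt; apply/orP; left; apply/eqP; ring.
apply/eqP; rewrite -cmod_eq0 eq_le cmod_ge0 andbT; apply/ler_addgt0Pl => e e0.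
rewrite addr0.
have zr1 : 0 <= cmod z / r < 1.
  by rewrite divr_ge0 ?cmod_ge0 ?(ltW r0)//= ltr_pdivrMr// mul1r.
have eK : 0 < e / (K + 1) by rewrite divr_gt0// ltr_pwDr.
have [n hn] := expr_small zr1 eK.
apply: le_trans (est n) _; apply: le_trans (ler_wpM2l K0 (ltW hn)) _.
by rewrite mulrA ler_pdivrMr ?ltr_pwDr// mulrC ler_pM2l// lerDl.
Qed.

Lemma holo_order f p R1 : 0 < R1 -> (forall z, cmod (z - p) < R1 -> cdiff f z) ->
  (forall z, cmod (z - p) < R1 -> f z = 0) \/
  exists (m : nat) (g : C -> C), [/\ forall z, cmod (z - p) < R1 -> cdiff g z,
    g p != 0 & forall z, cmod (z - p) < R1 -> f z = (z - p) ^+ m * g z].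
Proof.
move=> R10 df.
have [|H|[m [g [dg g0 gE]]]] := @holo_order0 (fun w => f (w + p)) R1 R10.
- by move=> z zR; apply: cdiff_shift; apply: df; rewrite addrK.
- by left=> z /H; rewrite subrK.
right; exists m, (fun z => g (z - p)); split; rewrite ?subrr//.
  by move=> z /dg; exact: cdiff_shift.
by move=> z /gE; rewrite subrK.
Qed.

End CauchyFormula.

(** * Functions on a circle up to finitely many points *)

Section ExceptionalPoints.
Variable R : realType.
Local Notation C := (cplx R).
Local Notation mu := (@lebesgue_measure R).
Local Notation D := (`[0, 2 * pi]%classic : set R).
Implicit Types (F G : C -> R) (f : C -> C) (r : R) (S : seq C).

Lemma polar_inj r (t t' : R) : 0 < r -> 0 <= t < 2 * pi -> 0 <= t' < 2 * pi ->
  polar r t = polar r t' -> t = t'.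
Proof.
move=> r0; wlog tt' : t t' / t <= t'.
  move=> H h h' e; have [tt'|/ltW tt'] := leP t t'; first exact: H.
  by apply/esym; apply: H.
move=> ht ht' [/(mulfI (lt0r_neq0 r0)) ec /(mulfI (lt0r_neq0 r0)) es].
apply/eqP; rewrite eq_le tt' andTb leNgt; apply/negP => lt.
have : cos (t' - t) = 1 by rewrite cosB ec es -!expr2 cos2Dsin2.
have -> : t' - t = ((t' - t) / 2) *+ 2 by rewrite -mulr_natr divfK.
rewrite cos_mulr2n cos2sin2 => h.
have : sin ((t' - t) / 2) ^+ 2 = 0 by move: h; lra.
move=> /eqP; rewrite sqrf_eq0 => /eqP s0.
have : 0 < sin ((t' - t) / 2) by apply: sin_gt0_pi; lra.
by rewrite s0 ltxx.
Qed.

Lemma finite_circ_preimage r S : 0 < r ->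
  finite_set [set t : R | D t /\ polar r t \in S].
Proof.
move=> r0; elim: S => [|p S IH].
  by apply: sub_finite_set (finite_set0 _) => t [].
have [[t0 ht0 pt0]|np] := pselect (exists2 t, 0 <= t < 2 * pi & polar r t = p); last first.
  have : finite_set ([set 2 * pi] `|` [set t : R | D t /\ polar r t \in S]).
    by rewrite finite_setU; split => //; exact: finite_set1.
  apply: sub_finite_set => t [/=]; rewrite in_itv/= => /andP[t0 t1].
  rewrite in_cons => /predU1P[tp|tS]; last by right; rewrite t0 t1.
  left; move: t1; rewrite le_eqVlt => /predU1P[//|t1].
  by exfalso; apply: np; exists t; rewrite ?t0.
have : finite_set ([set t0] `|` ([set 2 * pi] `|` [set t : R | D t /\ polar r t \in S])).
  by rewrite !finite_setU; split; [|split => //]; exact: finite_set1.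
apply: sub_finite_set => t [/=]; rewrite in_itv/= => /andP[h0 h1].
rewrite in_cons => /predU1P[tp|tS]; last by right; right; rewrite h0 h1.
move: h1; rewrite le_eqVlt => /predU1P[->|h1]; first by right; left.
by left; rewrite /=; apply: (polar_inj r0); rewrite ?h0// tp pt0.
Qed.

Let B r S : set R := [set t : R | D t /\ polar r t \in S].

Lemma finite_measurable (A : set R) : finite_set A -> measurable A.
Proof.
move=> /finite_set_countable; apply: countable_measurable => t.
exact: measurable_set1.
Qed.

Lemma finite_measurable_fun (A : set R) (h : R -> R) : finite_set A ->
  measurable_fun A h.
Proof.
move=> fA _ Y mY; apply: finite_measurable; apply: sub_finite_set fA.
exact: subIsetl.
Qed.

Lemma DBE r S : D = (D `\` B r S) `|` B r S.
Proof.
apply/seteqP; split => [t Dt|t [[]//|[]//]].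
by have [|] := pselect (B r S t); [right|left].
Qed.

Lemma measurable_circ_off F r S : 0 < r ->
  (forall z, cmod z = r -> z \notin S -> rcont F z) ->
  measurable_fun D (fun t => F (polar r t)).
Proof.
move=> r0 cF; have fB := finite_circ_preimage S r0.
rewrite [X in measurable_fun X](DBE r S) measurable_funU; last 2 first.
- by apply: measurableD => //; exact: finite_measurable.
- exact: finite_measurable.
split; last exact: finite_measurable_fun.
apply: subspace_continuous_measurable_fun.
  by apply: measurableD => //; exact: finite_measurable.
apply: continuous_in_subspaceT => t; rewrite inE => -[Dt nB].
apply/contRP/contR_polar/cF; first by rewrite cmod_polar// ltW.
by apply/negP => tS; apply: nB.
Qed.

Lemma measurable_ext_off F G r S : 0 < r ->
  measurable_fun D (fun t => F (polar r t)) ->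
  (forall z, cmod z = r -> z \notin S -> F z = G z) ->
  measurable_fun D (fun t => G (polar r t)).
Proof.
move=> r0 mF FG; have fB := finite_circ_preimage S r0.
have mDB : measurable (D `\` B r S).
  by apply: measurableD => //; exact: finite_measurable.
move: mF; rewrite {1}(DBE r S) measurable_funU//; last exact: finite_measurable.
move=> [mF _].
rewrite [X in measurable_fun X](DBE r S) measurable_funU//; last exact: finite_measurable.
split; last exact: finite_measurable_fun.
apply: eq_measurable_fun mF => t; rewrite inE => -[Dt nB]; apply: FG.
  by rewrite cmod_polar// ltW.
by apply/negP => tS; apply: nB.
Qed.

Lemma ae_eq_off F G r S : 0 < r ->
  (forall z, cmod z = r -> z \notin S -> F z = G z) ->
  ae_eq mu D (EFin \o (fun t => F (polar r t))) (EFin \o (fun t => G (polar r t))).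
Proof.
move=> r0 FG; have fB := finite_circ_preimage S r0.
exists (B r S); split.
- exact: finite_measurable.
- exact/countable_lebesgue_measure0/finite_set_countable.
move=> t /= /not_implyP[Dt ne]; split => //; apply: contrapT => /negP tS.
by apply: ne; rewrite FG// cmod_polar// ltW.
Qed.

(** The extended-valued integral allows comparisons before integrability is known. *)
Definition eint F r : \bar R := (\int[mu]_(t in D) (F (polar r t))%:E)%E.

Lemma eint_ext_off F G r S : 0 < r ->
  measurable_fun D (fun t => F (polar r t)) ->
  (forall z, cmod z = r -> z \notin S -> F z = G z) -> eint F r = eint G r.
Proof.
move=> r0 mF FG; have mG := measurable_ext_off r0 mF FG.
by apply: ae_eq_integral => //; [exact/measurable_EFinP|exact/measurable_EFinP|
  exact: ae_eq_off FG].
Qed.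

Lemma circ_int_measurable F r : circ_int F r ->
  measurable_fun D (fun t => F (polar r t)).
Proof. by move=> /integrableP[/measurable_EFinP]. Qed.

Lemma circ_int_off F G r S : 0 < r -> circ_int F r ->
  (forall z, cmod z = r -> z \notin S -> F z = G z) ->
  circ_int G r /\ circ G r = circ F r.
Proof.
move=> r0 iF FG; have mF := circ_int_measurable iF.
have mG := measurable_ext_off r0 mF FG; split; last first.
  by rewrite /circ /Rintegral; congr (_ * fine _); apply/esym; exact: (eint_ext_off r0 mF FG).
apply/integrableP; split; first exact/measurable_EFinP.
have /integrableP[_] := iF; apply: le_lt_trans; rewrite le_eqVlt; apply/orP; left.
have mF' : measurable_fun D (fun t => `|F (polar r t)|) by apply: measurableT_comp.
have FG' z : cmod z = r -> z \notin S -> `|F z| = `|G z| by move=> zr zS; rewrite FG.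
by have := eint_ext_off r0 mF' FG'; rewrite /eint/= => ->.
Qed.

Lemma circ_le_off F G r S : 0 < r -> circ_int F r -> circ_int G r ->
  (forall z, cmod z = r -> z \notin S -> F z <= G z) -> circ F r <= circ G r.
Proof.
move=> r0 iF iG FG.
pose F' z := if z \in S then G z else F z.
have [iF' <-] : circ_int F' r /\ circ F' r = circ F r.
  by apply: (circ_int_off (S := S) r0 iF) => z _ zS; rewrite /F' (negbTE zS).
apply: (circ_le (ltW r0)) => // z zr; rewrite /F'; case: ifPn => // zS.
exact: FG.
Qed.

End ExceptionalPoints.

(** * Means of ln |g| *)

Section LogarithmicMean.
Variable R : realType.
Local Notation C := (cplx R).
Local Notation mu := (@lebesgue_measure R).
Implicit Types (f g : C -> C) (r : R) (z p : C).

Lemma rcont_ln_cmod f z : f z != 0 -> ccont f z -> rcont (fun w => ln (cmod (f w))) z.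
Proof.
move=> f0 cf; apply: (rcont_comp (rcont_cmod cf)); apply/contRP.
by apply: continuous_ln; rewrite cmod_gt0.
Qed.

(** Half of the inequality ln (1 + x) <= x at x = |1 + h|^2 - 1. *)
Lemma ln_cmod1D (h : C) : 1 + h != 0 ->
  ln (cmod (1 + h)) <= complex.Re h + cmod h ^+ 2 / 2.
Proof.
move=> h0; have c0 : 0 < cmod (1 + h) by rewrite cmod_gt0.
have E : cmod (1 + h) ^+ 2 = 1 + (2 * complex.Re h + cmod h ^+ 2).
  by rewrite !cmod_sqr ReD ImD /=; ring.
have := @le_ln1Dx R (2 * complex.Re h + cmod h ^+ 2).
have : 0 < cmod (1 + h) ^+ 2 by rewrite exprn_gt0.
rewrite -E lnXn// E => p; have -> : -1 < 2 * complex.Re h + cmod h ^+ 2 by lra.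
by move=> /(_ erefl); rewrite mulr2n; lra.
Qed.

Lemma polarZ (l r t : R) : polar (l * r) t = (l%:C)%C * polar r t.
Proof. by apply/eqP; rewrite eq_complex /=; apply/andP; split; apply/eqP; ring. Qed.

Lemma circ_scale (F : C -> R) (l r : R) :
  circ (fun z => F ((l%:C)%C * z)) r = circ F (l * r).
Proof.
by rewrite /circ; congr (_ * _); apply: eq_Rintegral => t _; rewrite polarZ.
Qed.

Lemma logmean_int g r : 0 <= r -> (forall z, cmod z = r -> cdiff g z) ->
  (forall z, cmod z = r -> g z != 0) -> circ_int (fun z => ln (cmod (g z))) r.
Proof.
move=> r0 dg g0; apply: circ_int_cont => // z zr.
by apply: rcont_ln_cmod; [exact: g0|apply: cdiff_ccont; exact: dg].
Qed.

(* One step of the telescoping: with h = g(z)/g(lz) - 1 the mean of ln|1 + h|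
   is at most the mean of Re h, which vanishes, plus a quadratic error. *)
Lemma logmean_step g R1 rho (A l : R) : 0 < rho < R1 -> 0 < l < 1 ->
  (forall z, cmod z < R1 -> cdiff g z) -> (forall z, cmod z < R1 -> g z != 0) ->
  (forall z, cmod z = rho -> cmod (g z / g ((l%:C)%C * z) - 1) <= A) ->
  circ (fun z => ln (cmod (g z))) rho <=
  circ (fun z => ln (cmod (g z))) (l * rho) + A ^+ 2 / 2.
Proof.
move=> /andP[rho0 rhoR] /andP[l0 l1] dg g0 HA.
have lR z : cmod z < R1 -> cmod ((l%:C)%C * z) < R1.
  move=> zR; rewrite cmodM cmod_real gtr0_norm//; apply: le_lt_trans zR.
  by rewrite ler_piMl ?cmod_ge0// ltW.
pose h z := g z / g ((l%:C)%C * z) - 1.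
have dh z : cmod z < R1 -> cdiff h z.
  move=> zR; apply: cdiffB; last exact: cdiff_cst.
  apply: cdiffM; first exact: dg.
  apply: cdiffV; first by apply: g0; exact: lR.
  by apply: cdiff_scale; apply: dg; exact: lR.
have mh : circ (fun z => complex.Re (h z)) rho = 0.
  rewrite (@circ_disc R h rho 0 R1) ?rho0//.
  - by rewrite /h mulr0 divff ?subrr ?g0// cmod0 (lt_trans rho0).
  - by move=> z zR; apply: cdiff_ccont; exact: dh.
  - by move=> z /andP[_ zR] _; exact: dh.
have ih : circ_int (fun z => complex.Re (h z)) rho.
  by apply: circ_int_cont; [exact: ltW|move=> z zr; apply/rcont_Re/cdiff_ccont/dh; rewrite zr].
have il : circ_int (fun z => ln (cmod (g ((l%:C)%C * z)))) rho.
  apply: logmean_int; [exact: ltW| |] => z zr.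
    by apply: cdiff_scale; apply: dg; apply: lR; rewrite zr.
  by apply: g0; apply: lR; rewrite zr.
rewrite -(circ_scale (fun z => ln (cmod (g z)))).
have -> : A ^+ 2 / 2 = circ (fun z => complex.Re (h z) + A ^+ 2 / 2) rho.
  by rewrite circD ?mh ?circ_cst ?add0r//; exact: circ_int_cst.
have i2 : circ_int (fun z => complex.Re (h z) + A ^+ 2 / 2) rho.
  by apply: circ_intD => //; exact: circ_int_cst.
rewrite -circD//; apply: circ_le; rewrite ?(ltW rho0)//.
- by apply: logmean_int; [exact: ltW| |] => z zr; [apply: dg|apply: g0]; rewrite zr.
- exact: circ_intD.
move=> z zr; have zR : cmod z < R1 by rewrite zr.
have gl := g0 _ (lR _ zR); have gz := g0 _ zR.
have E : g z = g ((l%:C)%C * z) * (1 + h z) by rewrite /h; field.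
have h1 : 1 + h z != 0.
  by apply/negP => /eqP h1; move: gz; rewrite E h1 mulr0 eqxx.
rewrite {1}E cmodM lnM ?posrE ?cmod_gt0// lerD2l.
apply: le_trans (ln_cmod1D h1) _; rewrite lerD2l ler_pM2r ?invr_gt0//.
have := HA z zr; rewrite -/(h z) => hA.
have := cmod_ge0 (h z) => hge; nra.
Qed.

(** Along the radii l^k r each step costs an error of order (1 - l)^2. The errors sum to O(1 - l),
    uniformly in k; so k is taken large to reach the value at 0, with l close to 1. *)
Lemma logmean_le g R1 r : 0 < r < R1 ->
  (forall z, cmod z < R1 -> cdiff g z) -> (forall z, cmod z < R1 -> g z != 0) ->
  circ (fun z => ln (cmod (g z))) r <= ln (cmod (g 0)).
Proof.
move=> /andP[r0 rR] dg g0.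
pose r' := (r + R1) / 2.
have rr' : r < r' by rewrite /r'; lra.
have r'R : r' < R1 by rewrite /r'; lra.
clearbody r'; have r'0 := lt_trans r0 rr'.
have rr0 : 0 <= r < r' by rewrite (ltW r0).
have [K K0 HK] := holo_lipschitz rr0 r'R dg.
have dV z : cmod z < R1 -> cdiff (fun w => (g w)^-1) z.
  by move=> zR; apply: cdiffV; [exact: g0|exact: dg].
have [M M0 HM] := @bounded_circ R (fun w => (g w)^-1) r' (ltW r'0)
  ltac:(by move=> z zr; apply/cdiff_ccont/dV; rewrite zr).
pose N := 2 * (M * (r' / (r' - r))).
have N0 : 0 <= N.
  by apply: mulr_ge0 => //; apply: mulr_ge0 => //; apply: divr_ge0; rewrite ?subr_ge0 ltW.
have HN z : cmod z <= r -> cmod (g z)^-1 <= N.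
  move=> zr; have zr' := le_lt_trans zr rr'.
  apply: le_trans (cauchy_estimate r'R dV HM zr') _.
  rewrite ler_pM2l// ler_wpM2l// ler_pM2l// lef_pV2 ?posrE ?subr_gt0//.
  by rewrite lerD2l lerN2.
pose L := circ (fun z => ln (cmod (g z))).
have step rho l : 0 < rho <= r -> 0 < l < 1 ->
    L rho <= L (l * rho) + (K * N * (1 - l) * rho) ^+ 2 / 2.
  move=> /andP[rho0 rhor] /andP[l0 l1].
  apply: (logmean_step (R1 := R1)); rewrite ?rho0 ?l0 ?(le_lt_trans rhor)//.
  move=> z zr; have zR : cmod z <= r by rewrite zr.
  have lzr : cmod ((l%:C)%C * z) <= r.
    by rewrite cmodM cmod_real gtr0_norm// zr (le_trans _ rhor)// ler_piMl// ltW.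
  have gl : g ((l%:C)%C * z) != 0 by apply: g0; exact: le_lt_trans rR.
  have -> : g z / g ((l%:C)%C * z) - 1 = (g z - g ((l%:C)%C * z)) * (g ((l%:C)%C * z))^-1 by field.
  rewrite cmodM; have -> : K * N * (1 - l) * rho = K * ((1 - l) * rho) * N by ring.
  apply: ler_pM; rewrite ?cmod_ge0 ?HN//.
  apply: le_trans (HK _ _ zR lzr) _; rewrite ler_wpM2l//.
  have -> : z - (l%:C)%C * z = ((1 - l)%:C)%C * z.
    by rewrite rmorphB /= rmorph1; ring.
  by rewrite cmodM cmod_real zr gtr0_norm// subr_gt0.
(* One factor (1 - l) rho of the quadratic error is the decrement of the radius, so the errors
   telescope; the other keeps the small factor 1 - l, and its rho is bounded by r. *)
pose Q := (K * N) ^+ 2 * r / 2.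
have Q0 : 0 <= Q by rewrite divr_ge0// mulr_ge0 ?(ltW r0)// sqr_ge0.
have iter l k : 0 < l < 1 -> L r <= L (l ^+ k * r) + Q * (1 - l) * (r - l ^+ k * r).
  move=> l01; have /andP[l0 l1] := l01; elim: k => [|k IH].
    by rewrite expr0 mul1r subrr mulr0 addr0.
  apply: le_trans IH _; set rho := l ^+ k * r.
  have lk0 : 0 < l ^+ k by rewrite exprn_gt0.
  have lk1 : l ^+ k <= 1 by rewrite exprn_ile1// ltW.
  have rho0 : 0 < rho by rewrite mulr_gt0.
  have rhor : rho <= r by rewrite ler_piMl// ltW.
  have st := step rho l; rewrite rho0 rhor l01 in st.
  have {}st := st isT isT.
  have -> : l ^+ k.+1 * r = l * rho by rewrite /rho exprS mulrA.
  clearbody rho.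
  have e1 : (K * N * (1 - l) * rho) ^+ 2 / 2 <= Q * (1 - l) * (rho - l * rho).
    have -> : (K * N * (1 - l) * rho) ^+ 2 / 2 = (K * N) ^+ 2 / 2 * (1 - l) ^+ 2 * rho * rho by ring.
    have -> : Q * (1 - l) * (rho - l * rho) = (K * N) ^+ 2 / 2 * (1 - l) ^+ 2 * rho * r by rewrite /Q; ring.
    apply: ler_wpM2l => //; apply: mulr_ge0; last exact: ltW.
    by apply: mulr_ge0; rewrite ?sqr_ge0// divr_ge0// sqr_ge0.
  have -> : Q * (1 - l) * (r - l * rho) = Q * (1 - l) * (rho - l * rho) + Q * (1 - l) * (r - rho) by ring.
  move: st e1; clear; lra.
have R10 := lt_trans r0 rR.
have lim0 e : 0 < e -> exists2 d : R, 0 < d & forall s, 0 < s < d -> s < R1 -> L s <= ln (cmod (g 0)) + e.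
  move=> e0; have c00 : cmod (0 : C) < R1 by rewrite cmod0.
  have [d d0 Hd] := rcont_ln_cmod (g0 _ c00) (cdiff_ccont (dg _ c00)) e0.
  exists d => // s /andP[s0 sd] sR; rewrite -[leRHS](circ_cst _ s).
  apply: circ_le; rewrite ?(ltW s0)//; last 2 first.
  - exact: circ_int_cst.
  - move=> z zs; have := Hd z; rewrite subr0 zs => /(_ sd).
    by rewrite ltr_norml => /andP[_]; lra.
  by apply: logmean_int; [exact: ltW| |] => z zr; [apply: dg|apply: g0]; rewrite zr.
apply/ler_addgt0Pl => e e0.
have e2 : 0 < e / 2 by rewrite divr_gt0.
have [d d0 Hd] := lim0 _ e2.
(* x is 1 - l; the telescoped error is at most Q x r, hence at most e / 2. *)
pose x := Num.min (1 / 2) (e / 2 / (Q * r + 1)).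
have Qr : 0 < Q * r + 1 by rewrite ltr_pwDr// mulr_ge0// ltW.
have x0 : 0 < x by rewrite lt_min divr_gt0//= !divr_gt0.
have x1 : x <= 1 / 2 by rewrite ge_min lexx.
have x2 : x * (Q * r + 1) <= e / 2 by rewrite -ler_pdivlMr// ge_min lexx orbT.
pose l := 1 - x; have l01 : 0 < l < 1 by rewrite /l; clear -x0 x1; lra.
have /andP[l0 l1] := l01.
have l01' : 0 <= l < 1 by rewrite (ltW l0).
have dr : 0 < d / r by rewrite divr_gt0.
have [k hk] := expr_small l01' dr.
have lk0 : 0 < l ^+ k * r by rewrite mulr_gt0// exprn_gt0.
have lkr : l ^+ k * r <= r by rewrite ler_piMl ?(ltW r0)// exprn_ile1// ltW.
have := Hd (l ^+ k * r); rewrite lk0 -ltr_pdivlMr// hk => /(_ isT (le_lt_trans lkr rR)) h1.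
have h2 := iter l k l01.
have h3 : Q * (1 - l) * (r - l ^+ k * r) <= e / 2.
  have -> : 1 - l = x by rewrite /l; ring.
  apply: le_trans x2; apply: le_trans (_ : Q * x * r <= _).
    by apply: ler_wpM2l; [rewrite mulr_ge0// ltW|rewrite lerBlDr lerDl ltW].
  have -> : x * (Q * r + 1) = Q * x * r + x by ring.
  by rewrite lerDl ltW.
move: h1 h2 h3; rewrite -/(L _); clear; lra.
Qed.

(** [logmean_le] for both g and 1/g. *)
Lemma logmean g R1 r : 0 < r < R1 ->
  (forall z, cmod z < R1 -> cdiff g z) -> (forall z, cmod z < R1 -> g z != 0) ->
  circ (fun z => ln (cmod (g z))) r = ln (cmod (g 0)).
Proof.
move=> rR dg g0; apply/eqP; rewrite eq_le (logmean_le rR dg g0) andTb.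
have /andP[r0 rR1] := rR.
have dV z : cmod z < R1 -> cdiff (fun w => (g w)^-1) z.
  by move=> zR; apply: cdiffV; [exact: g0|exact: dg].
have V0 z : cmod z < R1 -> (g z)^-1 != 0 by move=> /g0; rewrite invr_eq0.
have := logmean_le rR dV V0.
have lnE z : cmod z < R1 -> ln (cmod (g z)^-1) = - ln (cmod (g z)).
  by move=> zR; rewrite cmodV lnV// posrE cmod_gt0 g0.
rewrite lnE; last by rewrite cmod0 (lt_trans r0).
rewrite (@circ_ext _ _ (fun z => - ln (cmod (g z)))) ?(ltW r0)//; last first.
  by move=> z zr; rewrite lnE// zr.
rewrite circN ?lerN2//; apply: logmean_int; rewrite ?(ltW r0)// => z zr.
  by apply: dg; rewrite zr.
by apply: g0; rewrite zr.
Qed.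

Lemma logmean_factor_out r p : 0 < r < cmod p ->
  circ_int (fun z => ln (cmod (z - p))) r /\
  circ (fun z => ln (cmod (z - p))) r = ln (cmod p).
Proof.
move=> /andP[r0 rp].
have dg z : cdiff (fun w => w - p) z.
  by apply: cdiffB; [exact: cdiff_id|exact: cdiff_cst].
have g0 z : cmod z < cmod p -> z - p != 0.
  by move=> zp; rewrite subr_eq0; apply/negP => /eqP zp'; move: zp; rewrite zp' ltxx.
split.
  by apply: logmean_int; rewrite ?(ltW r0)// => z zr; apply: g0; rewrite zr.
by rewrite (@logmean (fun w => w - p) (cmod p)) ?r0//; rewrite sub0r cmodN.
Qed.

(** Reflection in the circle moves a zero p to r^2 / conj p and keeps the modulus on the circle. For
    |p| < r the reflected factor has no zero in the closed disc. *)
Lemma cmod_reflect (r : R) z p : 0 < r -> cmod z = r ->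
  cmod (z - p) = cmod ((r%:C)%C - (p^*%C / (r%:C)%C) * z).
Proof.
move=> r0 zr; apply/eqP.
rewrite -(eqrXn2 (_ : 0 < 2)%N (cmod_ge0 _) (cmod_ge0 _))//.
have -> : (r%:C)%C - (p^*%C / (r%:C)%C) * z = (r%:C)%C - p^*%C * z * ((r^-1)%:C)%C.
  by rewrite fmorphV/=; ring.
have : cmod z ^+ 2 = r ^+ 2 by rewrite zr.
rewrite !cmod_sqr; case: z {zr} => x y; case: p => a b /= h.
have E : (r - ((a * x - (- b) * y) * r^-1 - (a * y + (- b) * x) * 0)) ^+ 2 +
   (0 - ((a * x - (- b) * y) * 0 + (a * y + (- b) * x) * r^-1)) ^+ 2 =
   r ^+ 2 - 2 * (a * x + b * y) + (a ^+ 2 + b ^+ 2) * (x ^+ 2 + y ^+ 2) / r ^+ 2.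
  by field; rewrite gt_eqF.
rewrite E h mulfK; last by rewrite expf_neq0// gt_eqF.
apply/eqP.
have -> : (x - a) ^+ 2 + (y - b) ^+ 2 = (x ^+ 2 + y ^+ 2) - 2 * (a * x + b * y) + (a ^+ 2 + b ^+ 2) by ring.
by rewrite h.
Qed.

Lemma logmean_factor_in r p : 0 < r -> cmod p < r ->
  circ_int (fun z => ln (cmod (z - p))) r /\
  circ (fun z => ln (cmod (z - p))) r = ln r.
Proof.
move=> r0 pr; have p0 := cmod_ge0 p.
pose g (z : C) : C := (r%:C)%C - (p^*%C / (r%:C)%C) * z.
(* The harmonic mean of r and r^2 / |p|: it lies between the circle and the reflected zero, and
   still makes sense for p = 0. *)
pose R1 := 2 * r ^+ 2 / (r + cmod p).
have rp : 0 < r + cmod p by rewrite ltr_pwDl.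
have rR1 : r < R1 by rewrite /R1 ltr_pdivlMr//; nra.
have cJ : cmod (p^*%C : C) = cmod p by case: p {pr p0 g R1 rp rR1} => a b /=; rewrite sqrrN.
have dg z : cdiff g z.
  apply: cdiffB; first exact: cdiff_cst.
  by apply: cdiffM; [exact: cdiff_cst|exact: cdiff_id].
have g0 z : cmod z < R1 -> g z != 0.
  move=> zR; rewrite -cmod_gt0.
  have := cmodB_ge ((r%:C)%C : C) ((p^*%C / (r%:C)%C) * z).
  rewrite !cmodM cmodV cJ cmod_real gtr0_norm//; apply: lt_le_trans.
  rewrite subr_gt0 mulrAC ltr_pdivrMr//.
  apply: le_lt_trans (_ : cmod p * R1 < _).
    by rewrite ler_wpM2l// ltW.
  rewrite /R1 mulrA ltr_pdivrMr//.
  have -> : cmod p * (2 * r ^+ 2) = r * r * (2 * cmod p) by ring.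
  by rewrite ltr_pM2l ?mulr_gt0//; lra.
have E z : cmod z = r -> ln (cmod (z - p)) = ln (cmod (g z)).
  by move=> zr; rewrite (@cmod_reflect r).
have ig : circ_int (fun z => ln (cmod (g z))) r.
  by apply: logmean_int; rewrite ?(ltW r0)// => z zr; apply: g0; rewrite zr.
split; first by apply: circ_int_ext ig; rewrite ?(ltW r0)// => z /E.
rewrite (circ_ext (ltW r0) E) (@logmean g R1) ?r0//.
by rewrite /g mulr0 subr0 cmod_real gtr0_norm.
Qed.

(** The zero is approached from inside along x p with x < 1, where the mean is ln r. Fatou's lemma
    gives integrability and the lower bound; the upper bound comes from |z - p|^2 <= |z - y p|^2 / y
    on the circle. *)
Lemma logmean_factor_on r p : 0 < r -> cmod p = r ->
  circ_int (fun z => ln (cmod (z - p))) r /\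
  circ (fun z => ln (cmod (z - p))) r = ln r.
Proof.
move=> r0 pr; have p0 : p != 0 by rewrite -cmod_gt0 pr.
pose q (x : R) : C := (x%:C)%C * p.
have cq x : 0 < x < 1 -> cmod (q x) < r.
  by move=> /andP[x0 x1]; rewrite cmodM cmod_real gtr0_norm// pr gtr_pMl.
pose x n : R := 1 - (n.+2%:R)^-1.
have x01 n : 0 < x n < 1.
  rewrite /x subr_gt0 invf_lt1 ?ltr0n// ltr1n/= ltrBlDr ltrDl invr_gt0 ltr0n//.
(* Nonnegative on the circle because distances there are at most 2 r. The value at p, a null set, is
   fixed so that [F n] converges to [G] at every point. *)
pose F n (z : C) := if z == p then 0 else ln (2 * r) - ln (cmod (z - q (x n))).
pose G (z : C) := if z == p then 0 else ln (2 * r) - ln (cmod (z - p)).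
have zp z : z \notin [:: p] -> (z == p) = false by rewrite inE => /negbTE.
have iF n : circ_int (F n) r /\ circ (F n) r = ln 2.
  have [i1 c1] := logmean_factor_in r0 (cq _ (x01 n)).
  have i2 : circ_int (fun z => ln (2 * r) - ln (cmod (z - q (x n)))) r.
    by apply: circ_intD; [exact: circ_int_cst|exact: circ_intN].
  have [|iF ->] := circ_int_off (S := [:: p]) (G := F n) r0 i2.
    by move=> z _ /zp; rewrite /F => ->.
  split => //; rewrite circB ?c1 ?circ_cst//; last exact: circ_int_cst.
  by rewrite lnM ?posrE//; ring.
have F0 n z : cmod z = r -> 0 <= F n z.
  move=> zr; rewrite /F; case: ifPn => // _; rewrite subr_ge0 ler_ln ?posrE ?mulr_gt0//.
    apply: le_trans (cmodB _ _) _; rewrite zr mulr_natl mulr2n lerD2l ltW//.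
    exact: cq.
  by rewrite cmod_gt0; exact: circ_ne (cq _ (x01 n)) zr.
have Fcvg z : cmod z = r -> (fun n => (F n z)%:E) @ \oo --> (G z)%:E.
  move=> zr; rewrite /F /G; case: ifPn => [_|znp]; first exact: cvg_cst.
  apply: cvg_EFin; first by near=> n.
  rewrite /comp/=; apply/cvgrPdist_lt => e e0.
  have c1 : ccont (fun w => z - w * p) 1.
    apply: cdiff_ccont; apply: cdiffB; first exact: cdiff_cst.
    by apply: cdiffM; [exact: cdiff_id|exact: cdiff_cst].
  have zz : z - 1 * p != 0 by rewrite mul1r subr_eq0.
  have [d d0 Hd] := @rcont_ln_cmod (fun w => z - w * p) 1 zz c1 e e0.
  have [N HN] : exists N : nat, d^-1 < N%:R.
    exists (Num.truncn d^-1).+1.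
    have d1 : 0 <= d^-1 by rewrite invr_ge0 ltW.
    by have /andP[_] := truncn_itv d1.
  exists N => // n /= Nn.
  have := Hd ((x n)%:C)%C; rewrite mul1r.
  have -> : ((x n)%:C)%C - 1 = ((x n - 1)%:C)%C :> C.
    by apply/eqP; rewrite eq_complex /= subr0 !eqxx.
  rewrite cmod_real /x addrAC subrr add0r normrN ger0_norm ?invr_ge0//.
  have h : (n.+2%:R)^-1 < d.
    rewrite -(invrK d) ltf_pV2 ?posrE ?invr_gt0 ?ltr0n//.
    by apply: lt_le_trans HN _; rewrite ler_nat -addn2 (leq_trans Nn)// leq_addr.
  move=> /(_ h); rewrite -/(x n) -/(q (x n)).
  by congr (`|_| < _); ring.
have mF n := circ_int_measurable (iF n).1.
have mG : measurable_fun (`[0, 2 * pi]%classic : set R) (fun t => G (polar r t)).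
  apply: (@measurable_circ_off R _ r [:: p]) => // z zr /zp znp.
  have zz : z - p != 0 by rewrite subr_eq0 znp.
  have c1 : ccont (fun w => w - p) z.
    by apply: ccontD; [exact: ccont_id|exact: ccont_cst].
  move=> e e0; have [d d0 Hd] := @rcont_ln_cmod (fun w => w - p) z zz c1 e e0.
  exists (Num.min d (cmod (z - p))); first by rewrite lt_min d0 cmod_gt0.
  move=> w; rewrite lt_min /G znp => /andP[wd wz].
  have -> : (w == p) = false.
    by apply/negP => /eqP wp; move: wz; rewrite wp cmodBC ltxx.
  rewrite distrC; have -> : ln (2 * r) - ln (cmod (z - p)) - (ln (2 * r) - ln (cmod (w - p))) =
    ln (cmod (w - p)) - ln (cmod (z - p)) by ring.
  exact: Hd.
have G0 z : cmod z = r -> 0 <= G z.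
  move=> zr; rewrite /G; case: ifPn => // znp; rewrite subr_ge0 ler_ln ?posrE ?mulr_gt0//.
    by apply: le_trans (cmodB _ _) _; rewrite zr pr mulr_natl.
  by rewrite cmod_gt0 subr_eq0.
have EF n : (eint (F n) r = (2 * pi * ln 2)%:E)%E.
  have [i c] := iF n; move: c; rewrite /circ /Rintegral => c.
  rewrite /eint -[LHS]fineK; last exact: integrable_fin_num.
  by congr EFin; rewrite -c mulrA mulfV ?mul1r// gt_eqF// twopi_gt0.
have Gle : (eint G r <= (2 * pi * ln 2)%:E)%E.
  have := @fatou _ _ R mu _ (measurable_itv `[0, 2 * pi]%R) (fun n t => (F n (polar r t))%:E).
  move=> /(_ _ _).
  rewrite (_ : limn_einf _ = (2 * pi * ln 2)%:E); last first.
    rewrite (_ : (fun n => _) = fun=> (2 * pi * ln 2)%:E); last first.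
      by apply/funext => n; exact: EF.
    have cc : (fun _ : nat => (2 * pi * ln 2)%:E : \bar R) @ \oo --> (2 * pi * ln 2)%:E.
      exact: cvg_cst.
    by rewrite is_cvg_limn_einfE; [exact/cvg_lim|apply/cvg_ex; exists (2 * pi * ln 2)%:E].
  move=> H; apply: le_trans (H _ _); last 2 first.
  - by move=> n; apply/measurable_EFinP; exact: mF.
  - by move=> n t _; rewrite lee_fin F0// cmod_polar// ltW.
  rewrite le_eqVlt; apply/orP; left; apply/eqP; apply: eq_integral => t _.
  have Ft := Fcvg _ (cmod_polar t (ltW r0)).
  by rewrite is_cvg_limn_einfE; [apply/esym/cvg_lim|apply/cvg_ex; exists (G (polar r t))%:E].
have iG : circ_int G r.
  apply/integrableP; split; first exact/measurable_EFinP.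
  apply: le_lt_trans (ltry (2 * pi * ln 2)); apply: le_trans Gle.
  rewrite le_eqVlt; apply/orP; left; apply/eqP; apply: eq_integral => t _ /=.
  by rewrite ger0_norm// G0// cmod_polar// ltW.
have cG : circ G r <= ln 2.
  rewrite /circ ler_pdivrMl ?twopi_gt0// -lee_fin /Rintegral fineK//.
  exact: integrable_fin_num.
have iLG : circ_int (fun z => ln (2 * r) - G z) r.
  by apply: circ_intD; [exact: circ_int_cst|exact: circ_intN].
have [|iL cL] := circ_int_off (S := [:: p]) (G := fun z => ln (cmod (z - p))) r0 iLG.
  by move=> z _ /zp; rewrite /G => ->; rewrite opprB addrC subrK.
split => //; apply/eqP; rewrite eq_le; apply/andP; split; last first.
  rewrite cL circB ?circ_cst//; last exact: circ_int_cst.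
  by rewrite lnM ?posrE//; move: cG; clear; lra.
apply/ler_addgt0Pl => e e0.
(* Then e = - ln y / 2 absorbs the factor y of the inequality, which holds since |z - y p|^2 - y |z
   - p|^2 = ((1 - y) r)^2 on the circle. *)
pose y := expR (- (2 * e)).
have y01 : 0 < y < 1 by rewrite expR_gt0 expR_lt1 oppr_lt0 mulr_gt0.
have [iy cy] := logmean_factor_in r0 (cq _ y01).
have -> : e + ln r = circ (fun z => e + ln (cmod (z - q y))) r.
  by rewrite circD ?circ_cst ?cy//; exact: circ_int_cst.
apply: (circ_le_off (S := [:: p])) => //.
  by apply: circ_intD => //; exact: circ_int_cst.
move=> z zr /zp znp.
have zz : 0 < cmod (z - p) by rewrite cmod_gt0 subr_eq0 znp.
have zq : 0 < cmod (z - q y) by rewrite cmod_gt0; exact: circ_ne (cq _ y01) zr.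
have -> : e = - (ln y / 2) by rewrite /y expRK; field.
suff : ln y + 2 * ln (cmod (z - p)) <= 2 * ln (cmod (z - q y)) by clear; lra.
rewrite !mulr_natl -!lnXn// -lnM ?posrE ?exprn_gt0//; last by case/andP: y01.
rewrite ler_ln ?posrE ?mulr_gt0 ?exprn_gt0//; last by case/andP: y01.
have hz : cmod z ^+ 2 = r ^+ 2 by rewrite zr.
have hp : cmod p ^+ 2 = r ^+ 2 by rewrite pr.
move: hz hp; rewrite !cmod_sqr /q !ReB !ImB ReM ImM /=.
move: (complex.Re z) (complex.Im z) (complex.Re p) (complex.Im p) => a b c d.
move=> hz hp.
rewrite -subr_ge0.
have -> : (a - (y * c - 0 * d)) ^+ 2 + (b - (y * d + 0 * c)) ^+ 2 -
   y * ((a - c) ^+ 2 + (b - d) ^+ 2) = (1 - y) * (a ^+ 2 + b ^+ 2) - y * (1 - y) * (c ^+ 2 + d ^+ 2).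
  by ring.
rewrite hz hp; have -> : (1 - y) * r ^+ 2 - y * (1 - y) * r ^+ 2 = ((1 - y) * r) ^+ 2 by ring.
exact: sqr_ge0.
Unshelve. all: by end_near.
Qed.

Lemma logmean_factor r p : 0 < r ->
  circ_int (fun z => ln (cmod (z - p))) r /\
  circ (fun z => ln (cmod (z - p))) r = ln (Num.max r (cmod p)).
Proof.
move=> r0; have [pr|pr|pr] := ltgtP (cmod p) r.
- exact: logmean_factor_in.
- by apply: logmean_factor_out; rewrite r0.
- by rewrite pr; exact: logmean_factor_on.
Qed.

End LogarithmicMean.

(** * Orders of zeros and poles; the identity theorem *)

Section LocalForm.
Variable R : realType.
Local Notation C := (cplx R).
Implicit Types (f g : C -> C) (z w p : C).

Definition zero_near f p := exists2 d : R, 0 < d &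
  forall z, 0 < cmod (z - p) < d -> f z = 0.

Lemma is_poleP f p : is_pole f p <-> exists m : nat, (0 < m)%N /\
  exists2 c : C, c != 0 & clim (fun z => (z - p) ^+ m * f z) p c.
Proof.
split=> -[m [m0 [c c0 H]]]; exists m; split => //; exists c => //.
  exact/cvg_climP.
exact/cvg_climP.
Qed.

Lemma mero_punct f p : is_meromorphic f -> exists2 d : R, 0 < d &
  forall z, 0 < cmod (z - p) < d -> ~ is_pole f z /\ cdiff f z.
Proof.
move=> [iso der]; have [d d0 Hd] := iso p; exists d => // z /andP[z0 zd].
have np : ~ is_pole f z.
  by move=> /Hd /(_ zd) zp; move: z0; rewrite zp subrr cmod0 ltxx.
by split => //; apply/derivable_cdiff/der.
Qed.

Lemma clim_subX p k : clim (fun z : C => (z - p) ^+ k) p (0 ^+ k).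
Proof.
apply: climX; have := climD (clim_id p) (clim_cst (- p) p).
by rewrite subrr.
Qed.

Lemma clim_mulX f p l k : (0 < k)%N -> clim f p l ->
  clim (fun z => (z - p) ^+ k * f z) p 0.
Proof.
move=> k0 H; have := climM (clim_subX p k) H.
by rewrite expr0n (gtn_eqF k0) mul0r.
Qed.

(** f behaves like c (z - p)^(a - b). Two natural exponents cover zeros and poles at once; only
    their difference is determined. *)
Definition ord_form f p (a b : nat) := exists2 c : C, c != 0 &
  clim (fun z => (z - p) ^+ b * f z / (z - p) ^+ a) p c.

Lemma ord_form_le f p a b a' b' : ord_form f p a b -> ord_form f p a' b' ->
  (a' + b <= a + b')%N.
Proof.
move=> [c c0 H] [c' c'0 H']; rewrite leqNgt; apply/negP => lt.
have k0 : (0 < a' + b - (a + b'))%N by rewrite subn_gt0.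
have H1 := clim_mulX k0 H'.
have : clim (fun z => (z - p) ^+ b * f z / (z - p) ^+ a) p 0.
  apply: (eq_clim (ltr01 : 0 < (1 : R)) _ H1) => z /andP[z0 _].
  have zp : z - p != 0 by rewrite -cmod_gt0.
  apply: (mulIf (_ : (z - p) ^+ (a + a' + b') != 0)); first by rewrite expf_neq0.
  have e1 : (z - p) ^+ (a' + b - (a + b')) * ((z - p) ^+ b' * f z / (z - p) ^+ a') * (z - p) ^+ (a + a' + b') =
    ((z - p) ^+ (a' + b - (a + b')) * (z - p) ^+ (a + b')) * f z * (z - p) ^+ b'.
    by rewrite !exprD; field; rewrite !expf_neq0.
  rewrite e1 -exprD subnK ?(ltnW lt)// !exprD; field; by rewrite expf_neq0.
by move=> /(clim_unique H) h; rewrite h eqxx in c0.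
Qed.

Lemma ord_form_unique f p a b a' b' : ord_form f p a b -> ord_form f p a' b' ->
  (a' + b = a + b')%N.
Proof.
by move=> H H'; apply/eqP; rewrite eqn_leq (ord_form_le H H') (ord_form_le H' H).
Qed.

Lemma zero_near_ord f p a b : zero_near f p -> ~ ord_form f p a b.
Proof.
move=> [d d0 Hd] [c c0 H].
have : clim (fun z => (z - p) ^+ b * f z / (z - p) ^+ a) p 0.
  by apply: (eq_clim d0 _ (clim_cst 0 p)) => z /Hd ->; rewrite mulr0 mul0r.
by move=> /(clim_unique H) h; rewrite h eqxx in c0.
Qed.

Lemma ord_form_pole f p m : (exists2 c : C, c != 0 &
  clim (fun z => (z - p) ^+ m * f z) p c) <-> ord_form f p 0 m.
Proof.
split=> -[c c0 H]; exists c => //;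
  by apply: (eq_clim (ltr01 : 0 < (1 : R)) _ H) => z _; rewrite expr0 divr1.
Qed.

Lemma ord_form_zero f p m : (exists2 c : C, c != 0 &
  clim (fun z => f z / (z - p) ^+ m) p c) <-> ord_form f p m 0.
Proof.
split=> -[c c0 H]; exists c => //;
  by apply: (eq_clim (ltr01 : 0 < (1 : R)) _ H) => z _; rewrite expr0 mul1r.
Qed.

Lemma ord_form_cvg f p m : (exists2 c : C, c != 0 & (fun z => (z - p) ^+ m * f z) @ p^' --> c) <->
  ord_form f p 0 m.
Proof.
rewrite -ord_form_pole; split=> -[c c0 H]; exists c => //; exact/cvg_climP.
Qed.

Lemma ord_form_cvg0 f p m : (exists2 c : C, c != 0 & (fun z => f z / (z - p) ^+ m) @ p^' --> c) <->
  ord_form f p m 0.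
Proof.
rewrite -ord_form_zero; split=> -[c c0 H]; exists c => //; exact/cvg_climP.
Qed.

Lemma orders_form f p a b : ord_form f p a b ->
  zero_order f p = (a - b)%N /\ pole_order f p = (b - a)%N.
Proof.
move=> H; split.
  rewrite /zero_order; have [ab|ab] := leqP a b.
    rewrite xgetPN; last first.
      move=> m [m0 /ord_form_cvg0 H']; have := ord_form_unique H H'.
      by rewrite addn0 => h; move: ab m0; rewrite -h -{2}[b]add0n leq_add2r leqn0 => /eqP ->.
    by apply/esym/eqP; rewrite subn_eq0.
  case: xgetP => [m _ [m0 /ord_form_cvg0 H']|nE].
    by have := ord_form_unique H H'; rewrite addn0 => <-; rewrite addnK.
  exfalso; apply: (nE (a - b)%N); split; first by rewrite subn_gt0.
  case: H => c c0 H; apply/ord_form_cvg0; exists c => //.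
  apply: (eq_clim (ltr01 : 0 < (1 : R)) _ H) => z /andP[z0 _].
  have zp : z - p != 0 by rewrite -cmod_gt0.
  rewrite -{1}(subnK (ltnW ab)) exprD; field.
  by rewrite !expf_neq0.
rewrite /pole_order; have [ba|ba] := leqP b a.
  rewrite xgetPN; last first.
    move=> m [m0 /ord_form_cvg H']; have := ord_form_unique H H'.
    by rewrite add0n => h; move: ba m0; rewrite h -{2}[a]addn0 leq_add2l leqn0 => /eqP ->.
  by apply/esym/eqP; rewrite subn_eq0.
case: xgetP => [m _ [m0 /ord_form_cvg H']|nE].
  by have := ord_form_unique H H'; rewrite add0n => ->; rewrite addKn.
exfalso; apply: (nE (b - a)%N); split; first by rewrite subn_gt0.
case: H => c c0 H; apply/ord_form_cvg; exists c => //.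
apply: (eq_clim (ltr01 : 0 < (1 : R)) _ H) => z /andP[z0 _].
have zp : z - p != 0 by rewrite -cmod_gt0.
rewrite -{1}(subnK (ltnW ba)) exprD; field.
by rewrite expf_neq0.
Qed.

(** No exponent fits a function vanishing near p, so [xget] falls back to 0. *)
Lemma zero_near_orders f p : zero_near f p -> zero_order f p = 0%N /\ pole_order f p = 0%N.
Proof.
move=> H; split; rewrite /zero_order /pole_order xgetPN// => m [m0].
  by move=> /ord_form_cvg0; exact: zero_near_ord.
by move=> /ord_form_cvg; exact: zero_near_ord.
Qed.

Lemma pole_orderP f p : is_pole f p <-> (0 < pole_order f p)%N.
Proof.
split=> [[m [m0 /ord_form_cvg /orders_form[_ ->]]]|]; first by rewrite subn0.
rewrite /pole_order; case: xgetP => // m _ [m0 H] _.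
by exists m.
Qed.

Lemma not_pole_cdiff f p : is_meromorphic f -> pole_order f p = 0%N -> cdiff f p.
Proof.
by move=> [_ der] p0; apply/derivable_cdiff/der => /pole_orderP; rewrite p0.
Qed.

Definition local_form f p := exists2 d : R, 0 < d & exists g : C -> C,
  [/\ forall z, cmod (z - p) < d -> cdiff g z, forall z, cmod (z - p) < d -> g z != 0 &
      forall z, 0 < cmod (z - p) < d ->
        f z = (z - p) ^+ zero_order f p / (z - p) ^+ pole_order f p * g z].

Lemma shrink_nz g p (d : R) : 0 < d -> (forall z, cmod (z - p) < d -> cdiff g z) ->
  g p != 0 -> exists2 d' : R, 0 < d' <= d & forall z, cmod (z - p) < d' -> g z != 0.
Proof.
move=> d0 dg gp.
have cg : ccont g p by apply/cdiff_ccont/dg; rewrite subrr cmod0.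
have [d1 d10 Hd] := cg (cmod (g p)) ltac:(by rewrite cmod_gt0).
exists (Num.min d d1); first by rewrite lt_min d0 d10 ge_min lexx.
move=> z; rewrite lt_min => /andP[_ /Hd h]; apply/negP => /eqP gz.
by move: h; rewrite gz sub0r cmodN ltxx.
Qed.

(** At a pole of order m, (z - p)^m f becomes holomorphic once it is given its limit at p, by
    [removable]; at a regular point [holo_order] applies. *)
Lemma mero_local f p : is_meromorphic f -> zero_near f p \/ local_form f p.
Proof.
move=> mf; have [d d0 Hd] := mero_punct p mf.
suff H (a b : nat) g : (a == 0%N) || (b == 0%N) ->
    (forall z, cmod (z - p) < d -> cdiff g z) -> g p != 0 ->
    (forall z, 0 < cmod (z - p) < d -> f z = (z - p) ^+ a / (z - p) ^+ b * g z) ->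
    local_form f p.
  have [/[dup] pf /is_poleP[m [m0 [c c0 Hc]]]|np] := pselect (is_pole f p).
    right; pose g z := if z == p then c else (z - p) ^+ m * f z.
    have gE z : z != p -> g z = (z - p) ^+ m * f z by move=> zp; rewrite /g (negbTE zp).
    have gp : g p = c by rewrite /g eqxx.
    apply: (H 0%N m g) => //; last 2 first.
    - by rewrite gp.
    - move=> z /andP[z0 _]; have zp : z - p != 0 by rewrite -cmod_gt0.
      have zp' : z != p by rewrite -subr_eq0.
      by rewrite gE// expr0 mul1r mulKf// expf_neq0.
    have dg z : 0 < cmod (z - p) < d -> cdiff g z.
      move=> /[dup] hz /andP[z0 zd]; have zp : z != p by rewrite -subr_eq0 -cmod_gt0.
      apply: (@eq_cdiff _ (fun z => (z - p) ^+ m * f z) _ _ (cmod (z - p))) => //.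
        move=> w wz; rewrite gE//; apply/negP => /eqP wp.
        by move: wz; rewrite wp cmodBC ltxx.
      apply: cdiffM; last by case: (Hd _ hz).
      by apply: cdiffX; apply: cdiffB; [exact: cdiff_id|exact: cdiff_cst].
    move=> z zd; have [->|zp] := eqVneq z p; last by apply: dg; rewrite zd cmod_gt0 subr_eq0 zp.
    apply: (removable d0) => //; apply/ccont_clim; rewrite gp.
    apply: (eq_clim (ltr01 : 0 < (1 : R)) _ Hc) => w /andP[w0 _].
    by rewrite gE// -subr_eq0 -cmod_gt0.
  have df z : cmod (z - p) < d -> cdiff f z.
    move=> zd; have [->|zp] := eqVneq z p.
      by case: mf => _ der; apply/derivable_cdiff/der.
    by have [] // := Hd z; rewrite zd cmod_gt0 subr_eq0 zp.
  have [Hz|[m [g [dg gp gE]]]] := holo_order d0 df.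
    by left; exists d => // z /andP[_ /Hz].
  right; apply: (H m 0%N g); rewrite ?orbT//.
  by move=> z /andP[_ /gE ->]; rewrite expr0 divr1.
move=> ab dg gp fE.
have [d' /andP[d'0 dd'] nz] := shrink_nz d0 dg gp.
have OF : ord_form f p a b.
  exists (g p) => //; have /ccont_clim cg := cdiff_ccont (dg p ltac:(by rewrite subrr cmod0)).
  apply: (eq_clim d0 _ cg) => z /[dup] hz /andP[z0 _]; have zp : z - p != 0 by rewrite -cmod_gt0.
  by rewrite fE//; field; rewrite !expf_neq0.
have [zo po] := orders_form OF.
exists d' => //; exists g; split => //; first by move=> z zd; apply: dg; exact: lt_le_trans dd'.
move=> z /andP[z0 zd]; rewrite fE ?z0 ?(lt_le_trans zd)// zo po.
by case/orP: ab => /eqP ->; rewrite ?subn0 ?sub0n.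
Qed.

Lemma local_form_clim f p : local_form f p -> exists2 c : C, c != 0 &
  clim (fun z => (z - p) ^+ pole_order f p * f z / (z - p) ^+ zero_order f p) p c.
Proof.
move=> [d d0 [g [dg g0 fE]]].
have pp : cmod (p - p) < d by rewrite subrr cmod0.
exists (g p); first exact: g0.
have /ccont_clim cg := cdiff_ccont (dg p pp).
apply: (eq_clim d0 _ cg) => z /[dup] hz /andP[z0 _]; have zp : z - p != 0 by rewrite -cmod_gt0.
rewrite (fE z hz); move: (expf_neq0 (zero_order f p) zp) (expf_neq0 (pole_order f p) zp).
move: ((z - p) ^+ zero_order f p) ((z - p) ^+ pole_order f p) => A B A0 B0.
by field; rewrite A0 B0.
Qed.

Lemma local_form_near f p : local_form f p -> exists2 d : R, 0 < d &
  forall z, 0 < cmod (z - p) < d -> f z != 0.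
Proof.
move=> [d d0 [g [dg g0 fE]]]; exists d => // z /[dup] hz /andP[z0 zd].
have zp : z - p != 0 by rewrite -cmod_gt0.
by rewrite fE// !mulf_neq0 ?invr_neq0 ?expf_neq0// g0.
Qed.

Lemma local_form_not_zero f p : local_form f p -> ~ zero_near f p.
Proof. by move=> /local_form_clim H /zero_near_ord; apply; exact: H. Qed.

(** Vanishing near a point and its negation are both open conditions, so each small rectangle is
    entirely of one kind; bisection extends this to the rectangle spanned by p and q. *)
Lemma zero_near_all f p q : is_meromorphic f -> zero_near f p -> zero_near f q.
Proof.
move=> mf.
pose inr (x y w h : R) (z : C) := x <= complex.Re z <= x + w /\ y <= complex.Im z <= y + h.
pose Q (x y w h : R) := (forall z, inr x y w h z -> zero_near f z) \/
  (forall z, inr x y w h z -> ~ zero_near f z).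
pose x0 := Num.min (complex.Re p) (complex.Re q).
pose y0 := Num.min (complex.Im p) (complex.Im q).
pose x1 := Num.max (complex.Re p) (complex.Re q).
pose y1 := Num.max (complex.Im p) (complex.Im q).
have E1 : x0 + (x1 - x0) = x1 by ring.
have E2 : y0 + (y1 - y0) = y1 by ring.
have inp : inr x0 y0 (x1 - x0) (y1 - y0) p.
  by rewrite /inr E1 E2 /x0 /x1 /y0 /y1 !ge_min !le_max !lexx.
have inq : inr x0 y0 (x1 - x0) (y1 - y0) q.
  by rewrite /inr E1 E2 /x0 /x1 /y0 /y1 !ge_min !le_max !lexx !orbT.
suff [H _|H /H //] : Q x0 y0 (x1 - x0) (y1 - y0); first exact: H.
apply: (@bisect_rect _ Q).
- by rewrite subr_ge0 /x0 /x1 ge_min !le_max !lexx.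
- by rewrite subr_ge0 /y0 /y1 ge_min !le_max !lexx.
- move=> x y w h _ _ _ _ w00 h0 q1 q2 q3 q4.
  (* The centre lies in all four quarters, which are therefore of the same kind. *)
  pose c : C := ((x + w) +i* (y + h))%C.
  have c1 : inr x y w h c by rewrite /inr /=; split; lra.
  have c2 : inr (x + w) y w h c by rewrite /inr /=; split; lra.
  have c3 : inr x (y + h) w h c by rewrite /inr /=; split; lra.
  have c4 : inr (x + w) (y + h) w h c by rewrite /inr /=; split; lra.
  have cov z : inr x y (2 * w) (2 * h) z -> [\/ inr x y w h z, inr (x + w) y w h z,
      inr x (y + h) w h z | inr (x + w) (y + h) w h z].
    rewrite /inr => -[zx zy].
    have [a1|a1] := leP (complex.Re z) (x + w); have [a2|a2] := leP (complex.Im z) (y + h).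
    + by apply: Or41; split; lra.
    + by apply: Or43; split; lra.
    + by apply: Or42; split; lra.
    + by apply: Or44; split; lra.
  have [cz|cz] := pselect (zero_near f c).
    left=> z /cov[]; [case: q1|case: q2|case: q3|case: q4] => k; try exact: k.
    + by have := k _ c1 cz.
    + by have := k _ c2 cz.
    + by have := k _ c3 cz.
    + by have := k _ c4 cz.
  right=> z /cov[]; [case: q1|case: q2|case: q3|case: q4] => k; try exact: k.
  + by have := cz (k _ c1).
  + by have := cz (k _ c2).
  + by have := cz (k _ c3).
  + by have := cz (k _ c4).
- move=> a b _ _; pose z0 : C := (a +i* b)%C.
  have close (e x y w h : R) : x <= a <= x + w -> y <= b <= y + h -> 0 <= w < e / 2 -> 0 <= h < e / 2 ->
      forall z, inr x y w h z -> cmod (z - z0) < e.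
    move=> xa yb wd hd z [zx zy]; apply: le_lt_trans (cmod_le_ReIm _) _.
    have -> : e = e / 2 + e / 2 by field.
    by apply: ltrD; rewrite ?ReB ?ImB /= ltr_norml; lra.
  have [[d d0 Hd]|lf] := mero_local z0 mf.
    exists (d / 2); first by rewrite divr_gt0.
    move=> x y w h _ _ _ _ xa yb wd hd; left=> z /(close d x y w h xa yb wd hd) zz.
    have [->|zz0] := eqVneq z z0; first by exists d.
    have zz00 : 0 < cmod (z - z0) by rewrite cmod_gt0 subr_eq0.
    exists (Num.min (cmod (z - z0)) (d - cmod (z - z0))).
      by rewrite lt_min zz00 subr_gt0.
    move=> u; rewrite lt_min => /and3P[u0 u1 u2]; apply: Hd; apply/andP; split.
      rewrite cmod_gt0 subr_eq0; apply/negP => /eqP uz.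
      by move: u1; rewrite uz cmodBC ltxx.
    rewrite -(subrKA z); apply: le_lt_trans (cmodD _ _) _; lra.
  have nz := local_form_not_zero lf; have [d d0 Hd] := local_form_near lf.
  exists (d / 2); first by rewrite divr_gt0.
  move=> x y w h _ _ _ _ xa yb wd hd; right=> z /(close d x y w h xa yb wd hd) zz.
  have [->//|zz0] := eqVneq z z0.
  move=> zn; have zz00 : 0 < cmod (z - z0) by rewrite cmod_gt0 subr_eq0.
  have fz := Hd z; rewrite zz00 zz in fz.
  case: zn => d' d'0 Hd'.
  pose e := Num.min (Num.min d' (cmod (z - z0))) (d - cmod (z - z0)) / 2.
  have m0 : 0 < Num.min (Num.min d' (cmod (z - z0))) (d - cmod (z - z0)).
    by rewrite !lt_min d'0 zz00 subr_gt0.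
  have e0 : 0 < e by rewrite divr_gt0.
  have em : e < Num.min (Num.min d' (cmod (z - z0))) (d - cmod (z - z0)).
    by rewrite /e ltr_pdivrMr// ltr_pMr// ltr1n.
  move: em; rewrite !lt_min => /andP[/andP[e1 e2] e3].
  pose u : C := z + (e%:C)%C.
  have uz : cmod (u - z) = e by rewrite /u addrC addKr cmod_real gtr0_norm.
  have fu : f u = 0 by apply: Hd'; rewrite uz e0.
  suff : f u != 0 by rewrite fu eqxx.
  apply: Hd; apply/andP; split.
    rewrite cmod_gt0 subr_eq0; apply/negP => /eqP uz0.
    by move: e2; rewrite -uz uz0 cmodBC ltxx.
  rewrite -(subrKA z); apply: le_lt_trans (cmodD _ _) _; rewrite uz; lra.
Qed.

Lemma zero_near_eq0 f p : is_meromorphic f -> zero_near f p -> forall z, f z = 0.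
Proof.
move=> mf zp z; have zz := zero_near_all z mf zp.
have [_ po] := zero_near_orders zz.
have /ccont_clim := cdiff_ccont (not_pole_cdiff mf po).
have [d d0 Hd] := zz.
have : clim f z 0 by apply: (eq_clim d0 _ (clim_cst 0 z)) => w /Hd.
by move=> h1 /(clim_unique h1).
Qed.

Lemma mero_local_form f : is_meromorphic f -> (exists z, f z != 0) ->
  forall p, local_form f p.
Proof.
move=> mf [z fz] p; have [/(zero_near_eq0 mf) h|//] := mero_local p mf.
by move: fz; rewrite h eqxx.
Qed.

End LocalForm.

(** * Sums over zeros and poles *)

Section CountingSums.
Variable R : realType.
Local Notation C := (cplx R).
Implicit Types (f g : C -> C) (z w p : C) (o : C -> nat) (S : seq C) (r : R).

Definition locally_finite o := forall r, exists S, forall p, cmod p <= r -> o p != 0%N -> p \in S.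

(** The list that [xget] picks is arbitrary; filtering and removing duplicates make the members
    depend on o and r alone. *)
Definition osupp o r : seq C := undup [seq p <- xget [::] [set S : seq C |
  forall p, cmod p <= r -> o p != 0%N -> p \in S] | (cmod p <= r) && (o p != 0%N)].

Lemma osupp_uniq o r : uniq (osupp o r).
Proof. exact: undup_uniq. Qed.

Lemma mem_osupp o r p : locally_finite o ->
  (p \in osupp o r) = (cmod p <= r) && (o p != 0%N).
Proof.
move=> lf; rewrite mem_undup mem_filter; apply: andb_idr => /andP[pr op].
by case: xgetP => [S _ /(_ p pr op)//|nE]; have [S HS] := lf r; case: (nE S HS).
Qed.

(** Nevanlinna's integrated counting function in summed form, without the contribution of the
    origin. *)
Definition NN o r : R := \sum_(p <- osupp o r | p != 0) (o p)%:R * ln (r / cmod p).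

Lemma sum_supp (F : C -> R) S S' : uniq S -> uniq S' ->
  (forall p, F p != 0 -> (p \in S) = (p \in S')) ->
  \sum_(p <- S) F p = \sum_(p <- S') F p.
Proof.
move=> uS uS' H.
have filt T : \sum_(p <- T) F p = \sum_(p <- [seq p <- T | F p != 0]) F p.
  rewrite big_filter [RHS]big_mkcond/=; apply: eq_bigr => p _.
  by case: eqP => //= ->.
rewrite (filt S) (filt S'); apply: perm_big; apply: uniq_perm; rewrite ?filter_uniq//.
by move=> p; rewrite !mem_filter; case: eqP => //= /eqP /H ->.
Qed.

Lemma sum_le_cover (F : C -> R) S S' : uniq S -> uniq S' ->
  (forall p, 0 <= F p) -> (forall p, p \in S -> F p != 0 -> p \in S') ->
  \sum_(p <- S) F p <= \sum_(p <- S') F p.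
Proof.
move=> uS uS' F0 H.
have -> : \sum_(p <- S) F p = \sum_(p <- S') (if p \in S then F p else 0).
  rewrite -big_mkcond/= -[RHS]big_filter.
  apply: sum_supp; rewrite ?filter_uniq// => p Fp; rewrite mem_filter.
  by have [pS|//] := boolP (p \in S); rewrite H.
by apply: ler_sum => p _; case: ifP.
Qed.

Lemma logp_ge0 (x : R) : 0 <= logp x.
Proof. by rewrite /logp le_max lexx. Qed.

(** [logp] kills the points beyond r, so one large list can serve several radii and several
    functions o at once. *)
Lemma NN_cover o r S : locally_finite o -> uniq S -> 0 < r ->
  (forall p, 0 < cmod p <= r -> o p != 0%N -> p \in S) ->
  NN o r = \sum_(p <- S | p != 0) (o p)%:R * logp (r / cmod p).
Proof.
move=> lf uS r0 HS; rewrite /NN.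
have -> : \sum_(p <- osupp o r | p != 0) (o p)%:R * ln (r / cmod p) =
    \sum_(p <- osupp o r | p != 0) (o p)%:R * logp (r / cmod p).
  rewrite big_seq_cond [RHS]big_seq_cond; apply: eq_bigr => p.
  rewrite mem_osupp// => /andP[/andP[pr _] p0].
  rewrite /logp max_r// ln_ge0// ler_pdivlMr ?cmod_gt0// mul1r//.
rewrite big_mkcond/= [RHS]big_mkcond/=; apply: sum_supp; rewrite ?osupp_uniq//.
move=> p; have [->|p0] := eqVneq p 0; first by rewrite eqxx.
rewrite mulf_eq0 negb_or pnatr_eq0 => /andP[op lp]; rewrite mem_osupp// op andbT.
have pr : cmod p <= r.
  rewrite leNgt; apply/negP => rp; move: lp; rewrite /logp max_l ?eqxx//.
  by rewrite ln_le0// ler_pdivrMr ?cmod_gt0// mul1r ltW.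
by rewrite pr HS// pr cmod_gt0 p0.
Qed.

Lemma logp_le (x y : R) : 0 < x -> x <= y -> logp x <= logp y.
Proof.
move=> x0 xy; rewrite /logp ge_max !le_max lexx /= ler_ln ?posrE ?xy ?orbT//.
exact: lt_le_trans xy.
Qed.

Lemma NN_ge0 o r : locally_finite o -> 0 < r -> 0 <= NN o r.
Proof.
move=> lf r0; rewrite (@NN_cover o r (osupp o r))// ?osupp_uniq//.
  by apply: sumr_ge0 => p _; rewrite mulr_ge0// logp_ge0.
by move=> p /andP[p0 pr] op; rewrite mem_osupp// pr.
Qed.

Lemma NN_le o r r' : locally_finite o -> 0 < r -> r <= r' -> NN o r <= NN o r'.
Proof.
move=> lf r0 rr'; have r'0 := lt_le_trans r0 rr'.
have mS p : o p != 0%N -> cmod p <= r' -> p \in osupp o r' by rewrite mem_osupp// => -> ->.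
rewrite !(@NN_cover o _ (osupp o r'))// ?osupp_uniq//.
- by apply: ler_sum => p p0; rewrite ler_wpM2l// logp_le ?divr_gt0 ?cmod_gt0// ler_pM2r ?invr_gt0 ?cmod_gt0.
- by move=> p /andP[_ pr] op; exact: mS.
- by move=> p /andP[_ pr] op; apply: mS => //; exact: le_trans rr'.
Qed.

Lemma NN_ge o r p : locally_finite o -> o p != 0%N -> p != 0 -> cmod p <= r ->
  ln (r / cmod p) <= NN o r.
Proof.
move=> lf op p0 pr; have pp : 0 < cmod p by rewrite cmod_gt0.
have mp : p \in osupp o r by rewrite mem_osupp// pr.
have lr q : q \in osupp o r -> q != 0 -> 0 <= (o q)%:R * ln (r / cmod q).
  rewrite mem_osupp// => /andP[qr _] q0; rewrite mulr_ge0// ln_ge0//.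
  by rewrite ler_pdivlMr ?cmod_gt0// mul1r.
rewrite /NN big_mkcond/= (bigD1_seq p) ?osupp_uniq//= p0.
rewrite -[leLHS]addr0; apply: lerD.
  rewrite ler_peMl ?ler1n ?lt0n// ln_ge0// ler_pdivlMr// mul1r//.
rewrite big_seq_cond sumr_ge0// => q /andP[qS _]; case: ifP => // q0.
exact: lr.
Qed.

Lemma orders0 f z : ccont f z -> f z != 0 -> zero_order f z = 0%N /\ pole_order f z = 0%N.
Proof.
move=> /ccont_clim cf fz; have H : ord_form f z 0 0.
  by exists (f z) => //; apply: (eq_clim (ltr01 : 0 < (1 : R)) _ cf) => w _; rewrite !expr0 mul1r divr1.
by have [-> ->] := orders_form H.
Qed.

(** Each point has a neighbourhood in which it is the only possible zero or pole; bisecting a square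
    that contains the disc turns this into finiteness. *)
Lemma mero_lfin f : is_meromorphic f ->
  locally_finite (fun p => zero_order f p + pole_order f p)%N.
Proof.
move=> mf r.
pose o p := (zero_order f p + pole_order f p)%N.
pose inr (x y w h : R) (z : C) := x <= complex.Re z <= x + w /\ y <= complex.Im z <= y + h.
pose Q (x y w h : R) := exists S, forall p, inr x y w h p -> o p != 0%N -> p \in S.
pose r' := `|r|.
suff [S HS] : Q (- r') (- r') (2 * r') (2 * r').
  exists S => p pr; apply: HS; have pr' : cmod p <= r' by rewrite (le_trans pr)// ler_norm.
  have := norm_Re_le p; have := norm_Im_le p; rewrite /inr !ler_norml; split; lra.
apply: (@bisect_rect _ Q); rewrite ?mulr_ge0 ?normr_ge0//.
  move=> x y w h _ _ _ _ w00 h0 [S1 H1] [S2 H2] [S3 H3] [S4 H4].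
  exists (S1 ++ S2 ++ S3 ++ S4) => z; rewrite /inr => -[zx zy] oz.
  rewrite !mem_cat.
  have [a1|a1] := leP (complex.Re z) (x + w); have [a2|a2] := leP (complex.Im z) (y + h).
  - by rewrite H1//; split; lra.
  - by rewrite H3 ?orbT//; split; lra.
  - by rewrite H2 ?orbT//; split; lra.
  - by rewrite H4 ?orbT//; split; lra.
move=> a b _ _; pose z0 : C := (a +i* b)%C.
have [zn|lf] := mero_local z0 mf.
  exists 1 => // x y w h _ _ _ _ _ _ _ _; exists [::] => p _.
  by rewrite /o; have [-> ->] := zero_near_orders (zero_near_all p mf zn).
have [d d0 Hd] := local_form_near lf; have [d' d'0 Hd'] := mero_punct z0 mf.
pose e := Num.min d d'; have e0 : 0 < e by rewrite lt_min d0.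
exists (e / 2); first by rewrite divr_gt0.
move=> x y w h _ _ _ _ xa yb wd hd; exists [:: z0] => p [px py] op.
rewrite inE; apply/negPn/negP => pz.
have pe : cmod (p - z0) < e.
  apply: le_lt_trans (cmod_le_ReIm _) _; have -> : e = e / 2 + e / 2 by field.
  by apply: ltrD; rewrite ?ReB ?ImB /= ltr_norml; lra.
have p0 : 0 < cmod (p - z0) by rewrite cmod_gt0 subr_eq0.
move: pe; rewrite lt_min => /andP[pd pd'].
have fp := Hd p; rewrite p0 pd in fp.
have [|_ dp] := Hd' p; first by rewrite p0 pd'.
by move: op; rewrite /o; have [-> ->] := orders0 (cdiff_ccont dp) (fp isT).
Qed.

Lemma zero_lfin f : is_meromorphic f -> locally_finite (zero_order f).
Proof.
move=> /mero_lfin H r; have [S HS] := H r; exists S => p pr op; apply: HS => //.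
by rewrite addn_eq0 negb_and op.
Qed.

Lemma pole_lfin f : is_meromorphic f -> locally_finite (pole_order f).
Proof.
move=> /mero_lfin H r; have [S HS] := H r; exists S => p pr op; apply: HS => //.
by rewrite addn_eq0 negb_and op orbT.
Qed.

End CountingSums.

(** * Jensen's formula *)

Section Jensen.
Variable R : realType.
Local Notation C := (cplx R).
Implicit Types (f g : C -> C) (z w p : C) (S : seq C) (r : R).

Lemma avoid_seq S p : exists2 d : R, 0 < d & forall z, 0 < cmod (z - p) < d -> z \notin S.
Proof.
elim: S => [|q S [d d0 Hd]]; first by exists 1.
have [->|qp] := eqVneq q p.
  exists d => // z /[dup] hz /andP[z0 _]; rewrite inE negb_or Hd// andbT.
  by rewrite -subr_eq0 -cmod_gt0.
exists (Num.min d (cmod (q - p))); first by rewrite lt_min d0 cmod_gt0 subr_eq0.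
move=> z; rewrite lt_min => /and3P[z0 zd zq]; rewrite inE negb_or Hd ?z0// andbT.
by apply/negP => /eqP zq'; move: zq; rewrite zq' ltxx.
Qed.

(** The rational function with the zeros and poles that f has in S. *)
Definition rfactor f S z : C :=
  \prod_(p <- S) ((z - p) ^+ zero_order f p / (z - p) ^+ pole_order f p).

Lemma rfactor_neq0 f S z : z \notin S -> rfactor f S z != 0.
Proof.
elim: S => [|p S IH]; first by rewrite /rfactor big_nil oner_neq0.
rewrite inE negb_or => /andP[zp zS]; rewrite /rfactor big_cons mulf_neq0 ?IH//.
by rewrite mulf_neq0 ?invr_neq0// expf_neq0// subr_eq0.
Qed.

Lemma rfactor_cdiff f S z : z \notin S -> cdiff (rfactor f S) z.
Proof.
elim: S => [|p S IH].
  move=> _; apply: (eq_cdiff (ltr01 : 0 < (1 : R)) _ (cdiff_cst 1 z)) => w _.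
  by rewrite /rfactor big_nil.
rewrite inE negb_or => /andP[zp zS].
have dX k : cdiff (fun w => (w - p) ^+ k) z.
  by apply: cdiffX; apply: cdiffB; [exact: cdiff_id|exact: cdiff_cst].
have H := cdiffM (cdiffM (dX (zero_order f p)) (cdiffV _ (dX (pole_order f p)))) (IH zS).
apply: (eq_cdiff (ltr01 : 0 < (1 : R)) _ (H _)); last by rewrite expf_neq0// subr_eq0.
by move=> w _; rewrite /rfactor big_cons.
Qed.

Lemma mero_factor f (R1 : R) S : is_meromorphic f -> (exists z, f z != 0) -> uniq S ->
  (forall p, cmod p < R1 -> (zero_order f p + pole_order f p)%N != 0%N -> p \in S) ->
  exists G, [/\ forall z, cmod z < R1 -> cdiff G z, forall z, cmod z < R1 -> G z != 0 &
    forall z, z \notin S -> f z = rfactor f S z * G z].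
Proof.
move=> mf fn0 uS cov.
pose H z := f z / rfactor f S z.
(* On S the quotient takes its limit as value. Near such a point it agrees with a holomorphic
   quotient from which the factor of that point has cancelled. *)
pose G z := if z \in S then xget 0 [set c : C | clim H z c] else H z.
have GE z : z \notin S -> G z = H z by rewrite /G => /negbTE ->.
have key z : cmod z < R1 -> cdiff G z /\ G z != 0.
  move=> zR; have [e e0 He] := avoid_seq S z.
  have [zS|zS] := boolP (z \in S); last first.
    have /negP : ~~ ((zero_order f z + pole_order f z)%N != 0%N).
      by apply/negP => /(cov _ zR); exact/negP.
    move=> /negP; rewrite negbK addn_eq0 => /andP[/eqP z0 /eqP p0].
    have df := not_pole_cdiff mf p0.
    have fz : f z != 0.
      have [d d0 [g [dg g0 fE]]] := mero_local_form mf fn0 z.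
      have zz : cmod (z - z) < d by rewrite subrr cmod0.
      have /ccont_clim c1 := cdiff_ccont df; have /ccont_clim c2 := cdiff_ccont (dg z zz).
      have c3 : clim f z (g z).
        by apply: (eq_clim d0 _ c2) => w /fE ->; rewrite z0 p0 !expr0 divr1 mul1r.
      by rewrite (clim_unique c1 c3) g0.
    split; last by rewrite GE// /H mulf_neq0 ?invr_neq0// rfactor_neq0.
    apply: (@eq_cdiff _ H _ _ e) => //.
      move=> w we; rewrite GE//; have [->//|wz] := eqVneq w z.
      by apply: He; rewrite we cmod_gt0 subr_eq0 wz.
    by apply: cdiffM => //; apply: cdiffV; [exact: rfactor_neq0|exact: rfactor_cdiff].
  have [d d0 [g [dg g0 fE]]] := mero_local_form mf fn0 z.
  pose S' := rem z S.
  have zS' : z \notin S' by rewrite /S' mem_rem_uniq// inE eqxx.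
  pose K w := g w / rfactor f S' w.
  have KE w : 0 < cmod (w - z) < Num.min d e -> H w = K w.
    rewrite lt_min => /and3P[w0 wd we].
    have wz : w - z != 0 by rewrite -cmod_gt0.
    have wS : w \notin S by apply: He; rewrite w0.
    have wS' : w \notin S' by apply: contra wS; exact: mem_rem.
    have := rfactor_neq0 f wS' => r0.
    rewrite /H /K fE ?w0// {1}/rfactor (perm_big _ (perm_to_rem zS)) big_cons /= -/(rfactor f S' w).
    move: r0 (expf_neq0 (zero_order f z) wz) (expf_neq0 (pole_order f z) wz).
    move: ((w - z) ^+ zero_order f z) ((w - z) ^+ pole_order f z) (rfactor f S' w) (g w).
    by move=> A B D E D0 A0 B0; field; rewrite A0 B0 D0.
  have de0 : 0 < Num.min d e by rewrite lt_min d0.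
  have zz : cmod (z - z) < d by rewrite subrr cmod0.
  have dK : cdiff K z.
    by apply: cdiffM; [exact: dg|apply: cdiffV; [exact: rfactor_neq0|exact: rfactor_cdiff]].
  have cH : clim H z (K z).
    by have /ccont_clim cK := cdiff_ccont dK; apply: (eq_clim de0 _ cK) => w /KE.
  have GK : G z = K z.
    rewrite /G zS; case: xgetP => [c _ /= Hc|nE]; last by case: (nE _ cH).
    exact: clim_unique Hc cH.
  split; last by rewrite GK mulf_neq0 ?invr_neq0 ?rfactor_neq0// g0.
  apply: (eq_cdiff de0 _ dK) => w wde; have [->//|wz] := eqVneq w z.
  have hw : 0 < cmod (w - z) < Num.min d e by rewrite wde cmod_gt0 subr_eq0 wz.
  have wS : w \notin S by apply: He; move: hw; rewrite lt_min => /and3P[-> _ ->].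
  by rewrite -(KE w hw) (GE w wS).
exists G; split; [by move=> z /key[]|by move=> z /key[]|].
by move=> z zS; rewrite GE// /H mulrC divfK// rfactor_neq0.
Qed.

Definition ord f p : R := (zero_order f p)%:R - (pole_order f p)%:R.

Lemma ln_rfactor f S z : z \notin S ->
  ln (cmod (rfactor f S z)) = \sum_(p <- S) ord f p * ln (cmod (z - p)).
Proof.
elim: S => [|p S IH]; first by rewrite /rfactor !big_nil cmod1 ln1.
rewrite inE negb_or => /andP[zp zS]; rewrite /rfactor !big_cons -/(rfactor f S z).
have zp0 : 0 < cmod (z - p) by rewrite cmod_gt0 subr_eq0.
have r0 := rfactor_neq0 f zS.
rewrite !cmodM cmodV !cmodX lnM ?posrE ?cmod_gt0 ?mulr_gt0 ?invr_gt0 ?exprn_gt0//.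
rewrite lnM ?posrE ?invr_gt0 ?exprn_gt0// lnV ?posrE ?exprn_gt0// !lnXn// IH//.
by congr (_ + _); rewrite /ord mulrBl !mulr_natl.
Qed.

Lemma circ_sum (F : C -> C -> R) (a : C -> R) S r :
  (forall p, circ_int (F p) r) ->
  circ_int (fun z => \sum_(p <- S) a p * F p z) r /\
  circ (fun z => \sum_(p <- S) a p * F p z) r = \sum_(p <- S) a p * circ (F p) r.
Proof.
move=> iF; elim: S => [|p S [IH1 IH2]].
  have -> : (fun z => \sum_(p <- [::]) a p * F p z) = fun=> 0.
    by apply/funext => z; rewrite big_nil.
  by rewrite circ_cst big_nil; split => //; exact: circ_int_cst.
have -> : (fun z => \sum_(q <- p :: S) a q * F q z) =
    fun z => a p * F p z + \sum_(q <- S) a q * F q z.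
  by apply/funext => z; rewrite big_cons.
have ip := circ_intZ (a p) (iF p).
by split; [exact: circ_intD|rewrite circD// circZ// IH2 big_cons].
Qed.

(** f is [rfactor] times a zero-free G on a larger disc: each factor |z - p| has logarithmic mean ln
    max (r, |p|), and G has the mean ln |G 0|. The constant c is ln of the modulus of the leading
    Laurent coefficient at 0, hence the same for all r although S and G vary with r. *)
Lemma jensen f : is_meromorphic f -> (exists z, f z != 0) -> exists c : R,
  forall r, 0 < r -> circ_int (fun z => ln (cmod (f z))) r /\
    circ (fun z => ln (cmod (f z))) r =
    c + ord f 0 * ln r + NN (zero_order f) r - NN (pole_order f) r.
Proof.
move=> mf fn0; have [c0 c00 Hc0] := local_form_clim (mero_local_form mf fn0 0).
exists (ln (cmod c0)) => r r0.
pose R1 := r + 1; have R10 : 0 < R1 by rewrite /R1; lra.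
pose o p := (zero_order f p + pole_order f p)%N.
have lfo : locally_finite o := mero_lfin mf.
pose S := osupp o R1; have uS : uniq S := osupp_uniq _ _.
have inS p : cmod p <= R1 -> o p != 0%N -> p \in S by move=> pR op; rewrite mem_osupp// pR.
have [G [dG G0 fE]] := @mero_factor f R1 S mf fn0 uS ltac:(by move=> p /ltW; exact: inS).
have iG : circ_int (fun z => ln (cmod (G z))) r.
  by apply: logmean_int; rewrite ?(ltW r0)// => z zr; [apply: dG|apply: G0]; rewrite zr /R1 ltrDl.
have cG : circ (fun z => ln (cmod (G z))) r = ln (cmod (G 0)).
  have rR1 : 0 < r < R1 by rewrite r0 /R1 ltrDl ltr01.
  exact: logmean rR1 dG G0.
have [iS cS] := @circ_sum (fun p z => ln (cmod (z - p))) (ord f) S r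
  ltac:(by move=> p; have [] := logmean_factor p r0).
have [|iF cF] := circ_int_off (S := S) (G := fun z => ln (cmod (f z))) r0 (circ_intD iG iS).
  move=> z zr zS; rewrite (fE z zS) cmodM lnM ?posrE ?cmod_gt0 ?rfactor_neq0//.
    by rewrite ln_rfactor// addrC.
  by apply: G0; rewrite zr /R1 ltrDl.
split => //; rewrite cF circD// cG cS.
have ord0 p : p \notin S -> cmod p <= R1 -> zero_order f p = 0%N /\ pole_order f p = 0%N.
  move=> pS pR; have : o p == 0%N by apply/negPn/negP => /(inS _ pR); exact/negP.
  by rewrite addn_eq0 => /andP[/eqP -> /eqP ->].
have z0R : cmod (0 : C) <= R1 by rewrite cmod0 ltW.
have splitS (F : C -> R) : \sum_(p <- S) ord f p * F p =
    ord f 0 * F 0 + \sum_(p <- S | p != 0) ord f p * F p.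
  have [S0|S0] := boolP (0 \in S); first by rewrite (bigD1_seq 0).
  have [zo po] := ord0 _ S0 z0R.
  have -> : ord f 0 = 0 by rewrite /ord zo po subrr.
  rewrite mul0r add0r big_seq [RHS]big_seq_cond; apply: eq_bigl => p; apply/esym/andb_idr.
  by move=> pS; apply/negP => /eqP p0; rewrite p0 in pS; rewrite pS in S0.
pose S' := [seq p <- S | p != 0].
have z0S' : 0 \notin S' by rewrite mem_filter eqxx.
have prodE z : rfactor f S z =
    (z - 0) ^+ zero_order f 0 / (z - 0) ^+ pole_order f 0 * rfactor f S' z.
  rewrite /rfactor big_filter; have [S0|S0] := boolP (0 \in S); first by rewrite (bigD1_seq 0).
  have [zo po] := ord0 _ S0 z0R; rewrite zo po !expr0 divr1 mul1r.
  rewrite big_seq [RHS]big_seq_cond; apply: eq_bigl => p; apply/esym/andb_idr.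
  by move=> pS; apply/negP => /eqP p0; rewrite p0 in pS; rewrite pS in S0.
(* With the power of z removed, the remaining product is continuous at 0 and its value there is the
   leading coefficient. *)
have c0E : c0 = rfactor f S' 0 * G 0.
  have z0R' : cmod (0 : C) < R1 by rewrite cmod0.
  have /ccont_clim cR := cdiff_ccont (cdiffM (rfactor_cdiff f z0S') (dG 0 z0R')).
  have [e e0 He] := avoid_seq S 0.
  apply: (clim_unique Hc0); apply: (eq_clim e0 _ cR) => z /[dup] /He zS /andP[z0 _].
  have zz : z - 0 != 0 by rewrite -cmod_gt0.
  rewrite (fE z zS) prodE.
  move: (expf_neq0 (zero_order f 0) zz) (expf_neq0 (pole_order f 0) zz).
  move: ((z - 0) ^+ zero_order f 0) ((z - 0) ^+ pole_order f 0) (rfactor f S' z) (G z).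
  by move=> A B D E A0 B0; field; rewrite A0 B0.
have G00 : G 0 != 0 by apply: G0; rewrite cmod0.
have lnc0 : ln (cmod c0) = \sum_(p <- S | p != 0) ord f p * ln (cmod p) + ln (cmod (G 0)).
  rewrite c0E cmodM lnM ?posrE ?cmod_gt0 ?rfactor_neq0// ln_rfactor// big_filter.
  by congr (_ + _); apply: eq_bigr => p _; rewrite sub0r cmodN.
have cirE : \sum_(p <- S) ord f p * circ (fun z => ln (cmod (z - p))) r =
    \sum_(p <- S) ord f p * ln (Num.max r (cmod p)).
  by apply: eq_bigr => p _; have [_ ->] := logmean_factor p r0.
rewrite cirE (splitS (fun p => ln (Num.max r (cmod p)))) cmod0 max_l ?(ltW r0)//.
have covNN q : 0 < cmod q <= r -> o q != 0%N -> q \in S.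
  by move=> /andP[_ qr] oq; apply: inS => //; rewrite (le_trans qr)// /R1 lerDl.
rewrite (@NN_cover _ (zero_order f) r S (zero_lfin mf) uS r0); last first.
  by move=> p pr zo; apply: covNN => //; rewrite /o addn_eq0 negb_and zo.
rewrite (@NN_cover _ (pole_order f) r S (pole_lfin mf) uS r0); last first.
  by move=> p pr zo; apply: covNN => //; rewrite /o addn_eq0 negb_and zo orbT.
rewrite -addrA -sumrB lnc0.
(* Termwise this is log+ (r / |p|) = ln max (r, |p|) - ln |p|. *)
have -> : \sum_(p <- S | p != 0) ((zero_order f p)%:R * logp (r / cmod p) -
    (pole_order f p)%:R * logp (r / cmod p)) =
    \sum_(p <- S | p != 0) ord f p * ln (Num.max r (cmod p)) - \sum_(p <- S | p != 0) ord f p * ln (cmod p).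
  rewrite -sumrB; apply: eq_bigr => p p0; rewrite -mulrBl -/(ord f p) -mulrBr; congr (_ * _).
  have pp : 0 < cmod p by rewrite cmod_gt0.
  rewrite /logp ln_div ?posrE//; have [pr|pr] := leP r (cmod p).
    by rewrite max_l ?subrr// subr_le0 ler_ln.
  by rewrite max_r// subr_ge0 ler_ln// ltW.
ring.
Qed.

End Jensen.

(** * The counting function and the first main theorem *)

Section CountingFunction.
Variable R : realType.
Local Notation C := (cplx R).
Local Notation mu := (@lebesgue_measure R).
Implicit Types (f g : C -> C) (z w p : C) (r t : R).

Lemma npolesE f t : is_meromorphic f ->
  npoles f t = \sum_(p <- osupp (pole_order f) t) (pole_order f p)%:R.
Proof.
move=> mf; have lf := pole_lfin mf; rewrite /npoles.
have -> : (\esum_(p in [set p : C | (cmod p <= t)%R]) ((pole_order f p)%:R : R)%:E)%E =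
    (\esum_(p in [set` osupp (pole_order f) t]) ((pole_order f p)%:R : R)%:E)%E.
  rewrite esum_mkcond [RHS]esum_mkcond; apply: eq_esum => p _.
  have e1 : (p \in [set p : C | (cmod p <= t)%R]) = (cmod p <= t)%R.
    by apply/idP/idP; rewrite inE.
  have e2 : (p \in [set` osupp (pole_order f) t]) = (cmod p <= t) && (pole_order f p != 0%N).
    by rewrite -mem_osupp//; apply/idP/idP; rewrite inE.
  by rewrite e1 e2; case: (_ <= _) => //=; case: (pole_order f p).
rewrite esum_fset; [|exact: finite_seq|by move=> p _; rewrite lee_fin].
by rewrite -fsbig_seq ?osupp_uniq// sumEFin.
Qed.

Lemma npoles_le f t r : is_meromorphic f -> t <= r -> npoles f t =
  \sum_(p <- osupp (pole_order f) r) (if cmod p <= t then (pole_order f p)%:R else 0).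
Proof.
move=> mf tr; have lf := pole_lfin mf; rewrite npolesE//.
have -> : \sum_(p <- osupp (pole_order f) t) ((pole_order f p)%:R : R) =
   \sum_(p <- osupp (pole_order f) t) (if cmod p <= t then (pole_order f p)%:R else 0).
  by rewrite big_seq [RHS]big_seq; apply: eq_bigr => p; rewrite mem_osupp// => /andP[->].
apply: sum_supp; rewrite ?osupp_uniq// => p; rewrite !mem_osupp//.
by case: ifPn => [pt|]; rewrite ?eqxx// (le_trans pt tr) => _.
Qed.

Let inv_from (a : R) (t : R) : R := if a <= t then t^-1 else 0.

Lemma integral_inv_from (a r : R) : 0 < a -> a <= r ->
  (\int[mu]_(t in `]0%R, r]) (inv_from a t)%:E = (ln (r / a))%:E)%E /\
  measurable_fun `]0, r] (inv_from a).
Proof.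
move=> a0 ar; have r0 := lt_le_trans a0 ar.
have E : (`]0%R, r]%classic `&` `[a, r]%classic)%R = `[a, r]%classic.
  apply/seteqP; split => t /=; rewrite !in_itv/=; first by case.
  by move=> /andP[ta tr]; rewrite (lt_le_trans a0 ta) tr ta.
have cinv : {within `[a, r], continuous (fun t : R => t^-1)}.
  apply: continuous_in_subspaceT => t; rewrite inE/= in_itv/= => /andP[ta _].
  by apply: inv_continuous; rewrite gt_eqF// (lt_le_trans a0).
have resE : {in `]0, r]%classic, (fun t : R => t^-1) \_ `[a, r] =1 inv_from a}.
  move=> t; rewrite inE/= in_itv/= => /andP[t0 tr]; rewrite patchE /inv_from.
  rewrite mem_setE in_itv /= tr andbT; by case: leP.
split; last first.
  apply: (eq_measurable_fun _ resE).
  apply/measurable_restrict => //; rewrite E.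
  by apply: subspace_continuous_measurable_fun.
transitivity (\int[mu]_(t in `[a, r]) (t^-1)%:E)%E.
  rewrite -E integral_mkcondr; apply: eq_integral => t /resE <-.
  by rewrite !patchE; case: ifP.
move: ar; rewrite le_eqVlt => /predU1P[<-|ar].
  by rewrite set_itv1 integral_set1 divff ?ln1// gt_eqF.
rewrite (@continuous_FTC2 _ _ (@ln R)) //.
- by rewrite -EFinB ln_div.
- split.
  + move=> t; rewrite in_itv/= => /andP[ta _].
    by have [] := @is_derive1_ln R t (lt_trans a0 ta).
  + by apply: cvg_at_right_filter; exact: continuous_ln.
  + by apply: cvg_at_left_filter; exact: continuous_ln.
- move=> t; rewrite in_itv/= => /andP[ta _].
  by rewrite derive1E; have [_ ->] := @is_derive1_ln R t (lt_trans a0 ta).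
Qed.

(** Each pole p other than 0 contributes its multiplicity times 1/t on [|p|, r], with integral ln (r
    / |p|); subtracting [npoles f 0] removes the origin. *)
Lemma counting_fnE f r : is_meromorphic f -> 0 < r ->
  counting_fn f r = NN (pole_order f) r + (pole_order f 0)%:R * ln r.
Proof.
move=> mf r0; have lf := pole_lfin mf; rewrite /counting_fn; congr (_ + _); last first.
  congr (_ * _); rewrite npolesE//.
  have -> : \sum_(p <- osupp (pole_order f) 0) ((pole_order f p)%:R : R) =
      \sum_(p <- [:: 0]) (if p == 0 then (pole_order f p)%:R else 0).
    have -> : \sum_(p <- osupp (pole_order f) 0) ((pole_order f p)%:R : R) =
        \sum_(p <- osupp (pole_order f) 0) (if p == 0 then (pole_order f p)%:R else 0).
      rewrite big_seq [RHS]big_seq; apply: eq_bigr => p; rewrite mem_osupp// => /andP[p0 _].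
      by rewrite -cmod_eq0 eq_le p0 cmod_ge0.
    apply: sum_supp; rewrite ?osupp_uniq// => p; rewrite mem_osupp// inE.
    have [->|_] := eqVneq p 0; last by rewrite eqxx.
    by rewrite cmod0 lexx pnatr_eq0 => ->.
  by rewrite big_seq1 eqxx.
pose S := osupp (pole_order f) r.
pose K p (t : R) := if p == 0 then 0 else (pole_order f p)%:R * inv_from (cmod p) t.
have E t : 0 < t <= r -> (npoles f t - npoles f 0) / t = \sum_(p <- S) K p t.
  move=> /andP[t0 tr]; rewrite (npoles_le mf tr) (npoles_le mf (ltW r0)) -sumrB mulr_suml.
  apply: eq_bigr => p _; rewrite /K /inv_from; have [->|p0] := eqVneq p 0.
    by rewrite cmod0 lexx (ltW t0) subrr mul0r.
  have -> : (cmod p <= 0) = false by apply/negbTE; rewrite -ltNge cmod_gt0.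
  by rewrite subr0; case: ifP; rewrite ?mul0r ?mulr0.
have Kint p : p \in S -> (\int[mu]_(t in `]0%R, r]) (K p t)%:E =
    (if p == 0 then 0 else (pole_order f p)%:R * ln (r / cmod p))%:E)%E /\
    measurable_fun `]0, r] (K p).
  rewrite mem_osupp// /K => /andP[pr _]; have [_|p0] := eqVneq p 0.
    by rewrite integral0; split => //; exact: measurable_cst.
  have p0' : 0 < cmod p by rewrite cmod_gt0.
  have [I M] := integral_inv_from p0' pr.
  split; last by apply: measurable_funM => //; exact: measurable_cst.
  under eq_integral do rewrite EFinM.
  rewrite ge0_integralZl ?I ?EFinM//.
  - exact/measurable_EFinP.
  - move=> t; rewrite /= in_itv/= => /andP[t0 _]; rewrite lee_fin /inv_from.
    by case: ifP => // _; rewrite invr_ge0 ltW.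
(* The guard makes the summand measurable for every p, inside [S] or not, as the interchange of sum
   and integral demands. *)
have -> : (\int[mu]_(t in `]0%R, r]) ((npoles f t - npoles f 0) / t)%:E =
    \int[mu]_(t in `]0%R, r]) \sum_(p <- S) (if p \in S then K p t else 0)%:E)%E.
  apply: eq_integral => t; rewrite inE/= in_itv/= => /E ->.
  rewrite sumEFin; congr EFin; rewrite big_seq [RHS]big_seq; apply: eq_bigr => p ->//.
rewrite ge0_integral_sum//; last 2 first.
- move=> p; have [pS|pS] := boolP (p \in S); last exact: measurable_cst.
  by apply/measurable_EFinP; case: (Kint p pS).
- move=> p t; rewrite /= in_itv/= => /andP[t0 _]; rewrite lee_fin; case: ifP => // _.
  rewrite /K; case: eqP => // _; rewrite mulr_ge0// /inv_from.
  by case: ifP => // _; rewrite invr_ge0 ltW.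
have -> : (\sum_(p <- S) \int[mu]_(t in `]0%R, r]) (if p \in S then K p t else 0)%:E =
    \sum_(p <- S) (if p == 0 then 0 else (pole_order f p)%:R * ln (r / cmod p))%:E)%E.
  rewrite big_seq [RHS]big_seq; apply: eq_bigr => p pS; rewrite pS.
  by have [-> _] := Kint p pS.
rewrite sumEFin /= /NN [RHS]big_mkcond/=; apply: eq_bigr => p _.
by case: eqP.
Qed.

Lemma charTE f r : is_meromorphic f -> 0 < r ->
  charT f r = circ (fun z => logp (cmod (f z))) r + NN (pole_order f) r +
              (pole_order f 0)%:R * ln r.
Proof. by move=> mf r0; rewrite /charT counting_fnE// addrA. Qed.

Lemma logpE (x : R) : logp x = (ln x + `|ln x|) / 2.
Proof.
rewrite /logp; have [h|h] := leP 0 (ln x).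
  by rewrite ger0_norm//; field.
by rewrite ltr0_norm// subrr mul0r.
Qed.

(** At x = 0 every term is 0 by the conventions for [ln] and the inverse. *)
Lemma ln_logp (x : R) : 0 <= x -> ln x = logp x - logp x^-1.
Proof.
rewrite le_eqVlt => /predU1P[<-|x0]; first by rewrite invr0 subrr ln0.
by rewrite !logpE lnV ?posrE// normrN; field.
Qed.

Lemma circ_int_logp (F : C -> R) r : circ_int (fun z => ln (F z)) r ->
  circ_int (fun z => logp (F z)) r.
Proof.
move=> iF; have iN : circ_int (fun z => `|ln (F z)|) r by exact: integrable_norm iF.
have := circ_intZ (2^-1) (circ_intD iF iN).
by apply: eq_integrable => // t _ /=; rewrite logpE mulrC.
Qed.

Lemma mero_logp_int f r : is_meromorphic f -> 0 < r ->
  circ_int (fun z => logp (cmod (f z))) r.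
Proof.
move=> mf r0; have [fn0|f0] := pselect (exists z, f z != 0).
  by have [c Hc] := jensen mf fn0; apply: circ_int_logp; case: (Hc r r0).
have fz z : f z = 0 by apply/eqP/negPn/negP => fz; apply: f0; exists z.
have -> : (fun z => logp (cmod (f z))) = fun=> logp 0.
  by apply/funext => z; rewrite fz cmod0.
exact: circ_int_cst.
Qed.

Lemma circ_ge0 (F : C -> R) r : 0 <= r -> circ_int F r -> (forall z, 0 <= F z) -> 0 <= circ F r.
Proof.
move=> r0 iF F0; rewrite -(circ_cst 0 r); apply: circ_le => //.
exact: circ_int_cst.
Qed.

(** Jensen's formula with ln split as log+ x - log+ (1/x). The left-hand side is the characteristic
    of 1/f written through the zeros of f, which avoids 1/f as a function and its conventional
    values at the zeros of f. *)
Lemma first_main_theorem f : is_meromorphic f -> (exists z, f z != 0) ->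
  exists c : R, forall r, 0 < r ->
    circ_int (fun z => logp (cmod (f z))^-1) r /\
    circ (fun z => logp (cmod (f z))^-1) r + NN (zero_order f) r +
      (zero_order f 0)%:R * ln r = charT f r - c.
Proof.
move=> mf fn0; have [c Hc] := jensen mf fn0; exists c => r r0.
have [iF cF] := Hc r r0; have iL := mero_logp_int mf r0.
have E z : logp (cmod (f z))^-1 = logp (cmod (f z)) - ln (cmod (f z)).
  by rewrite ln_logp ?cmod_ge0//; ring.
have EE : (fun z => logp (cmod (f z))^-1) = fun z => logp (cmod (f z)) - ln (cmod (f z)).
  exact/funext.
rewrite EE; split; first by apply: circ_intD => //; exact: circ_intN.
rewrite circB// charTE// cF /ord; ring.
Qed.

End CountingFunction.

(** * Rotation invariance of circle means *)

Section Rotation.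
Variable R : realType.
Local Notation C := (cplx R).
Local Notation mu := (@lebesgue_measure R).
Local Notation D := (`[0, 2 * pi]%classic : set R).
Implicit Types (r t : R).

Let shiftR (c : R) : measurableTypeR R -> measurableTypeR R := fun t => t + c.

Lemma measurable_shiftR c : measurable_fun setT (shiftR c).
Proof.
have : measurable_fun [set: R] (fun t : R => t + c).
  by apply: measurable_funD => //; exact: measurable_cst.
exact.
Qed.

(** Translation preserves the lengths of half-open intervals, and these determine the measure. *)
Lemma lebesgue_shift c (A : set R) : measurable A -> pushforward mu (shiftR c) A = mu A.
Proof.
move=> mA; have mphi := measurable_shiftR c.
apply/esym.
pose mphi_mixin := isMeasurableFun.Build _ _ _ _ _ mphi.
pose phi : {mfun _ >-> _} := HB.pack (shiftR c) mphi_mixin.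
apply: (@lebesgue_measure_unique R (pushforward mu phi)) => // _ [[a b]] _ <-.
change (mu `]a, b] = mu (shiftR c @^-1` `]a, b])).
have -> : shiftR c @^-1` `]a, b] = `]a - c, b - c]%classic.
  by apply/seteqP; split => t /=; rewrite /shiftR !in_itv/= ltrBlDr lerBrDr.
rewrite !lebesgue_measure_itv/= !lte_fin ltrD2r; case: ifP => // _.
by rewrite -!EFinD; congr EFin; ring.
Qed.

Lemma integral_shift c (A : set R) (h : R -> \bar R) : measurable A ->
  measurable_fun A h -> (forall t, A t -> (0 <= h t)%E) ->
  (\int[mu]_(t in [set t | A (t + c)%R]) h (t + c)%R = \int[mu]_(t in A) h t)%E.
Proof.
move=> mA mh h0; have mphi := measurable_shiftR c.
rewrite -(@ge0_integral_pushforward _ _ _ _ _ (shiftR c) mphi mu A h mA mh); last first.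
  by move=> t; rewrite inE; exact: h0.
by apply: eq_measure_integral => B mB _; exact: lebesgue_shift.
Qed.

(** The interval is cut at 2 pi - th. Its first piece is translated by th, the second by th - 2 pi
    with the help of periodicity, and together they cover the period again. *)
Lemma integral_periodic (h : R -> R) (th : R) : 0 <= th <= 2 * pi ->
  (forall t, h (t + 2 * pi) = h t) -> (forall t, 0 <= h t) ->
  measurable_fun D h -> measurable_fun D (fun t => h (t + th)) ->
  (\int[mu]_(t in D) (h (t + th)%R)%:E = \int[mu]_(t in D) (h t)%:E)%E.
Proof.
move=> /andP[th0 th1] hp h0 mh mht; set T := 2 * pi in th1 hp mh mht *.
have spl (x : R) : 0 <= x <= T -> `[0, T]%classic = `[0, x]%classic `|` `]x, T]%classic.
  move=> /andP[x0 xT]; apply/seteqP; split => t /=; rewrite !in_itv/=.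
    move=> /andP[t0 tT]; have [tx|tx] := leP t x; [left|right]; by rewrite ?t0 ?tT.
  by move=> [/andP[-> tx]|/andP[xt ->]]; rewrite ?(le_trans tx)// ?andbT (le_trans x0)// ltW.
have dis (x : R) : [disjoint `[0, x]%classic & `]x, T]%classic].
  by apply/disj_setPS => t /=; rewrite !in_itv/= => -[/andP[_ tx] /andP[]]; rewrite ltNge tx.
have I1 : (\int[mu]_(t in `[0%R, T]) (h (t + th)%R)%:E =
  \int[mu]_(t in `[0%R, (T - th)%R]) (h (t + th)%R)%:E + \int[mu]_(t in `](T - th)%R, T]) (h (t + th)%R)%:E)%E.
  rewrite {1}(spl (T - th)); last by rewrite subr_ge0 th1/= gerBl.
  rewrite ge0_integral_setU//.
  - by rewrite -spl ?subr_ge0 ?th1 ?gerBl//; exact/measurable_EFinP.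
  - by move=> t _; rewrite lee_fin.
have I2 : (\int[mu]_(t in `[0%R, T]) (h t)%:E =
  \int[mu]_(t in `[0%R, th]) (h t)%:E + \int[mu]_(t in `]th, T]) (h t)%:E)%E.
  rewrite {1}(spl th); last by rewrite th0.
  rewrite ge0_integral_setU//.
  - by rewrite -spl ?th0 ?th1//; exact/measurable_EFinP.
  - by move=> t _; rewrite lee_fin.
have mhE : measurable_fun `[0, T] (EFin \o h) by exact/measurable_EFinP.
have I3 : (\int[mu]_(t in `[0%R, (T - th)%R]) (h (t + th)%R)%:E = \int[mu]_(t in `]th, T]) (h t)%:E)%E.
  have := @integral_shift th `[th, T]%classic (EFin \o h).
  have -> : [set t | `[th, T]%classic (t + th)] = `[0, T - th]%classic.
    by apply/seteqP; split => t /=; rewrite !in_itv/= lerDr lerBrDr.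
  rewrite -integral_itv_obnd_cbnd; last first.
    apply: measurable_funS mhE => //; apply: subset_trans (_ : `]th, T] `<=` `[0, T])%classic => //.
    by apply: subset_itvr; rewrite bnd_simp.
  move=> -> //; last by move=> t _ /=; rewrite lee_fin.
  by apply: measurable_funS mhE => //; apply: subset_itvr; rewrite bnd_simp.
have I4 : (\int[mu]_(t in `](T - th)%R, T]) (h (t + th)%R)%:E = \int[mu]_(t in `[0%R, th]) (h t)%:E)%E.
  have := @integral_shift (th - T) `]0, th]%classic (EFin \o h).
  have -> : [set t | `]0, th]%classic (t + (th - T))] = `]T - th, T]%classic.
    apply/seteqP; split => t /=; rewrite !in_itv/= => /andP[? ?]; apply/andP; split; lra.
  rewrite -integral_itv_obnd_cbnd; last first.
    by apply: measurable_funS mhE => //; apply: subset_trans (subset_itvl _) (subset_itvr _); rewrite bnd_simp.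
  move=> <- //; last 2 first.
  - by apply: measurable_funS mhE => //; apply: subset_trans (subset_itvl _) (subset_itvr _); rewrite bnd_simp.
  - by move=> t _ /=; rewrite lee_fin.
  apply: eq_integral => t _ /=; congr EFin; rewrite -[RHS]hp; congr h; ring.
by rewrite I1 I2 I3 I4 addeC.
Qed.

Lemma eint_rot (F : C -> R) (c : C) r : 0 < r -> c != 0 -> (forall z, 0 <= F z) ->
  measurable_fun D (fun t => F (polar (cmod c * r) t)) ->
  measurable_fun D (fun t => F (c * polar r t)) ->
  eint (fun z => F (c * z)) r = eint F (cmod c * r).
Proof.
move=> r0 c0 F0 m1 m2; have [th hth cE] := polar_exists c.
have pE t : c * polar r t = polar (cmod c * r) (t + th).
  by rewrite {1}cE polarM addrC.
rewrite /eint -(@integral_periodic (fun t => F (polar (cmod c * r) t)) th)//.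
- by apply: eq_integral => t _; rewrite pE.
- by move=> t; rewrite polar_periodic.
- by apply: eq_measurable_fun m2 => t _; rewrite pE.
Qed.

(** Multiplication by c dilates by |c| and rotates by its argument; the mean sees the dilation
    only. *)
Lemma circ_rot (F : C -> R) (c : C) r : 0 < r -> c != 0 -> (forall z, 0 <= F z) ->
  circ_int F (cmod c * r) -> measurable_fun D (fun t => F (c * polar r t)) ->
  circ_int (fun z => F (c * z)) r /\
  circ (fun z => F (c * z)) r = circ F (cmod c * r).
Proof.
move=> r0 c0 F0 iF mc; have mF := circ_int_measurable iF.
have E := eint_rot r0 c0 F0 mF mc.
split; last by rewrite /circ /Rintegral; congr (_ * fine _); exact: E.
apply/integrableP; split; first exact/measurable_EFinP.
rewrite (_ : integral _ _ _ = eint (fun z => F (c * z)) r); last first.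
  by apply: eq_integral => t _ /=; rewrite ger0_norm.
rewrite E; have /integrableP[_] := iF; apply: le_lt_trans.
rewrite le_eqVlt; apply/orP; left; apply/eqP; apply: eq_integral => t _ /=.
by rewrite ger0_norm.
Qed.

End Rotation.

(** * Estimates for log+ *)

Section LogPlus.
Variable R : realType.
Implicit Types x y : R.

Lemma logp0 : logp 0 = 0 :> R.
Proof. by rewrite /logp ln0// maxxx. Qed.

Lemma logp_mono x y : 0 <= x -> x <= y -> logp x <= logp y.
Proof.
rewrite le_eqVlt => /predU1P[<- _|x0]; last exact: logp_le.
by rewrite logp0 logp_ge0.
Qed.

Lemma ln_le_logp x : ln x <= logp x.
Proof. by rewrite /logp le_max lexx orbT. Qed.

Lemma le_exp_logp x : 0 <= x -> x <= expR (logp x).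
Proof.
rewrite le_eqVlt => /predU1P[<-|x0]; first exact: expR_ge0.
by rewrite -{1}(@lnK _ x) ?posrE// ler_expR ln_le_logp.
Qed.

(** Together with [le_exp_logp] this turns estimates of log+ into estimates between exponentials,
    without a case distinction at 1. *)
Lemma logp_le_exp x y : 0 <= y -> x <= expR y -> logp x <= y.
Proof.
move=> y0 xy; rewrite /logp ge_max y0 /=; have [x0|x0] := leP x 0.
  by rewrite ln0.
by rewrite -(expRK y) ler_ln ?posrE ?expR_gt0.
Qed.

Lemma logpM x y : 0 <= x -> 0 <= y -> logp (x * y) <= logp x + logp y.
Proof.
move=> x0 y0; apply: logp_le_exp; first by rewrite addr_ge0// logp_ge0.
by rewrite expRD ler_pM// le_exp_logp.
Qed.

Lemma logpD x y : 0 <= x -> 0 <= y -> logp (x + y) <= logp x + logp y + ln 2.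
Proof.
move=> x0 y0; have lx := logp_ge0 x; have ly := logp_ge0 y.
have l2 : 0 <= ln 2 :> R by rewrite ln_ge0// ler1n.
apply: logp_le_exp; first by rewrite !addr_ge0.
rewrite expRD lnK ?posrE//.
have h1 : x <= expR (logp x + logp y).
  by apply: le_trans (le_exp_logp x0) _; rewrite ler_expR lerDl.
have h2 : y <= expR (logp x + logp y).
  by apply: le_trans (le_exp_logp y0) _; rewrite ler_expR lerDr.
lra.
Qed.

Lemma logpX x k : 0 <= x -> logp (x ^+ k) <= k%:R * logp x.
Proof.
move=> x0; elim: k => [|k IH]; first by rewrite expr0 mul0r /logp ln1 maxxx.
rewrite exprS; apply: le_trans (logpM x0 (exprn_ge0 _ x0)) _.
by rewrite -natr1 mulrDl mul1r addrC lerD2r.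
Qed.

Lemma logp_lip x y : `|logp x - logp y| <= `|ln x - ln y|.
Proof.
rewrite /logp; have [h1|h1] := leP 0 (ln x); have [h2|h2] := leP 0 (ln y) => //;
  rewrite ?subr0 ?sub0r ?subrr ?normr0//.
  by rewrite !ger0_norm//; lra.
by rewrite normrN distrC !ger0_norm//; lra.
Qed.

End LogPlus.

(** * Bounds for the characteristic and behaviour under dilation *)

Section Characteristic.
Variable R : realType.
Local Notation C := (cplx R).
Local Notation D := (`[0, 2 * pi]%classic : set R).
Implicit Types (f g A : C -> C) (z w p : C) (r t : R).

Lemma charT_terms f r : is_meromorphic f -> 1 <= r ->
  [/\ 0 <= circ (fun z => logp (cmod (f z))) r, 0 <= NN (pole_order f) r &
      0 <= (pole_order f 0)%:R * ln r].
Proof.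
move=> mf r1; have r0 : 0 < r by rewrite (lt_le_trans ltr01).
split; [|exact: NN_ge0 (pole_lfin mf) r0|by rewrite mulr_ge0// ln_ge0].
by apply: circ_ge0; [exact: ltW|exact: mero_logp_int|move=> z; exact: logp_ge0].
Qed.

Lemma cdiff_no_pole f z : cdiff f z -> pole_order f z = 0%N.
Proof.
move=> df; apply/eqP; rewrite -leqn0 leqNgt; apply/negP => /pole_orderP /is_poleP.
move=> [m [m0 [c c0 Hc]]]; have /ccont_clim cf := cdiff_ccont df.
by have := clim_unique Hc (clim_mulX m0 cf) => cE; rewrite cE eqxx in c0.
Qed.

Lemma entire_mero f : (forall z, cdiff f z) -> is_meromorphic f.
Proof.
move=> df; split => z; last by move=> _; apply/derivable_cdiff.
by exists 1 => // w /pole_orderP; rewrite cdiff_no_pole.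
Qed.

(** A single pole makes the counting function grow like ln r. Without poles f - f 0 is entire with a
    zero at 0, so by the first main theorem its characteristic is at least ln r - O(1), and
    returning to f costs a constant. *)
Lemma charT_ge_ln f : is_meromorphic f -> ~ is_constant f ->
  exists K : R, forall r, 1 <= r -> ln r - K <= charT f r.
Proof.
move=> mf nc; have lf := pole_lfin mf.
have [[p pp]|np] := pselect (exists p, pole_order f p != 0%N).
  exists (logp (cmod p)) => r r1; have r0 : 0 < r by rewrite (lt_le_trans ltr01).
  have [t1 t2 t3] := charT_terms mf r1; rewrite charTE//.
  have l0 := logp_ge0 (cmod p); have lr := ln_ge0 r1.
  have [p0|p0] := eqVneq p 0.
    have : ln r <= (pole_order f 0)%:R * ln r by rewrite ler_peMl// ler1n lt0n -p0.
    by lra.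
  have [pr|pr] := leP (cmod p) r.
    have := NN_ge lf pp p0 pr; rewrite ln_div ?posrE ?cmod_gt0//.
    by have := ln_le_logp (cmod p); lra.
  have : ln r <= ln (cmod p) by rewrite ler_ln ?posrE ?cmod_gt0// ltW.
  by have := ln_le_logp (cmod p); lra.
have po0 p : pole_order f p = 0%N.
  by apply/eqP/negPn/negP => pp; apply: np; exists p.
have df z := not_pole_cdiff mf (po0 z).
pose g z := f z - f 0.
have dg z : cdiff g z by apply: cdiffB => //; exact: cdiff_cst.
have mg := entire_mero dg.
have gn0 : exists z, g z != 0.
  apply: contrapT => h; apply: nc; exists (f 0) => z; apply/eqP; rewrite -subr_eq0.
  by apply/negPn/negP => gz; apply: h; exists z.
have pg z : pole_order g z = 0%N by exact: cdiff_no_pole.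
have zg : (0 < zero_order g (0%R : C))%N.
  rewrite lt0n; apply/negP => /eqP zo.
  have [c c0 Hc] := local_form_clim (mero_local_form mg gn0 0).
  have /ccont_clim cg := cdiff_ccont (dg 0).
  have : clim g 0 c.
    by apply: (eq_clim (ltr01 : 0 < (1 : R)) _ Hc) => z _; rewrite zo pg !expr0 mul1r divr1.
  by move=> /(clim_unique cg); rewrite /g subrr => cE; rewrite -cE eqxx in c0.
have [c Hc] := first_main_theorem mg gn0.
exists (logp (cmod (f 0)) + ln 2 - c) => r r1; have r0 : 0 < r by rewrite (lt_le_trans ltr01).
have [iI E] := Hc r r0.
have h1 : 0 <= circ (fun z => logp (cmod (g z))^-1) r.
  by apply: circ_ge0; [exact: ltW|exact: iI|move=> z; exact: logp_ge0].
have h2 := NN_ge0 (zero_lfin mg) r0.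
have h3 : ln r <= (zero_order g 0)%:R * ln r by rewrite ler_peMl ?ler1n// ln_ge0.
have Ng : NN (pole_order g) r = 0.
  by rewrite /NN big1// => p _; rewrite pg mul0r.
have Nf : NN (pole_order f) r = 0.
  by rewrite /NN big1// => p _; rewrite po0 mul0r.
rewrite charTE// Ng pg mul0r !addr0 in E.
rewrite charTE// Nf po0 mul0r !addr0.
have : circ (fun z => logp (cmod (g z))) r <=
    circ (fun z => logp (cmod (f z)) + (logp (cmod (f 0)) + ln 2)) r.
  apply: circ_le; [exact: ltW|exact: mero_logp_int| |].
    by apply: circ_intD; [exact: mero_logp_int|exact: circ_int_cst].
  move=> z _; rewrite addrA; apply: le_trans (logpD (cmod_ge0 _) (cmod_ge0 _)).
  by apply: logp_mono; [exact: cmod_ge0|exact: cmodB].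
rewrite circD ?circ_cst; [|exact: mero_logp_int|exact: circ_int_cst].
move: E h1 h2 h3; clear; lra.
Qed.

Lemma ln_cmod_factor_inv (p : C) r : 0 < r ->
  circ_int (fun z => logp (cmod (z - p))) r /\ circ_int (fun z => logp (cmod (z - p))^-1) r /\
  circ (fun z => logp (cmod (z - p))^-1) r <= logp (r + cmod p) - ln r.
Proof.
move=> r0; have [i1 c1] := logmean_factor p r0.
have i2 := circ_int_logp i1.
have EE : (fun z => logp (cmod (z - p))^-1) = fun z => logp (cmod (z - p)) - ln (cmod (z - p)).
  by apply/funext => z; rewrite (@ln_logp R (cmod (z - p))) ?cmod_ge0//; ring.
rewrite EE; split => //; split; first by apply: circ_intD => //; exact: circ_intN.
rewrite circB// c1; apply: lerB.
  rewrite -(circ_cst (logp (r + cmod p)) r); apply: circ_le => //; first exact: ltW.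
    exact: circ_int_cst.
  by move=> z zr; apply: logp_mono; [exact: cmod_ge0|rewrite -zr; exact: cmodB].
by rewrite ler_ln ?posrE ?lt_max ?r0// le_max lexx.
Qed.

Lemma rfactor_logp f S z : z \notin S -> logp (cmod (rfactor f S z)) <=
  \sum_(p <- S) (zero_order f p + pole_order f p)%:R * (logp (cmod (z - p)) + logp (cmod (z - p))^-1).
Proof.
elim: S => [|p S IH]; first by rewrite /rfactor !big_nil cmod1 /logp ln1 maxxx.
rewrite inE negb_or => /andP[zp zS]; rewrite /rfactor !big_cons -/(rfactor f S z).
rewrite !cmodM cmodV !cmodX.
apply: le_trans (logpM _ _) _; rewrite ?cmod_ge0//.
  by rewrite mulr_ge0 ?invr_ge0 ?exprn_ge0 ?cmod_ge0.
apply: lerD; last exact: IH.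
apply: le_trans (logpM _ _) _; rewrite ?invr_ge0 ?exprn_ge0 ?cmod_ge0//.
have a1 := logpX (zero_order f p) (cmod_ge0 (z - p)).
have c1 : 0 <= (cmod (z - p))^-1 by rewrite invr_ge0 cmod_ge0.
have a2 := logpX (pole_order f p) c1.
rewrite exprVn in a2.
have l1 := logp_ge0 (cmod (z - p)); have l2 := logp_ge0 (cmod (z - p))^-1.
apply: le_trans (lerD a1 a2) _; rewrite natrD mulrDl !mulrDr.
have : 0 <= (zero_order f p)%:R * logp (cmod (z - p))^-1 by rewrite mulr_ge0.
have : 0 <= (pole_order f p)%:R * logp (cmod (z - p)) by rewrite mulr_ge0.
move: ((zero_order f p)%:R * _) ((pole_order f p)%:R * _) ((pole_order f p)%:R * logp _^-1) ((zero_order f p)%:R * logp (cmod (z - p))).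
clear => *; lra.
Qed.

(** Poles may lie on the circles, so a pointwise bound is out of reach. After [rfactor] is split
    off, the zero-free part is bounded and each |z - p| or its inverse has a mean of log+ that is
    bounded uniformly for r in [d, e]. *)
Lemma proximity_bounded f (d e : R) : is_meromorphic f -> 0 < d -> d <= e ->
  exists2 M : R, 0 <= M & forall r, d <= r <= e -> circ (fun z => logp (cmod (f z))) r <= M.
Proof.
move=> mf d0 de; have e0 := lt_le_trans d0 de.
have [fn0|f0] := pselect (exists z, f z != 0); last first.
  have fz z : f z = 0 by apply/eqP/negPn/negP => fz; apply: f0; exists z.
  exists 0 => // r _; have -> : (fun z => logp (cmod (f z))) = fun=> 0.
    by apply/funext => z; rewrite fz cmod0 logp0.
  by rewrite circ_cst.
pose o p := (zero_order f p + pole_order f p)%N.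
pose R1 := e + 2.
have lfo : locally_finite o := mero_lfin mf.
pose S := osupp o R1; have uS : uniq S := osupp_uniq _ _.
have [G [dG G0 fE]] := @mero_factor R f R1 S mf fn0 uS
  ltac:(by move=> p /ltW pR op; rewrite mem_osupp// pR).
have e1 : 0 <= e + 1 by rewrite addr_ge0// ltW.
have [M M0 HM] := @bounded_circ R G (e + 1) e1
  ltac:(by move=> z zr; apply/cdiff_ccont/dG; rewrite zr /R1; lra).
pose N := 2 * (M * ((e + 1) / (e + 1 - e))).
have HN z : cmod z <= e -> cmod (G z) <= N.
  move=> ze; have ze1 : cmod z < e + 1 by rewrite (le_lt_trans ze)// ltrDl.
  have eR : e + 1 < R1 by rewrite /R1; lra.
  apply: le_trans (cauchy_estimate eR dG HM ze1) _.
  rewrite ler_pM2l// ler_wpM2l// ler_wpM2l// lef_pV2 ?posrE; lra.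
pose b p := 2 * logp (e + cmod p) + logp d^-1.
have b0 p : 0 <= b p by rewrite addr_ge0 ?logp_ge0// mulr_ge0// logp_ge0.
exists (logp N + \sum_(p <- S) (o p)%:R * b p).
  by rewrite addr_ge0 ?logp_ge0// sumr_ge0// => p _; rewrite mulr_ge0.
move=> r /andP[dr re]; have r0 := lt_le_trans d0 dr.
pose H p (z : C) := logp (cmod (z - p)) + logp (cmod (z - p))^-1.
have iH p : circ_int (H p) r.
  by have [i1 [i2 _]] := ln_cmod_factor_inv p r0; exact: circ_intD.
have cH p : circ (H p) r <= b p.
  have [i1 [i2 c2]] := ln_cmod_factor_inv p r0; rewrite circD//.
  have c1 : circ (fun z => logp (cmod (z - p))) r <= logp (e + cmod p).
    rewrite -(circ_cst (logp (e + cmod p)) r); apply: circ_le => //; [exact: ltW|exact: circ_int_cst|].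
    move=> z zr; apply: logp_mono; first exact: cmod_ge0.
    by apply: le_trans (cmodB _ _) _; rewrite zr lerD2r.
  have c3 : logp (r + cmod p) <= logp (e + cmod p).
    by apply: logp_mono; rewrite ?lerD2r// addr_ge0 ?cmod_ge0// ltW.
  have c4 : - ln r <= logp d^-1.
    apply: le_trans (ln_le_logp _); rewrite lnV ?posrE// lerN2 ler_ln//.
  rewrite /b; move: c1 c2 c3 c4; clear; lra.
have [iS cS] := @circ_sum R H (fun p => (o p)%:R) S r iH.
have : circ (fun z => logp (cmod (f z))) r <=
    circ (fun z => logp N + \sum_(p <- S) (o p)%:R * H p z) r.
  apply: (circ_le_off (S := S)) => //; first exact: mero_logp_int.
    by apply: circ_intD => //; exact: circ_int_cst.
  move=> z zr zS; rewrite (fE z zS) cmodM mulrC.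
  apply: le_trans (logpM (cmod_ge0 _) (cmod_ge0 _)) _; apply: lerD; last exact: rfactor_logp.
  by apply: logp_mono; [exact: cmod_ge0|apply: HN; rewrite zr].
rewrite circD ?circ_cst ?cS//; last exact: circ_int_cst.
move=> h; apply: le_trans h _; rewrite lerD2l; apply: ler_sum => p _.
by rewrite ler_wpM2l.
Qed.

Lemma rcont_logp A z : A z != 0 -> ccont A z -> rcont (fun w => logp (cmod (A w))) z.
Proof.
move=> A0 cA e e0; have [d d0 Hd] := rcont_ln_cmod A0 cA e0.
by exists d => // w /Hd; apply: le_lt_trans; exact: logp_lip.
Qed.

(** Only finitely many points of the circle of radius |c| r have a nonzero order; at the others the
    value of A is the nonzero limit of its local form. *)
Lemma special_scale A (c : C) r : is_meromorphic A -> (exists z, A z != 0) -> c != 0 ->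
  exists S : seq C, forall z, cmod z = r -> z \notin S -> A (c * z) != 0 /\ cdiff A (c * z).
Proof.
move=> mA An0 c0; pose o p := (zero_order A p + pole_order A p)%N.
have lfo : locally_finite o := mero_lfin mA.
exists [seq w / c | w <- osupp o (cmod c * r)] => z zr zS.
have /negP : ~~ (o (c * z) != 0%N).
  apply/negP => oz; move/negP: zS; apply; apply/mapP; exists (c * z); last by field.
  by rewrite mem_osupp// oz cmodM zr lexx.
move=> /negP; rewrite negbK addn_eq0 => /andP[/eqP zo /eqP po].
have dA := not_pole_cdiff mA po; split => //.
have [l l0 Hl] := local_form_clim (mero_local_form mA An0 (c * z)).
have /ccont_clim cA := cdiff_ccont dA.
suff -> : A (c * z) = l by [].
apply: (clim_unique cA); apply: (eq_clim (ltr01 : 0 < (1 : R)) _ Hl) => w _.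
by rewrite zo po !expr0 mul1r divr1.
Qed.

Lemma mero_rot A (c : C) r : is_meromorphic A -> c != 0 -> 0 < r ->
  circ_int (fun z => logp (cmod (A (c * z)))) r /\
  circ (fun z => logp (cmod (A (c * z)))) r = circ (fun z => logp (cmod (A z))) (cmod c * r).
Proof.
move=> mA c0 r0; have cr : 0 < cmod c * r by rewrite mulr_gt0// cmod_gt0.
have [An0|A0] := pselect (exists z, A z != 0); last first.
  have Az z : A z = 0 by apply/eqP/negPn/negP => Az; apply: A0; exists z.
  have -> : (fun z => logp (cmod (A (c * z)))) = fun=> logp (cmod (0 : C)).
    by apply/funext => z; rewrite Az.
  have -> : (fun z => logp (cmod (A z))) = fun=> logp (cmod (0 : C)).
    by apply/funext => z; rewrite Az.
  by rewrite !circ_cst; split => //; exact: circ_int_cst.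
apply: (@circ_rot R (fun z => logp (cmod (A z)))) => //; [by move=> z; exact: logp_ge0|exact: mero_logp_int|].
have [S HS] := special_scale r mA An0 c0.
apply: (@measurable_circ_off R (fun z => logp (cmod (A (c * z)))) r S) => // z zr zS.
have [Az dA] := HS z zr zS.
apply: (@rcont_logp (fun w => A (c * w))) => //; apply/cdiff_ccont; exact: cdiff_scale.
Qed.

Lemma mero_rot_inv A (c : C) r : is_meromorphic A -> (exists z, A z != 0) -> c != 0 -> 0 < r ->
  circ_int (fun z => logp (cmod (A (c * z)))^-1) r /\
  circ (fun z => logp (cmod (A (c * z)))^-1) r = circ (fun z => logp (cmod (A z))^-1) (cmod c * r).
Proof.
move=> mA An0 c0 r0; have cr : 0 < cmod c * r by rewrite mulr_gt0// cmod_gt0.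
have [k Hk] := first_main_theorem mA An0.
apply: (@circ_rot R (fun z => logp (cmod (A z))^-1)) => //; [by move=> z; exact: logp_ge0|by case: (Hk _ cr)|].
have [S HS] := special_scale r mA An0 c0.
apply: (@measurable_circ_off R (fun z => logp (cmod (A (c * z)))^-1) r S) => // z zr zS.
have [Az dA] := HS z zr zS.
have := @rcont_logp (fun w => (A (c * w))^-1) z.
have -> : (fun w => logp (cmod (A (c * w))^-1)) = fun w => logp (cmod (A (c * w)))^-1.
  by apply/funext => w; rewrite cmodV.
apply; first by rewrite invr_eq0.
apply: cdiff_ccont; apply: cdiffV => //; exact: cdiff_scale.
Qed.

End Characteristic.

(** * Iterated inequalities *)

Section Chains.
Variable R : realType.
Local Notation C := (cplx R).

Lemma seq_argmax (g : nat -> R) n : (0 < n)%N ->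
  exists2 j, (j < n)%N & forall i, (i < n)%N -> g i <= g j.
Proof.
elim: n => // -[|n] IH _; first by exists 0%N => // -[].
have [j jn Hj] := IH isT; have [gj|gj] := leP (g j) (g n.+1).
  exists n.+1 => // i; rewrite ltnS leq_eqVlt => /predU1P[->//|ilt].
  exact: le_trans (Hj i ilt) gj.
exists j => [|i]; first exact: ltnW.
by rewrite ltnS leq_eqVlt => /predU1P[->|/Hj//]; exact: ltW.
Qed.

(* Following the recursion from index 0 leads to one of the indices K, ..., K + n - 1. *)
Lemma chain_bound (v u : nat -> R) n K :
  (forall k, 0 <= v k) -> (forall k, 0 <= u k) -> (0 < K)%N ->
  (forall k, (k < K)%N -> v k <= u k \/ exists2 j, (j < n)%N & v k <= u k + v (k + j.+1)%N) ->
  v 0%N <= \sum_(i < K) u i + \sum_(i < n) v (K + i)%N.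
Proof.
move=> v0 u0 K0 H.
have T0 : 0 <= \sum_(i < n) v (K + i)%N by apply: sumr_ge0 => i _.
(* Induction on the distance K - k. A jump from k < K lands below K + n, and at an index from K on
   the value is itself one of the last n summands. *)
suff main m k : (K - k <= m)%N -> (k < K + n)%N || (k < K)%N ->
    v k <= \sum_(k <= i < K) u i + \sum_(i < n) v (K + i)%N.
  by have := main K 0%N; rewrite subn0 leqnn K0 orbT big_mkord; exact.
elim: m k => [|m IH] k km kn.
  have kK : (K <= k)%N by rewrite -subn_eq0 -leqn0.
  have kn' : (k - K < n)%N by move: kn; rewrite ltnNge [in (k < K)%N]ltnNge kK orbF -ltnNge -ltn_subLR.
  rewrite big_geq// add0r (bigD1 (Ordinal kn'))//= subnKC// lerDl.
  by apply: sumr_ge0 => i _.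
have [kK|kK] := ltnP k K; last first.
  by apply: IH => //; rewrite (eqP (_ : K - k == 0)%N) // subn_eq0.
rewrite big_ltn//; have s0 a : 0 <= \sum_(a <= i < K) u i by apply: sumr_ge0 => i _.
case: (H k kK) => [h|[j jn h]]; apply: le_trans h _; rewrite -addrA; first by rewrite lerDl addr_ge0.
rewrite lerD2l.
have h1 : v (k + j.+1)%N <= \sum_((k + j.+1)%N <= i < K) u i + \sum_(i < n) v (K + i)%N.
  by apply: IH; [clear -km; lia|apply/orP; left; clear -jn kK; lia].
apply: le_trans h1 _; rewrite lerD2r.
have [kj|kj] := leqP (k + j.+1) K; last by rewrite [X in X <= _]big_geq// ltnW.
by rewrite [leRHS](@big_cat_nat _ _ _ (k + j.+1))//= ?addnS ?ltnS ?leq_addr -?addnS// lerDr; apply: sumr_ge0.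
Qed.

Lemma circ_sum_ord (F : nat -> C -> R) N r : (forall i, (i < N)%N -> circ_int (F i) r) ->
  circ_int (fun z => \sum_(i < N) F i z) r /\
  circ (fun z => \sum_(i < N) F i z) r = \sum_(i < N) circ (F i) r.
Proof.
elim: N => [|N IH] H.
  rewrite big_ord0 (_ : (fun z => _) = fun=> 0) ?circ_cst; last by apply/funext => z; rewrite big_ord0.
  by split => //; exact: circ_int_cst.
have [i1 e1] := IH (fun i iN => H i (ltnW iN)).
rewrite big_ord_recr /= (_ : (fun z => _) = fun z => \sum_(i < N) F i z + F N z); last first.
  by apply/funext => z; rewrite big_ord_recr.
by have iN := H N (ltnSn N); rewrite circD// e1; split => //; exact: circ_intD.
Qed.

Lemma good_union (P : nat -> C -> Prop) N r :
  (forall i, (i < N)%N -> exists S : seq C, forall z, cmod z = r -> z \notin S -> P i z) ->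
  exists S : seq C, forall z, cmod z = r -> z \notin S -> forall i, (i < N)%N -> P i z.
Proof.
elim: N => [|N IH] H; first by exists [::].
have [S HS] := IH (fun i iN => H i (ltnW iN)); have [S' HS'] := H N (ltnSn N).
exists (S ++ S') => z zr; rewrite mem_cat negb_or => /andP[zS zS'] i.
by rewrite ltnS leq_eqVlt => /predU1P[->|iN]; [exact: HS'|exact: HS].
Qed.

End Chains.

(** * Upper bounds for pole orders *)

Section PoleBounds.
Variable R : realType.
Local Notation C := (cplx R).
Implicit Types (f g A : C -> C) (z c : C).

(** The limit may be 0, so k only bounds the order from above. In exchange the property passes to
    sums and products, whose meromorphy is never at issue. *)
Definition pole_le f z k := exists l, clim (fun w => (w - z) ^+ k * f w) z l.

Lemma pole_le_eq f g z k (d : R) : 0 < d -> (forall w, 0 < cmod (w - z) < d -> f w = g w) ->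
  pole_le f z k -> pole_le g z k.
Proof. by move=> d0 fg [l Hl]; exists l; apply: (eq_clim d0 _ Hl) => w /fg ->. Qed.

Lemma pole_le_add f z k k' : pole_le f z k -> pole_le f z (k + k').
Proof.
move=> [l Hl]; exists (0 ^+ k' * l); apply: (eq_clim (ltr01 : 0 < (1 : R)) _ (climM (clim_subX z k') Hl)).
by move=> w _; rewrite exprD mulrA (mulrC (_ ^+ k')).
Qed.

Lemma pole_le_mono f z k k' : (k <= k')%N -> pole_le f z k -> pole_le f z k'.
Proof. by move=> kk' h; rewrite -(subnKC kk'); exact: pole_le_add. Qed.

Lemma pole_leD f g z k : pole_le f z k -> pole_le g z k -> pole_le (fun w => f w + g w) z k.
Proof.
move=> [l Hl] [m Hm]; exists (l + m).
by apply: (eq_clim (ltr01 : 0 < (1 : R)) _ (climD Hl Hm)) => w _; rewrite mulrDr.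
Qed.

Lemma pole_leM f g z k m : pole_le f z k -> pole_le g z m -> pole_le (fun w => f w * g w) z (k + m).
Proof.
move=> [l Hl] [l' Hm]; exists (l * l').
by apply: (eq_clim (ltr01 : 0 < (1 : R)) _ (climM Hl Hm)) => w _; rewrite exprD mulrACA.
Qed.

Lemma pole_leN f z k : pole_le f z k -> pole_le (fun w => - f w) z k.
Proof.
move=> [l Hl]; exists (-1 * l).
by apply: (eq_clim (ltr01 : 0 < (1 : R)) _ (climM (clim_cst _ _) Hl)) => w _; rewrite mulN1r mulrN.
Qed.

Lemma pole_le_sum (F : nat -> C -> C) N z k : (forall i, (i < N)%N -> pole_le (F i) z k) ->
  pole_le (fun w => \sum_(i < N) F i w) z k.
Proof.
elim: N => [|N IH] H.
  exists 0; apply: (eq_clim (ltr01 : 0 < (1 : R)) _ (clim_cst 0 z)) => w _.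
  by rewrite big_ord0 mulr0.
have h := pole_leD (IH (fun i iN => H i (ltnW iN))) (H N (ltnSn N)).
by apply: (pole_le_eq (ltr01 : 0 < (1 : R)) _ h) => w _; rewrite big_ord_recr.
Qed.

Lemma pole_le_scale f z c k : c != 0 -> pole_le f (c * z) k -> pole_le (fun w => f (c * w)) z k.
Proof.
move=> c0 [l /(clim_comp_scale c0) Hl]; exists (c ^- k * l).
apply: (eq_clim (ltr01 : 0 < (1 : R)) _ (climM (clim_cst _ _) Hl)) => w _.
by rewrite -mulrBr exprMn !mulrA mulVf ?mul1r// expf_neq0.
Qed.

Lemma pole_le_order f z : is_meromorphic f -> pole_le f z (pole_order f z).
Proof.
move=> mf; have [zn|lf] := mero_local z mf.
  have [_ ->] := zero_near_orders zn; have [d d0 Hd] := zn; exists 0.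
  by apply: (eq_clim d0 _ (clim_cst 0 z)) => w /Hd ->; rewrite mulr0.
have [c c0 Hc] := local_form_clim lf; exists (0 ^+ zero_order f z * c).
apply: (eq_clim (ltr01 : 0 < (1 : R)) _ (climM (clim_subX z (zero_order f z)) Hc)) => w /andP[w0 _].
by rewrite mulrC divfK// expf_neq0// -cmod_gt0.
Qed.

Lemma pole_order_le f z k : is_meromorphic f -> pole_le f z k -> (pole_order f z <= k)%N.
Proof.
move=> mf [l Hl]; have [zn|lf] := mero_local z mf; first by have [_ ->] := zero_near_orders zn.
have [c c0 Hc] := local_form_clim lf.
have [zE pE] := @orders_form R f z (zero_order f z) (pole_order f z) (ex_intro2 _ _ c c0 Hc).
rewrite leqNgt; apply/negP => kp.
have zo : zero_order f z = 0%N by move: zE pE kp; lia.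
have h := @clim_mulX R _ z l (pole_order f z - k) _ Hl.
rewrite subn_gt0 in h; have {}h := h kp.
move/eqP: c0; apply; apply: clim_unique Hc _.
apply: (eq_clim (ltr01 : 0 < (1 : R)) _ h) => w _.
by rewrite zo expr0 divr1 mulrA -exprD subnK// ltnW.
Qed.

Lemma pole_leV A z : is_meromorphic A -> (exists z, A z != 0) ->
  pole_le (fun w => (A w)^-1) z (zero_order A z).
Proof.
move=> mA An0; have lf := mero_local_form mA An0 z.
have [c c0 Hc] := local_form_clim lf; have [d d0 Hd] := local_form_near lf.
exists (0 ^+ pole_order A z * c^-1).
apply: (eq_clim d0 _ (climM (clim_subX z (pole_order A z)) (climV c0 Hc))) => w hw.
have Aw := Hd w hw; have /andP[w0 _] := hw.
have wz : w - z != 0 by rewrite -cmod_gt0.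
by rewrite !invfM invrK mulrA mulrA mulfV ?mul1r ?expf_neq0// mulrC.
Qed.

Lemma mero_punct_scale f z c : is_meromorphic f -> c != 0 -> exists2 d : R, 0 < d &
  forall w, 0 < cmod (w - z) < d -> ~ is_pole f (c * w).
Proof.
move=> mf c0; have cc : 0 < cmod c by rewrite cmod_gt0.
have [d d0 Hd] := mero_punct (c * z) mf; exists (d / cmod c); first by rewrite divr_gt0.
move=> w /andP[w0 wd]; have [] // := Hd (c * w).
by rewrite -mulrBr cmodM mulr_gt0//= mulrC -ltr_pdivlMr.
Qed.

Lemma punct_union (P : nat -> C -> Prop) N z :
  (forall i, (i < N)%N -> exists2 d : R, 0 < d & forall w, 0 < cmod (w - z) < d -> P i w) ->
  exists2 d : R, 0 < d & forall w, 0 < cmod (w - z) < d -> forall i, (i < N)%N -> P i w.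
Proof.
elim: N => [|N IH] H; first by exists 1.
have [d d0 Hd] := IH (fun i iN => H i (ltnW iN)); have [e e0 He] := H N (ltnSn N).
exists (Num.min d e) => [|w /andP[w0]]; first by rewrite lt_min d0.
rewrite lt_min => /andP[wd we] i.
by rewrite ltnS leq_eqVlt => /predU1P[->|iN]; [apply: He|apply: Hd]; rewrite ?w0.
Qed.

Lemma poles_scale A c r : is_meromorphic A -> c != 0 ->
  exists S : seq C, forall z, cmod z = r -> z \notin S -> ~ is_pole A (c * z).
Proof.
move=> mA c0; have lfo := pole_lfin mA.
exists [seq w / c | w <- osupp (pole_order A) (cmod c * r)] => z zr zS /pole_orderP pz.
move/negP: zS; apply; apply/mapP; exists (c * z); last by rewrite mulrAC mulfV ?mul1r.
by rewrite mem_osupp// -lt0n pz cmodM zr lexx.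
Qed.

(** The weight of w at radius r is that of c w at radius |c| r. An inequality, since the image of S
    may miss points counted on the right. *)
Lemma NN_scale (o : C -> nat) c r (S : seq C) : locally_finite o -> c != 0 -> 0 < r -> uniq S ->
  \sum_(w <- S | w != 0) (o (c * w))%:R * logp (r / cmod w) <= NN o (cmod c * r).
Proof.
move=> lo c0 r0 uS; have cc : 0 < cmod c by rewrite cmod_gt0.
pose S' := [seq c * w | w <- S]; pose T := undup (S' ++ osupp o (cmod c * r)).
have uS' : uniq S' by rewrite map_inj_uniq//; exact: mulfI.
rewrite (@NN_cover R o (cmod c * r) T) ?undup_uniq ?mulr_gt0//; last first.
  by move=> p /andP[_ pr] op; rewrite mem_undup mem_cat mem_osupp// pr op orbT.
pose F v : R := if v != 0 then (o v)%:R * logp (cmod c * r / cmod v) else 0.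
have -> : \sum_(w <- S | w != 0) (o (c * w))%:R * logp (r / cmod w) = \sum_(v <- S') F v.
  rewrite big_map big_mkcond; apply: eq_bigr => w _; rewrite /F mulf_eq0 (negbTE c0) /=.
  by case: ifP => // _; rewrite cmodM -mulf_div divff ?mul1r// gt_eqF.
rewrite [leRHS]big_mkcond; apply: (@sum_le_cover R F) => //; first exact: undup_uniq.
  by move=> p; rewrite /F; case: ifP => // _; rewrite mulr_ge0// logp_ge0.
by move=> p pS _; rewrite mem_undup mem_cat pS.
Qed.

End PoleBounds.

(** * Growth of the solutions of the normalised equation *)

Section ShiftEquation.
Variable R : realType.
Local Notation C := (cplx R).
Implicit Types (f : C -> C) (A : nat -> C -> C) (p c z : C) (n K : nat).

(** A common form for both cases of the q-difference equation: for |q| < 1 it has p = q and c = 1,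
    for |q| > 1 it has p = 1/q, c = q^(-n) and the coefficients in reverse order. *)
Definition shift_eq p c n A f := forall z,
  (forall j, (j <= n.+1)%N -> ~ is_pole (A j) (c * z)) ->
  (forall j, (j <= n)%N -> ~ is_pole f (p ^+ j * z)) ->
  \sum_(j < n.+1) A j (c * z) * f (p ^+ j * z) = A n.+1 (c * z).

Lemma shift_eq_solve p c n A f z : shift_eq p c n A f ->
  (forall j, (j <= n.+1)%N -> ~ is_pole (A j) (c * z)) ->
  (forall j, (j <= n)%N -> ~ is_pole f (p ^+ j * z)) -> A 0%N (c * z) != 0 ->
  f z = (A 0%N (c * z))^-1 *
    (A n.+1 (c * z) - \sum_(i < n) A i.+1 (c * z) * f (p ^+ i.+1 * z)).
Proof.
move=> H hA hf A0; have := H z hA hf; rewrite big_ord_recl expr0 mul1r => <-.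
by rewrite addrK mulrA mulVf// mul1r.
Qed.

(** The number n + 1 of terms costs its logarithm and the division by [A 0] costs log+ 1/|A 0|;
    summing over all coefficients gives a bound that does not depend on which term dominates. *)
Definition prox_load n A (w : C) : R :=
  ln n.+1%:R + logp (cmod (A 0%N w))^-1 + \sum_(j < n.+2) logp (cmod (A j w)).

Definition pole_load n A (w : C) : nat :=
  (zero_order (A 0%N) w + \sum_(j < n.+2) pole_order (A j) w)%N.

Lemma prox_load_ge0 n A w : 0 <= prox_load n A w.
Proof.
by rewrite !addr_ge0 ?logp_ge0 ?ln_ge0 ?ler1n//; apply: sumr_ge0 => i _; exact: logp_ge0.
Qed.

Lemma cmod_sum (I : finType) (F : I -> C) : cmod (\sum_i F i) <= \sum_i cmod (F i).
Proof.
elim/big_ind2: _ => [|x a y b xa yb|//]; first by rewrite cmod0.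
exact: le_trans (cmodD _ _) (lerD xa yb).
Qed.

Lemma shift_logp p c n A f z : shift_eq p c n A f ->
  (forall j, (j <= n.+1)%N -> ~ is_pole (A j) (c * z)) ->
  (forall j, (j <= n)%N -> ~ is_pole f (p ^+ j * z)) -> A 0%N (c * z) != 0 ->
  logp (cmod (f z)) <= prox_load n A (c * z) \/
  exists2 j, (j < n)%N & logp (cmod (f z)) <=
    prox_load n A (c * z) + logp (cmod (f (p ^+ j.+1 * z))).
Proof.
move=> H hA hf A0.
(* Any common bound L of the shifted values works; afterwards L is the largest of them, or 0 when n
   = 0 and there are none. *)
have core (L : R) : 0 <= L -> (forall j, (j < n)%N -> logp (cmod (f (p ^+ j.+1 * z))) <= L) ->
    logp (cmod (f z)) <= prox_load n A (c * z) + L.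
  move=> L0 HL; apply: logp_le_exp; first by rewrite addr_ge0// prox_load_ge0.
  rewrite (shift_eq_solve H hA hf A0) cmodM cmodV /prox_load.
  set E := \sum_(j < n.+2) _.
  have aj (j : nat) : (j < n.+2)%N -> cmod (A j (c * z)) <= expR E.
    move=> jn; apply: le_trans (le_exp_logp (cmod_ge0 _)) _; rewrite ler_expR.
    rewrite /E (bigD1 (Ordinal jn))//= lerDl; apply: sumr_ge0 => i _; exact: logp_ge0.
  have fj j : (j < n)%N -> cmod (f (p ^+ j.+1 * z)) <= expR L.
    by move=> jn; apply: le_trans (le_exp_logp (cmod_ge0 _)) _; rewrite ler_expR HL.
  have -> : ln n.+1%:R + logp (cmod (A 0%N (c * z)))^-1 + E + L =
     logp (cmod (A 0%N (c * z)))^-1 + (ln n.+1%:R + (E + L)) by ring.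
  rewrite expRD; apply: ler_pM; rewrite ?invr_ge0 ?cmod_ge0//.
    by apply: le_exp_logp; rewrite invr_ge0 cmod_ge0.
  rewrite expRD lnK ?posrE ?ltr0n// -natr1 mulrDl mul1r.
  apply: le_trans (cmodB _ _) _; rewrite addrC; apply: lerD.
    apply: le_trans (cmod_sum _) _; rewrite mulr_natl.
    rewrite -[n in leRHS]card_ord -sumr_const; apply: ler_sum => i _.
    rewrite cmodM expRD; apply: ler_pM; [exact: cmod_ge0|exact: cmod_ge0| |exact: fj].
    by apply: aj; rewrite ltnS ltnW// ltnS.
  by apply: le_trans (aj _ _) _ => //; rewrite ler_expR lerDl.
have [n0|n0] := posnP n.
  by left; rewrite -[leRHS]addr0; apply: core => // j; rewrite n0.
have [j jn Hj] := seq_argmax (fun j => logp (cmod (f (p ^+ j.+1 * z)))) n0.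
by right; exists j => //; apply: core => //; exact: logp_ge0.
Qed.

(** The solved equation holds in a punctured neighbourhood of z, free of poles and of zeros of
    [A 0]. Limits there suffice for [pole_le], so the inequality holds at every z, including poles
    of the coefficients. *)
Lemma shift_pole p c n A f z : p != 0 -> c != 0 -> is_meromorphic f ->
  (forall j, (j <= n.+1)%N -> is_meromorphic (A j)) -> (exists z, A 0%N z != 0) ->
  shift_eq p c n A f ->
  (pole_order f z <= pole_load n A (c * z)%R)%N \/
  exists2 j, (j < n)%N & (pole_order f z <=
    pole_load n A (c * z)%R + pole_order f (p ^+ j.+1 * z)%R)%N.
Proof.
move=> p0 c0 mf mA A0 H.
have core (L : nat) : (forall j, (j < n)%N -> pole_order f (p ^+ j.+1 * z)%R <= L)%N ->
    (pole_order f z <= pole_load n A (c * z)%R + L)%N.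
  move=> HL; apply: pole_order_le => //; rewrite /pole_load.
  set E := (\sum_(j < n.+2) _)%N.
  have aj (j : nat) : (j < n.+2)%N -> (pole_order (A j) (c * z)%R <= E)%N.
    by move=> jn; rewrite /E (bigD1 (Ordinal jn))//= leq_addr.
  have [d1 d10 H1] : exists2 d : R, 0 < d & forall w, 0 < cmod (w - z) < d ->
      forall j, (j < n.+2)%N -> ~ is_pole (A j) (c * w).
    by apply: punct_union => j jn; apply: mero_punct_scale => //; exact: mA.
  have [d2 d20 H2] : exists2 d : R, 0 < d & forall w, 0 < cmod (w - z) < d ->
      forall j, (j < n.+1)%N -> ~ is_pole f (p ^+ j * w).
    by apply: punct_union => j jn; apply: mero_punct_scale => //; exact: expf_neq0.
  have m0 := mA 0%N isT.
  have [d3 d30 H3] := local_form_near (mero_local_form m0 A0 (c * z)).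
  have cc : 0 < cmod c by rewrite cmod_gt0.
  have h : pole_le (fun w => (A 0%N (c * w))^-1 *
     (A n.+1 (c * w) - \sum_(i < n) A i.+1 (c * w) * f (p ^+ i.+1 * w))) z
     (zero_order (A 0%N) (c * z) + (E + L)).
    apply: pole_leM; first by apply: (@pole_le_scale R (fun w => (A 0%N w)^-1)) => //; exact: pole_leV.
    apply: pole_leD.
      apply: (@pole_le_mono R _ _ (pole_order (A n.+1) (c * z))).
        by apply: leq_trans (aj _ _) (leq_addr _ _).
      by apply: pole_le_scale => //; apply: pole_le_order; exact: mA.
    apply: pole_leN; apply: (@pole_le_sum R (fun i w => A i.+1 (c * w) * f (p ^+ i.+1 * w))) => i ilt.
    apply: (@pole_le_mono R _ _ (pole_order (A i.+1) (c * z) + pole_order f (p ^+ i.+1 * z))).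
      by apply: leq_add; [apply: aj; rewrite ltnS ltnW|exact: HL].
    apply: pole_leM; apply: pole_le_scale; rewrite ?expf_neq0//; apply: pole_le_order => //.
    by apply: mA; rewrite ltnS ltnW.
  have d0 : 0 < Num.min d1 (Num.min d2 (d3 / cmod c)) by rewrite !lt_min d10 d20 divr_gt0.
  rewrite addnA in h; apply: (pole_le_eq d0 _ h) => w; rewrite !lt_min => /andP[w0 /andP[w1 /andP[w2 w3]]].
  rewrite -(shift_eq_solve H)//.
  - by move=> j jn; apply: H1; rewrite ?w0.
  - by move=> j jn; apply: H2; rewrite ?w0.
  - by apply: H3; rewrite -mulrBr cmodM mulr_gt0//= mulrC -ltr_pdivlMr.
have [n0|n0] := posnP n.
  by left; rewrite -[X in (_ <= X)%N]addn0; apply: core => j; rewrite n0.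
have [j jn Hj] := seq_argmax (fun j => (pole_order f (p ^+ j.+1 * z))%:R : R) n0.
by right; exists j => //; apply: core => i /Hj; rewrite ler_nat.
Qed.

(** [chain_bound] is applied at each point of the circle outside a finite set and then averaged;
    [mero_rot] turns means of functions of c p^k z into means over circles of other radii. *)
Lemma shift_prox_chain p c n A f r K : p != 0 -> c != 0 -> is_meromorphic f ->
  (forall j, (j <= n.+1)%N -> is_meromorphic (A j)) -> (exists z, A 0%N z != 0) ->
  shift_eq p c n A f -> 0 < r -> (0 < K)%N ->
  circ (fun z => logp (cmod (f z))) r <=
  \sum_(k < K) (ln n.+1%:R + circ (fun z => logp (cmod (A 0%N z))^-1) (cmod (c * p ^+ k) * r) +
    \sum_(j < n.+2) circ (fun z => logp (cmod (A j z))) (cmod (c * p ^+ k) * r)) +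
  \sum_(i < n) circ (fun z => logp (cmod (f z))) (cmod (p ^+ (K + i)) * r).
Proof.
move=> p0 c0 mf mA A0 H r0 K0; have pk k : p ^+ k != 0 by exact: expf_neq0.
have cpk k : c * p ^+ k != 0 by rewrite mulf_neq0.
have m0 := mA 0%N isT.
have [S1 HS1] : exists S : seq C, forall z, cmod z = r -> z \notin S ->
    forall k, (k < K)%N -> A 0%N (c * p ^+ k * z) != 0 /\ cdiff (A 0%N) (c * p ^+ k * z).
  by apply: good_union => k _; apply: special_scale.
have [S2 HS2] : exists S : seq C, forall z, cmod z = r -> z \notin S ->
    forall k, (k < K)%N -> forall j, (j < n.+2)%N -> ~ is_pole (A j) (c * p ^+ k * z).
  apply: good_union => k _; apply: good_union => j jn; apply: poles_scale => //; exact: mA.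
have [S3 HS3] : exists S : seq C, forall z, cmod z = r -> z \notin S ->
    forall k, (k < K + n)%N -> ~ is_pole f (p ^+ k * z).
  by apply: good_union => k _; apply: poles_scale.
have iA k : circ_int (fun z => \sum_(j < n.+2) logp (cmod (A j (c * p ^+ k * z)))) r /\
    circ (fun z => \sum_(j < n.+2) logp (cmod (A j (c * p ^+ k * z)))) r =
    \sum_(j < n.+2) circ (fun z => logp (cmod (A j z))) (cmod (c * p ^+ k) * r).
  have [i1 ->] := @circ_sum_ord R (fun j z => logp (cmod (A j (c * p ^+ k * z)))) n.+2 r
    (fun j jn => (mero_rot (mA j jn) (cpk k) r0).1).
  split => //; apply: eq_bigr => j _; apply: (mero_rot _ (cpk k) r0).2.
  by apply: mA; rewrite -ltnS.
have iW k : circ_int (fun z => prox_load n A (c * p ^+ k * z)) r /\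
    circ (fun z => prox_load n A (c * p ^+ k * z)) r =
    ln n.+1%:R + circ (fun z => logp (cmod (A 0%N z))^-1) (cmod (c * p ^+ k) * r) +
    \sum_(j < n.+2) circ (fun z => logp (cmod (A j z))) (cmod (c * p ^+ k) * r).
  have [i1 e1] := iA k; have [i2 e2] := mero_rot_inv m0 A0 (cpk k) r0.
  have i3 : circ_int (fun z : C => ln n.+1%:R + logp (cmod (A 0%N (c * p ^+ k * z)))^-1) r.
    by apply: circ_intD => //; exact: circ_int_cst.
  rewrite /prox_load; split; first exact: circ_intD.
  by rewrite circD// circD ?circ_cst ?e1 ?e2//; exact: circ_int_cst.
have [iU eU] := @circ_sum_ord R (fun k z => prox_load n A (c * p ^+ k * z)) K r (fun k _ => (iW k).1).
have [iV eV] := @circ_sum_ord R (fun i z => logp (cmod (f (p ^+ (K + i) * z)))) n r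
  (fun i _ => (mero_rot mf (pk (K + i)%N) r0).1).
have -> : \sum_(i < n) circ (fun z => logp (cmod (f z))) (cmod (p ^+ (K + i)) * r) =
    circ (fun z => \sum_(i < n) logp (cmod (f (p ^+ (K + i) * z)))) r.
  by rewrite eV; apply: eq_bigr => i _; rewrite (mero_rot mf (pk _) r0).2.
under eq_bigr do rewrite -(iW _).2.
rewrite -eU -circD//; apply: (@circ_le_off R _ _ r (S1 ++ S2 ++ S3)) => //.
- exact: mero_logp_int.
- exact: circ_intD.
move=> z zr; rewrite !mem_cat !negb_or => /andP[z1 /andP[z2 z3]].
have := @chain_bound R (fun k => logp (cmod (f (p ^+ k * z)))) (fun k => prox_load n A (c * p ^+ k * z)) n K.
rewrite expr0 mul1r; apply => //.
- by move=> k; exact: logp_ge0.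
- by move=> k; exact: prox_load_ge0.
move=> k kK; have := @shift_logp p c n A f (p ^+ k * z) H.
rewrite !mulrA => /(_ (HS2 z zr z2 k kK)) h.
have {}h := h _ (HS1 z zr z1 k kK).1.
case: h => [j jn|h|[j jn h]].
- by rewrite mulrA -exprD; apply: HS3 => //; clear -jn kK; lia.
- by left.
- by right; exists j => //; apply: le_trans h _; rewrite lerD2l mulrA -exprD addnC.
Qed.

(** All terms of the chain at w carry the same weight log+ (r / |w|), so after summation over w each
    one is a rescaled counting function, bounded by [NN_scale]. *)
Lemma shift_pole_chain p c n A f r K : p != 0 -> c != 0 -> is_meromorphic f ->
  (forall j, (j <= n.+1)%N -> is_meromorphic (A j)) -> (exists z, A 0%N z != 0) ->
  shift_eq p c n A f -> 0 < r -> (0 < K)%N ->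
  NN (pole_order f) r <=
  \sum_(k < K) (NN (zero_order (A 0%N)) (cmod (c * p ^+ k) * r) +
    \sum_(j < n.+2) NN (pole_order (A j)) (cmod (c * p ^+ k) * r)) +
  \sum_(i < n) NN (pole_order f) (cmod (p ^+ (K + i)) * r).
Proof.
move=> p0 c0 mf mA A0 H r0 K0; have pk k : p ^+ k != 0 by exact: expf_neq0.
have cpk k : c * p ^+ k != 0 by rewrite mulf_neq0.
have m0 := mA 0%N isT.
pose S := osupp (pole_order f) r; have uS : uniq S by exact: osupp_uniq.
have lf := pole_lfin mf.
rewrite (@NN_cover R _ r S)//; last by move=> w /andP[_ wr] ow; rewrite mem_osupp// wr ow.
pose l w : R := logp (r / cmod w).
have pt w : (pole_order f w)%:R * l w <=
   \sum_(k < K) ((zero_order (A 0%N) (c * p ^+ k * w))%:R * l w +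
     \sum_(j < n.+2) (pole_order (A j) (c * p ^+ k * w))%:R * l w) +
   \sum_(i < n) (pole_order f (p ^+ (K + i) * w))%:R * l w.
  have lw : 0 <= l w by exact: logp_ge0.
  rewrite -[X in _ + X]mulr_suml.
  under eq_bigr do rewrite -mulr_suml -mulrDl.
  rewrite -mulr_suml -mulrDl; apply: ler_wpM2r => //.
  under eq_bigr do rewrite -natr_sum -natrD.
  have := @chain_bound R (fun k => (pole_order f (p ^+ k * w))%:R)
    (fun k => (pole_load n A (c * p ^+ k * w))%:R) n K.
  rewrite expr0 mul1r; apply => //.
  move=> k kK; have := @shift_pole p c n A f (p ^+ k * w) p0 c0 mf mA A0 H.
  rewrite mulrA; case=> [h|[j jn h]]; [by left; rewrite ler_nat|right; exists j; first by []].
  by rewrite (addnC k) exprD -(mulrA (p ^+ j.+1)) -natrD ler_nat.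
apply: le_trans (ler_sum _ (fun w _ => pt w)) _.
rewrite big_split /= exchange_big [X in _ + X <= _]exchange_big /=; apply: lerD; apply: ler_sum => k _.
  rewrite big_split /= [X in _ + X <= _]exchange_big /=; apply: lerD; first by apply: NN_scale => //; exact: zero_lfin.
  apply: ler_sum => j _; apply: NN_scale => //; apply: pole_lfin; exact: (mA j (ltn_ord j)).
exact: NN_scale.
Qed.

Lemma shift_load_bound n A (r0 : R) : 1 <= r0 ->
  (forall j, (j <= n.+1)%N -> is_meromorphic (A j)) -> (exists z, A 0%N z != 0) ->
  exists2 D : R, 0 <= D & forall r B, r0 <= r ->
    (forall j, (j <= n.+1)%N -> charT (A j) r <= B) ->
    ln n.+1%:R + circ (fun z => logp (cmod (A 0%N z))^-1) r +
      \sum_(j < n.+2) circ (fun z => logp (cmod (A j z))) r +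
    (NN (zero_order (A 0%N)) r + \sum_(j < n.+2) NN (pole_order (A j)) r) <= D + n.+3%:R * B.
Proof.
move=> r01 mA A0; have [k Hk] := first_main_theorem (mA 0%N isT) A0.
exists (ln n.+1%:R + `|k|); first by rewrite addr_ge0// ln_ge0// ler1n.
move=> r B r0r HB; have r1 := le_trans r01 r0r; have rp := lt_le_trans ltr01 r1.
have [_ h] := Hk r rp.
have z0 : 0 <= (zero_order (A 0%N) 0)%:R * ln r by rewrite mulr_ge0// ln_ge0.
have h0 := HB 0%N isT; have nk := ler_norm (- k); rewrite normrN in nk.
have hs : \sum_(j < n.+2) circ (fun z => logp (cmod (A j z))) r +
    \sum_(j < n.+2) NN (pole_order (A j)) r <= n.+2%:R * B.
  rewrite -big_split /= mulr_natl -[n.+2 in leRHS]card_ord -sumr_const; apply: ler_sum => j _.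
  have mj := mA j (ltn_ord j); apply: le_trans (HB j (ltn_ord j)).
  by rewrite charTE// lerDl mulr_ge0// ln_ge0.
rewrite -(@natr1 R n.+2) mulrDl mul1r.
move: hs h z0 h0 nk; move: (\sum_(_ < _) _) (\sum_(_ < _) _) => s1 s2.
move: (circ _ _) (NN _ _) ((zero_order (A 0%N) 0)%:R * ln r) (ln n.+1%:R) (charT _ _) (n.+2%:R * B) => a1 a2 a3 a4 a5 a6.
by clear; lra.
Qed.

(** The number of steps K is the least one with |c| |p|^K r < r0: coefficients are then evaluated
    only at radii in [r0, |c| r], and K = O(ln r + 1). *)
Lemma shift_growth p c n A f (r0 : R) : 0 < cmod p < 1 -> c != 0 -> is_meromorphic f ->
  (forall j, (j <= n.+1)%N -> is_meromorphic (A j)) -> (exists z, A 0%N z != 0) ->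
  shift_eq p c n A f -> 1 <= r0 ->
  exists2 D : R, 0 < D & exists2 r1 : R, 1 <= r1 & forall r B, r1 <= r -> 0 <= B ->
    (forall rho j, r0 <= rho <= cmod c * r -> (j <= n.+1)%N -> charT (A j) rho <= B) ->
    charT f r <= D * (1 + B) * (ln r + 1).
Proof.
move=> /andP[x0 x1] c0 mf mA A0 H r01.
have p0 : p != 0 by rewrite -cmod_gt0.
have kc : 0 < cmod c by rewrite cmod_gt0.
have r0p : 0 < r0 := lt_le_trans ltr01 r01.
have [D D0 HD] := shift_load_bound r01 mA A0.
(* By minimality of K, |p|^K r < e <= |p|^(K - 1) r; so the radii |p|^(K + i) r with i < n at which
   the chain may stop all lie in [d, e]. *)
pose e := r0 / cmod c; pose d := e * cmod p ^+ n.
have e0 : 0 < e by rewrite divr_gt0.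
have d0 : 0 < d by rewrite mulr_gt0// exprn_gt0.
have de : d <= e by rewrite /d ler_piMr ?(ltW e0)// exprn_ile1 ?(ltW x0)// ltW.
have [M M0 HM] := proximity_bounded mf d0 de.
have lf := pole_lfin mf; have N0 := NN_ge0 lf e0.
pose T : R := n%:R * (M + NN (pole_order f) e).
have T0 : 0 <= T by rewrite mulr_ge0// addr_ge0.
pose P0 : R := (pole_order f 0)%:R.
pose s := - ln (cmod p); have s0 : 0 < s by rewrite oppr_gt0 ln_lt0// x0 x1.
pose lk : R := `|ln e|.
have si : 0 <= s^-1 by rewrite invr_ge0 ltW.
have lks : 0 <= lk / s by rewrite mulr_ge0// normr_ge0.
(* From e <= |p|^(K - 1) r follows K <= 1 + (ln r + |ln e|) / s, which is at most E (ln r + 1). *)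
pose E := 1 + lk / s + s^-1.
have E1 : 1 <= E by rewrite /E -addrA lerDl addr_ge0.
have E0 := lt_le_trans ltr01 E1.
(* The summands pay for the K loads, for the tail in the annulus and for a pole of f at the
   origin. *)
exists (E * (D + n.+3%:R) + T + P0).
  by rewrite -addrA ltr_wpDr ?addr_ge0// mulr_gt0// ltr_wpDl.
(* r >= e means |c| r >= r0, so at least one step is made. *)
exists (Num.max 1 e); first by rewrite le_max lexx.
move=> r B; rewrite ge_max => /andP[r1 er] B0 HB.
have rp := lt_le_trans ltr01 r1; have lr := ln_ge0 r1.
have exK : exists K, cmod c * cmod p ^+ K * r < r0.
  have er0 : 0 < e / r by rewrite divr_gt0.
  have x01 : 0 <= cmod p < 1 by rewrite ltW.
  have [K HK] := expr_small x01 er0; exists K; move: HK.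
  by rewrite /e ltr_pdivlMr// ltr_pdivlMr// mulrAC (mulrC (cmod c)).
have [K HK Kmin] := ex_minnP exK.
have K0 : (0 < K)%N.
  rewrite lt0n; apply/eqP => K0; move: HK; rewrite K0 expr0 mulr1 ltNge => /negP; apply.
  by rewrite mulrC -ler_pdivrMr.
have kge k : (k < K)%N -> r0 <= cmod c * cmod p ^+ k * r.
  by move=> kK; rewrite leNgt; apply/negP => /Kmin; rewrite leqNgt kK.
have b1 := shift_prox_chain p0 c0 mf mA A0 H rp K0.
have b2 := shift_pole_chain p0 c0 mf mA A0 H rp K0.
have load : \sum_(k < K) (ln n.+1%:R + circ (fun z => logp (cmod (A 0%N z))^-1) (cmod (c * p ^+ k) * r) +
    \sum_(j < n.+2) circ (fun z => logp (cmod (A j z))) (cmod (c * p ^+ k) * r)) +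
  \sum_(k < K) (NN (zero_order (A 0%N)) (cmod (c * p ^+ k) * r) +
    \sum_(j < n.+2) NN (pole_order (A j)) (cmod (c * p ^+ k) * r)) <= K%:R * (D + n.+3%:R * B).
  rewrite -big_split /= mulr_natl -[K in leRHS]card_ord -sumr_const; apply: ler_sum => k _.
  have kr : r0 <= cmod (c * p ^+ k) * r by rewrite cmodM cmodX; exact: kge.
  apply: HD => // j jn; apply: HB => //; rewrite kr /= cmodM cmodX.
  by rewrite ler_pM2r// ler_piMr ?(ltW kc)// exprn_ile1 ?(ltW x0)// ltW.
have term i : (i < n)%N -> d <= cmod (p ^+ (K + i)) * r <= e.
  move=> ilt; rewrite cmodX; apply/andP; split.
    have h := kge K.-1; rewrite prednK// in h; have {}h := h (leqnn K).
    have -> : (K + i = K.-1 + i.+1)%N by clear -K0; lia.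
    rewrite exprD mulrAC; apply: ler_pM; [exact: ltW|by rewrite exprn_ge0// ltW| |].
      by rewrite /e ler_pdivrMr// mulrC mulrA.
    by apply: ler_wiXn2l; rewrite ?(ltW x0) ?(ltW x1).
  rewrite /e ler_pdivlMr// mulrC mulrA; apply: le_trans (ltW HK).
  rewrite ler_pM2r// ler_pM2l//; apply: ler_wiXn2l; rewrite ?(ltW x0) ?(ltW x1)//.
  exact: leq_addr.
have tail : \sum_(i < n) circ (fun z => logp (cmod (f z))) (cmod (p ^+ (K + i)) * r) +
    \sum_(i < n) NN (pole_order f) (cmod (p ^+ (K + i)) * r) <= T.
  rewrite -big_split /= /T mulr_natl -[n in leRHS]card_ord -sumr_const; apply: ler_sum => i _.
  have ht := term i (ltn_ord i); apply: lerD; first exact: HM.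
  have /andP[h1 h2] := ht; apply: NN_le => //; exact: lt_le_trans h1.
have Kle : K%:R <= E * (ln r + 1).
  have h := kge K.-1; rewrite prednK// in h; have {}h := h (leqnn K).
  have : ln e <= ln (cmod p ^+ K.-1 * r).
    rewrite ler_ln ?posrE//; last by rewrite mulr_gt0// exprn_gt0.
    by rewrite /e ler_pdivrMr// mulrC mulrA.
  rewrite lnM ?posrE ?exprn_gt0// lnXn// => hl.
  have hl' : K.-1%:R * s <= ln r + lk.
    rewrite /s mulrN mulr_natl; have := ler_norm (- ln e); rewrite normrN -/lk; move: hl.
    by move: (ln e) (ln (cmod p) *+ _) (ln r) (lk) => a b0 c1 d1; clear; lra.
  have hK : K.-1%:R <= (ln r + lk) / s by rewrite ler_pdivlMr.
  rewrite -(prednK K0) -natr1; apply: le_trans (lerD hK (lexx 1)) _.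
  have -> : E * (ln r + 1) = (ln r + lk) / s + 1 + ((1 + lk / s) * ln r + s^-1) by rewrite /E; ring.
  by rewrite lerDl addr_ge0// mulr_ge0// addr_ge0.
rewrite charTE// -/P0.
have big : K%:R * (D + n.+3%:R * B) <= E * (ln r + 1) * ((D + n.+3%:R) * (1 + B)).
  apply: ler_pM => //; first by rewrite addr_ge0// mulr_ge0.
  have -> : (D + n.+3%:R) * (1 + B) = D + n.+3%:R * B + (n.+3%:R + D * B) by ring.
  by rewrite lerDl addr_ge0// mulr_ge0.
have q1 : 1 <= (1 + B) * (ln r + 1) by rewrite mulr_ege1 ?lerDl ?lerDr.
have h1 : T <= T * ((1 + B) * (ln r + 1)) by rewrite ler_peMr.
have h2 : P0 * ln r <= P0 * ((1 + B) * (ln r + 1)).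
  rewrite ler_wpM2l//; apply: le_trans (_ : ln r + 1 <= _); first by rewrite lerDl.
  by rewrite ler_peMl ?lerDl// addr_ge0.
have -> : (E * (D + n.+3%:R) + T + P0) * (1 + B) * (ln r + 1) =
  E * (ln r + 1) * ((D + n.+3%:R) * (1 + B)) + T * ((1 + B) * (ln r + 1)) +
  P0 * ((1 + B) * (ln r + 1)) by ring.
apply: lerD h2; apply: le_trans (lerD big h1).
apply: le_trans (lerD load tail); rewrite addrACA; exact: lerD.
Qed.

End ShiftEquation.

(** * Eventual bounds and upper limits *)

Section Eventually.
Variable R : realType.
Implicit Types (g h : R -> R) (b : R).
Local Notation ev := (pinfty_nbhs R).

Lemma ev_gt b : ev (fun r => b < r).
Proof. by exists b; split => //; exact: num_real. Qed.

Lemma evI (P Q : R -> Prop) : ev P -> ev Q -> ev (fun r => P r /\ Q r).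
Proof. exact: filterI. Qed.

Lemma ev_forall (P : nat -> R -> Prop) N : (forall i, (i < N)%N -> ev (P i)) ->
  ev (fun r => forall i, (i < N)%N -> P i r).
Proof.
elim: N => [|N IH] H; first exact: filterE.
apply: filterS2 (IH (fun i iN => H i (ltnW iN))) (H N (ltnSn N)) => r h1 h2 i.
by rewrite ltnS leq_eqVlt => /predU1P[->|/h1].
Qed.

Lemma limsup_le g b : ev (fun r => g r <= b) -> (limsup_oo g <= b%:E)%E.
Proof.
move=> H; apply: (@le_trans _ _ (ereal_sup [set (g x)%:E | x in (fun r => g r <= b)])).
  by apply: ereal_inf_lbound; exists (fun r => g r <= b).
by apply: ge_ereal_sup => _ [x xb <-]; rewrite lee_fin.
Qed.

Lemma limsup_lt g b : (limsup_oo g < b%:E)%E -> ev (fun r => g r < b).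
Proof.
move=> /ereal_inf_lt[_ [V FV <-]] hV; apply: filterS FV => r Vr.
rewrite -lte_fin; apply: le_lt_trans hV; apply: ereal_sup_ubound; by exists r.
Qed.

Lemma limsup_ge g b : ev (fun r => b <= g r) -> (b%:E <= limsup_oo g)%E.
Proof.
move=> H; apply: le_ereal_inf_tmp => _ [V FV <-].
have [r [Vr br]] : exists r, V r /\ b <= g r.
  by have [M [_ HM]] := evI FV H; exists (M + 1); apply: HM; rewrite ltrDl.
apply: le_trans (_ : (g r)%:E <= _)%E; first by rewrite lee_fin.
by apply: ereal_sup_ubound; exists r.
Qed.

Lemma liminfE g : liminf_oo g = (- limsup_oo (fun r => - g r)%R)%E.
Proof. by []. Qed.

Lemma liminf_le g b : ev (fun r => g r <= b) -> (liminf_oo g <= b%:E)%E.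
Proof.
move=> H; rewrite liminfE leeNl -EFinN; apply: limsup_ge; apply: filterS H => r.
by rewrite lerN2.
Qed.

End Eventually.

(** * Estimates of phi-orders *)

Section PhiOrders.
Variable R : realType.
Variables (R0 : R) (phi s : R -> R).
Hypotheses (R0_gt0 : 0 < R0) (aphi : admissible_phi R0 phi) (adm_s : admissible_s R0 s).
Hypothesis sphi : phi_subadditive R0 phi.
Local Notation ev := (pinfty_nbhs R).
Local Notation C := (cplx R).

Lemma ln_phi_mono r r' : R0 < r -> r <= r' -> ln (phi r) <= ln (phi r').
Proof.
have [p0 [pm _]] := aphi => r0 rr'.
by rewrite ler_ln ?posrE ?p0 ?pm// (lt_le_trans r0 rr').
Qed.

Lemma ev_ln_phi (b : R) : ev (fun r => b < ln (phi r)).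
Proof.
have [p0 [pm [pu _]]] := aphi; have [r [r0 Mr]] := pu (expR b).
apply: filterS (ev_gt r) => r' rr'.
have p0' : 0 < phi r' by rewrite p0// (lt_trans r0).
by rewrite -(expRK b) ltr_ln ?posrE ?expR_gt0// (lt_le_trans Mr)// pm// ltW.
Qed.

Lemma ev_lnln : ev (fun r => 0 <= ln (ln r) <= ln (phi r)).
Proof.
have [p0 [pm [pu pb]]] := aphi.
apply: filterS2 (ev_gt R0) (ev_gt (expR 1)) => r r0 r1.
have l1 : 1 <= ln r by rewrite -(expRK 1) ler_ln ?posrE ?expR_gt0 ?ltW// (lt_trans R0_gt0).
have /andP[h _] := pb r r0.
by rewrite ln_ge0//= ler_ln ?posrE ?p0// (lt_le_trans ltr01).
Qed.

(** Both bounds come from 1 <= ln r <= phi r for large r. *)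
Lemma beta_fin : exists2 be : R, 0 <= be <= 1 & beta_phi phi = be%:E.
Proof.
have h : ev (fun r => 0 <= ln (ln r) / ln (phi r) <= 1).
  apply: filterS2 ev_lnln (ev_ln_phi 0) => r /andP[h1 h2] l0.
  by rewrite ler_pdivrMr// mul1r h2 divr_ge0// ltW.
have h1 : (beta_phi phi <= 1%:E)%E by apply: limsup_le; apply: filterS h => r /andP[].
have h0 : (0%:E <= beta_phi phi)%E by apply: limsup_ge; apply: filterS h => r /andP[].
move: h0 h1; case: (beta_phi phi) => [b| |] //; rewrite !lee_fin => h0 h1.
by exists b; rewrite ?h0.
Qed.

(** The bound s r <= r^2 gives ln (s r / r) <= ln r, and a liminf cannot exceed the limsup of a
    larger function. *)
Lemma gamma_le_beta be : beta_phi phi = be%:E -> 0 <= be -> fine (gamma_phi_s phi s) <= be.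
Proof.
move=> bE be0; have [s1 [s2 _]] := adm_s.
have : (gamma_phi_s phi s <= be%:E)%E.
  apply/lee_addgt0Pr => e e0; rewrite -EFinD; apply: liminf_le.
  have h : (beta_phi phi < (be + e)%:E)%E by rewrite bE lte_fin ltrDl.
  have h2 := limsup_lt h.
  have h3 : ev (fun r => ln (ln (s r / r)) <= ln (ln r)).
    apply: filterS2 (ev_gt R0) (ev_gt 1) => r r0 r1.
    have /andP[rs sr] := s2 r r0; have rp : 0 < r by rewrite (lt_trans R0_gt0).
    have l0 : 0 < ln (s r / r) by rewrite ln_gt0// ltr_pdivlMr// mul1r.
    have l1 : 0 < ln r by rewrite ln_gt0.
    rewrite ler_ln ?posrE// ler_ln ?posrE ?divr_gt0// ?(lt_trans rp)//.
    by rewrite ler_pdivrMr// -expr2.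
  have h4 := evI h2 h3; apply: filterS2 h4 (ev_ln_phi 0) => r [a1 a2] l0.
  by apply: le_trans (ltW a1); rewrite ler_pM2r// invr_gt0.
(* At -oo [fine] returns 0, which 0 <= be covers. *)
by case: (gamma_phi_s phi s) => [g| |] //=; rewrite lee_fin.
Qed.

Lemma alpha_fin : (0 < alpha_phi_s phi s)%E ->
  0 < fine (alpha_phi_s phi s) <= 1.
Proof.
move=> a0; have [s1 [s2 _]] := adm_s.
have : (alpha_phi_s phi s <= 1%:E)%E.
  apply: liminf_le; apply: filterS2 (ev_gt R0) (ev_ln_phi 0) => r r0 l0.
  have /andP[rs _] := s2 r r0.
  have h := ln_phi_mono r0 (ltW rs).
  by rewrite ler_pdivrMr ?mul1r// (lt_le_trans l0 h).
by move: a0; case: (alpha_phi_s phi s) => [a| |] //=; rewrite lte_fin lee_fin => -> ->.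
Qed.

Lemma ln_le_exp (x y : R) : 0 <= y -> x <= expR y -> ln x <= y.
Proof. by move=> y0 h; apply: le_trans (ln_le_logp x) (logp_le_exp y0 h). Qed.

(** T(r) >= ln r - K gives T(r) >= (ln r) / 2 eventually; after taking logarithms the constant ln 2
    is negligible against ln (phi r). *)
Lemma order_ge_beta be (f : C -> C) : is_meromorphic f -> ~ is_constant f ->
  beta_phi phi = be%:E -> (be%:E <= phi_order phi f)%E.
Proof.
move=> mf nc bE; rewrite leNgt; apply/negP => lt.
have [b [fb bb]] : exists b : R, (phi_order phi f < b%:E)%E /\ b < be.
  move: lt; case: (phi_order phi f) => [x| |] //=.
    rewrite lte_fin => xb; exists ((x + be) / 2); rewrite lte_fin.
    by rewrite midf_lt// midf_lt.
  by move=> _; exists (be - 1); rewrite ltNyr ltrBlDr ltrDl.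
have h := limsup_lt fb; have [K HK] := charT_ge_ln mf nc.
pose d := (be - b) / 2; have d0 : 0 < d by rewrite divr_gt0// subr_gt0.
have : (beta_phi phi <= (b + d)%:E)%E.
  apply: limsup_le.
  have h2 : ev (fun r => ln (ln r) - ln 2 <= ln (charT f r)).
    apply: filterS2 (ev_gt 1) (ev_gt (expR (2 * `|K| + 1))) => r r1 r2.
    have rp := lt_trans ltr01 r1.
    have lK : 2 * `|K| + 1 <= ln r by rewrite -(expRK (2 * `|K| + 1)) ler_ln ?posrE ?expR_gt0// ltW.
    have nK := ler_norm K; have nK0 := normr_ge0 K.
    have := HK r (ltW r1); move: lK nK nK0; move: (ln r) (`|K|) (charT f r) => l k t lK nK nK0 ht.
    have l0 : 0 < l by lra.
    rewrite -ln_div ?posrE// ler_ln ?posrE ?divr_gt0//; lra.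
  have h3 := evI h h2; have h4 := evI (ev_ln_phi 0) (ev_ln_phi (ln 2 / d)).
  apply: filterS2 h3 h4 => r [a1 a2] [l0 l1].
  rewrite ltr_pdivrMr// in a1 *; rewrite ler_pdivrMr//.
  rewrite ltr_pdivrMr// in l1; move: a1 a2 l1; rewrite mulrDl (mulrC d).
  by move: (ln (ln r)) (ln (charT f r)) (b * _) (_ * d) (ln 2) => ? ? ? ? ?; lra.
by rewrite bE lee_fin /d; lra.
Qed.

Lemma phi_mul N r : R0 < r -> (0 < N)%N -> phi (N%:R * r) <= N%:R * phi r.
Proof.
move=> r0; elim: N => // -[|N] IH _; first by rewrite !mul1r.
rewrite -(@natr1 R N.+1) !mulrDl !mul1r; apply: le_trans (sphi _ r0) (lerD (IH isT) (lexx _)).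
by apply: (lt_le_trans r0); rewrite ler_peMl ?ler1n// ltW// (lt_trans R0_gt0 r0).
Qed.

(** Subadditivity gives phi (N r) <= N phi r for an integer N >= k, so a dilation costs only the
    additive constant ln N. *)
Lemma ln_phi_scale (k : R) : exists2 D : R, 0 <= D &
  forall r, R0 < r -> R0 < k * r -> ln (phi (k * r)) <= ln (phi r) + D.
Proof.
have [p0 [pm _]] := aphi.
have [N kN] : exists N : nat, k <= N.+1%:R.
  exists (Num.bound `|k|); apply: le_trans (ler_norm k) _.
  by apply: ltW; apply: lt_trans (archi_boundP (normr_ge0 k)) _; rewrite ltr_nat.
exists (ln N.+1%:R); first by rewrite ln_ge0// ler1n.
move=> r r0 kr; have rp : 0 < r := lt_trans R0_gt0 r0.
rewrite addrC -lnM ?posrE ?ltr0n ?p0// ler_ln ?posrE ?p0 ?mulr_gt0 ?ltr0n ?p0//.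
by apply: le_trans (phi_mul r0 _) => //; apply: pm => //; rewrite ler_pM2r.
Qed.

(** The power of phi contributes x to the order and the factor ln r contributes beta; constants
    disappear because ln (phi r) tends to infinity. *)
Lemma order_le be (f : C -> C) (x D E : R) : beta_phi phi = be%:E -> 0 <= be -> 0 <= x -> 0 <= D ->
  ev (fun r => charT f r <= D * (1 + expR (x * (ln (phi r) + E))) * (ln r + 1)) ->
  (phi_order phi f <= (x + be)%:E)%E.
Proof.
move=> bE be0 x0 D0 H; apply/lee_addgt0Pr => e e0; rewrite -EFinD; apply: limsup_le.
pose e1 := e / 2; have e10 : 0 < e1 by rewrite divr_gt0.
have /limsup_lt h2 : (beta_phi phi < (be + e1)%:E)%E by rewrite bE lte_fin ltrDl.
(* All constants together: 4 comes from bounding each of the two sums by twice its exponential. One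
   half of e absorbs K, the other the excess over beta. *)
pose K := ln (4 * (D + 1)) + x * `|E|.
have K0 : 0 <= K by rewrite addr_ge0 ?mulr_ge0// ln_ge0//; lra.
have h3 := evI H h2; have h4 := evI (ev_ln_phi 0) (ev_ln_phi (K / e1)).
have h5 := evI (ev_gt (1 : R)) (ev_gt (expR 1)).
apply: filterS3 h3 h4 h5 => r [a1 a2] [l0 l1] [r1 r2]; rewrite ler_pdivrMr//.
rewrite ltr_pdivrMr// in a2; rewrite ltr_pdivrMr// in l1.
have rp := lt_trans ltr01 r1; have lr1 : 1 <= ln r.
  by rewrite -(expRK 1) ler_ln ?posrE ?expR_gt0// ltW.
have lr0 := lt_le_trans ltr01 lr1.
set L := ln (phi r) in a1 a2 l0 l1 *.
have y0 : 0 <= (x + be + e) * L by rewrite mulr_ge0 ?addr_ge0 ?(ltW e0) ?(ltW l0).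
apply: ln_le_exp => //; apply: le_trans a1 _.
have xL : 0 <= x * (L + `|E|) by rewrite mulr_ge0// addr_ge0// ltW.
have e2 : 1 + expR (x * (L + E)) <= 2 * expR (x * (L + `|E|)).
  have : expR (x * (L + E)) <= expR (x * (L + `|E|)) by rewrite ler_expR ler_wpM2l// lerD2l ler_norm.
  have : 1 <= expR (x * (L + `|E|)) by rewrite -expR0 ler_expR.
  by move: (expR _) (expR _) => ? ?; lra.
have e3 : ln r + 1 <= 2 * expR ((be + e1) * L).
  have : ln r <= expR ((be + e1) * L) by rewrite -{1}(@lnK _ (ln r)) ?posrE// ler_expR ltW.
  by move: lr1; move: (ln r) (expR _) => ? ?; lra.
apply: (@le_trans _ _ ((D + 1) * (2 * expR (x * (L + `|E|))) * (2 * expR ((be + e1) * L)))).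
  apply: ler_pM => //; rewrite ?mulr_ge0 ?addr_ge0 ?expR_ge0 ?(ltW lr0)//.
  by apply: ler_pM; rewrite ?addr_ge0 ?expR_ge0// lerDl.
have -> : (D + 1) * (2 * expR (x * (L + `|E|))) * (2 * expR ((be + e1) * L)) =
  4 * (D + 1) * expR (x * (L + `|E|)) * expR ((be + e1) * L) by ring.
rewrite -[4 * (D + 1)]lnK ?posrE ?mulr_gt0 ?ltr_wpDl// -!expRD ler_expR.
have -> : ln (4 * (D + 1)) + x * (L + `|E|) + (be + e1) * L = K + (x + be + e1) * L by rewrite /K; ring.
have -> : (x + be + e) * L = L * e1 + (x + be + e1) * L by rewrite /e1; field.
by rewrite lerD2r ltW.
Qed.

End PhiOrders.

(** With i = 1/al >= 1 the difference of the two sides is (i - 1)(rho (i + 1) - be) + (be - ga) i, a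
    sum of nonnegative terms. *)
Lemma order_bound_arith (R : realType) (al be ga rho : R) : 0 < al <= 1 -> ga <= be ->
  0 <= be <= rho -> rho + be <= rho * al ^- 2 - ga / al + 2 * be.
Proof.
move=> /andP[a0 a1] gb /andP[b0 br].
have i1 : 1 <= al^-1 by rewrite invf_ge1.
have i0 : 0 <= al^-1 := le_trans ler01 i1.
rewrite -exprVn; move: i1 i0; set i := al^-1 => i1 i0.
have h1 : ga * i <= be * i by rewrite ler_wpM2r.
have h2 : 0 <= (i - 1) * (rho * (i + 1) - be).
  rewrite mulr_ge0// subr_ge0//; apply: (le_trans br).
  by rewrite ler_peMr ?(le_trans b0 br)// lerDr.
have -> : rho * i ^+ 2 - ga * i + 2 * be =
   rho + be + ((i - 1) * (rho * (i + 1) - be) + (be * i - ga * i)) by ring.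
by rewrite lerDl addr_ge0// subr_ge0.
Qed.

(** * The q-difference equation *)

Section QDifference.
Variable R : realType.
Local Notation C := (cplx R).

(** k comes before r0 in the quantifiers: it is |c|, so r0 can be placed afterwards beyond the
    radius from which the coefficients are under control. *)
Lemma q_growth (q : C) n (a : nat -> C -> C) f : q != 0 -> cmod q != 1 ->
  (forall j, (j <= n.+1)%N -> is_meromorphic (a j)) ->
  (exists z, a 0%N z != 0) -> (exists z, a n z != 0) -> is_meromorphic f ->
  (forall z : C, (forall j, (j <= n.+1)%N -> ~ is_pole (a j) z) ->
      (forall j, (j <= n)%N -> ~ is_pole f (q ^+ j * z)) ->
      \sum_(j < n.+1) a j z * f (q ^+ j * z) = a n.+1 z) ->
  exists2 k : R, 0 < k & forall r0 : R, 1 <= r0 ->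
  exists2 D : R, 0 < D & exists2 r1 : R, 1 <= r1 & forall r B, r1 <= r -> 0 <= B ->
    (forall rho j, r0 <= rho <= k * r -> (j <= n.+1)%N -> charT (a j) rho <= B) ->
    charT f r <= D * (1 + B) * (ln r + 1).
Proof.
move=> q0 q1 ma a0 an mf H; have qp : 0 < cmod q by rewrite cmod_gt0.
have [ql|ql] := ltP (cmod q) 1.
  exists (cmod (1 : C)); first by rewrite cmod_gt0 oner_neq0.
  have H1 : shift_eq q 1 n a f.
    by move=> z; rewrite mul1r; exact: H.
  have q01 : 0 < cmod q < 1 by rewrite qp.
  by move=> r0 r01; exact: (shift_growth q01 (oner_neq0 _) mf ma a0 H1 r01).
have {}ql : 1 < cmod q by rewrite lt_neqAle eq_sym q1.
(* For |q| > 1 the point is moved to q^(-n) z, which turns f (q^j z) into f at q^(-(n - j)) z.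
   Reversing the terms puts a_n in front, while the right-hand side keeps its index. *)
pose A j := if (j <= n)%N then a (n - j)%N else a n.+1.
have c0 : q ^- n != 0 by rewrite invr_eq0 expf_neq0.
have Aa (P : (C -> C) -> Prop) : (forall j, (j <= n.+1)%N -> P (A j)) <->
    (forall j, (j <= n.+1)%N -> P (a j)).
  split => h j jn; rewrite /A.
    have [jn'|jn'] := leqP j n.
      have := h (n - j)%N; rewrite /A leq_subr subKn//; apply; exact: leq_trans (leq_subr _ _) _.
    by have := h n.+1 (leqnn _); rewrite /A ltnn (_ : j = n.+1)//; apply/eqP; rewrite eqn_leq jn.
  case: ifP => _; apply: h => //; exact: leq_trans (leq_subr _ _) _.
exists (cmod (q ^- n)); first by rewrite cmod_gt0.
have q01 : 0 < cmod q^-1 < 1 by rewrite cmodV invr_gt0 qp invf_lt1.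
have mA : forall j, (j <= n.+1)%N -> is_meromorphic (A j) by apply/Aa.
have A0 : exists z, A 0%N z != 0 by rewrite /A subn0.
have pw j z : (j <= n)%N -> q ^+ j * (q ^- n * z) = q^-1 ^+ (n - j) * z.
  move=> jn; rewrite -{1}(subnK jn) exprD invfM mulrA mulrCA mulfV ?expf_neq0//.
  by rewrite mulr1 exprVn.
have H1 : shift_eq q^-1 (q ^- n) n A f.
  move=> z hA hf; have := H (q ^- n * z).
  rewrite /A ltnn => <-; first last.
  - by move=> j jn; rewrite pw//; apply: hf; exact: leq_subr.
  - by apply/(Aa (fun g => ~ is_pole g (q ^- n * z))).
  rewrite (reindex_inj rev_ord_inj) /=; apply: eq_bigr => j _.
  have jn : (j <= n)%N by rewrite -ltnS.
  by rewrite subSS leq_subr subKn// pw.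
move=> r0 r01; have [D D0 [r1 r11 HD]] := shift_growth q01 c0 mf mA A0 H1 r01.
exists D => //; exists r1 => // r B rr B0 HB; apply: HD => // rho j hr jn.
by apply: (Aa (fun g => charT g rho <= B)).2 jn => i; exact: HB.
Qed.


Lemma charT_cst (c : C) r : 0 < r -> charT (fun=> c) r = logp (cmod c).
Proof.
move=> r0; have d z : cdiff (fun=> c) z := cdiff_cst c z.
have po z : pole_order (fun=> c) z = 0%N by exact: cdiff_no_pole.
rewrite charTE//; last exact: entire_mero.
by rewrite circ_cst po mul0r addr0 /NN big1 ?addr0// => p _; rewrite po mul0r.
Qed.

End QDifference.

Theorem theorem2p2 (R : realType) (R0 : R) (phi s : R -> R)
    (q : cplx R) (n : nat) (a : nat -> cplx R -> cplx R) (f : cplx R -> cplx R) :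
  0 < R0 ->
  (* standing assumptions on phi and s *)
  admissible_phi R0 phi ->
  admissible_s R0 s ->
  (* q *)
  q != 0 -> cmod q != 1 ->
  (* coefficients: meromorphic, finite phi-order, classical order < 1 *)
  (forall j, (j <= n.+1)%N -> is_meromorphic (a j)) ->
  (forall j, (j <= n.+1)%N -> (phi_order phi (a j) < +oo)%E) ->
  (forall j, (j <= n.+1)%N -> (classical_order (a j) < 1%:E)%E) ->
  (* a_0 a_n is not identically zero *)
  (exists z, a 0%N z != 0) -> (exists z, a n z != 0) ->
  (* s convex, differentiable, limsup r^2 s'(r)/s(r)^2 < oo *)
  convex_on_gt R0 s -> differentiable_on_gt R0 s ->
  (limsup_oo (fun r : R => (r ^+ 2 * derive1 s r / (s r) ^+ 2)%R) < +oo)%E ->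
  (* phi subadditive and differentiable *)
  phi_subadditive R0 phi -> differentiable_on_gt R0 phi ->
  (* condition involving the exponent of convergence of the zeros of a_0 *)
  ((limsup_oo (fun r : R => (derive1 phi (s r) * derive1 s r * r / phi (s r))%R)
      < inv_ext (zeros_exponent R0 phi (a 0%N)))%E \/
   (inv_ext (zeros_exponent R0 phi (a 0%N))
      <= liminf_oo (fun r : R => (derive1 phi (s r) * derive1 s r * r / phi (s r))%R))%E) ->
  (0 < alpha_phi_s phi s)%E ->
  (* f is a meromorphic solution (standing assumption applied to f) *)
  is_meromorphic f ->
  ((phi_order phi f < +oo)%E -> (classical_order f < 1%:E)%E) ->
  (forall z : cplx R,
      (forall j, (j <= n.+1)%N -> ~ is_pole (a j) z) ->
      (forall j, (j <= n)%N -> ~ is_pole f (q ^+ j * z)) ->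
      \sum_(j < n.+1) a j z * f (q ^+ j * z) = a n.+1 z) ->
  ((exists2 j, (j <= n.+1)%N & ~ is_constant (a j)) ->
     (phi_order phi f <=
        (\big[maxe/-oo]_(j < n.+2) phi_order phi (a j)) * ((fine (alpha_phi_s phi s)) ^-2)%:E
        - (fine (gamma_phi_s phi s) / fine (alpha_phi_s phi s))%:E
        + (2 * fine (beta_phi phi))%:E)%E)
  /\
  ((forall j, (j <= n.+1)%N -> is_constant (a j)) ->
     (phi_order phi f <= beta_phi phi)%E).
Proof.
move=> R00 aphi adm_s q0 q1 ma oa _ a0 an _ _ _ sphi _ _ al0 mf _ H.
have [be /andP[be0 be1] bE] := beta_fin R00 aphi.
have [k k0 growth] := q_growth q0 q1 ma a0 an mf H.
split=> [[j0 j0n nc]|cst].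
  have ga := gamma_le_beta R00 aphi adm_s bE be0.
  have al := alpha_fin aphi adm_s al0.
  have ob := order_ge_beta aphi (ma j0 j0n) nc bE.
  set rhoE := (\big[maxe/-oo]_(j < n.+2) phi_order phi (a j))%E.
  (* The maximum starts from -oo; the order of a non-constant coefficient is at least beta and keeps
     it finite. *)
  have [rho rhoEE] : exists rho, rhoE = rho%:E.
    have : (rhoE < +oo)%E.
      by apply: bigmax_lt => // j _; apply: oa; exact: (ltn_ord j).
    have : (be%:E <= rhoE)%E.
      by apply: le_trans ob _; exact: (le_bigmax _ _ (Ordinal (j0n : (j0 < n.+2)%N))).
    by case: rhoE => [x| |] // _ _; exists x.
  have brho : be <= rho.
    rewrite -lee_fin -rhoEE; apply: le_trans ob _.
    exact: (le_bigmax _ _ (Ordinal (j0n : (j0 < n.+2)%N))).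
  suff h : (phi_order phi f <= (rho + be)%:E)%E.
    rewrite rhoEE -EFinM -EFinB -EFinD bE; apply: le_trans h _; rewrite lee_fin.
    by apply: order_bound_arith => //; rewrite be0.
  apply/lee_addgt0Pr => e e0; rewrite -EFinD addrAC.
  have x0 : 0 <= rho + e by rewrite addr_ge0 ?(ltW e0)// (le_trans be0).
  (* A limsup bounds the quotients only up to an excess, which is why e was added to the claim. *)
  have ev1 : pinfty_nbhs R (fun r => forall j, (j < n.+2)%N ->
      ln (charT (a j) r) / ln (phi r) < rho + e).
    apply: ev_forall => j jn; apply: limsup_lt.
    apply: (@le_lt_trans _ _ rhoE); first exact: (le_bigmax _ _ (Ordinal jn)).
    by rewrite rhoEE lte_fin ltrDl.
  have [M [_ HM]] := evI (evI ev1 (ev_gt R0)) (ev_ln_phi aphi 0).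
  (* Past M the bounds hold for all coefficients and ln (phi r) is positive, so the recursion is
     made to stop at a radius beyond M. *)
  pose r0 := Num.max 1 (M + 1).
  have r0M r : r0 <= r -> M < r.
    by move=> h; apply: lt_le_trans h; rewrite lt_max ltrDl ltr01 orbT.
  have r01 : 1 <= r0 by rewrite le_max lexx.
  have [D D0 [r1 r11 HD]] := growth r0 r01.
  have [E E0 HE] := ln_phi_scale R00 aphi sphi k.
  apply: (order_le aphi bE be0 x0 (ltW D0) (E := E)).
  have h1 := evI (ev_gt r1) (ev_gt (r0 / k)).
  apply: filterS2 h1 (ev_gt R0) => r [rr1 rr0] rR0.
  have kr : r0 < k * r by rewrite mulrC -ltr_pdivrMr.
  have [[_ kR0] _] := HM _ (r0M _ (ltW kr)).
  apply: HD; [exact: ltW|exact: expR_ge0|move=> t j /andP[t0 tk] jn].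
  have [[Ht tR0] lt0] := HM _ (r0M _ t0).
  have := Ht j jn; rewrite ltr_pdivrMr// => lT.
  (* [ln] is 0 on nonpositive numbers, so a bound on the logarithm controls only a positive
     characteristic. *)
  have [T0|T0] := leP (charT (a j) t) 0; first exact: le_trans T0 (expR_ge0 _).
  rewrite -[leLHS]lnK ?posrE// ler_expR; apply: le_trans (ltW lT) _.
  rewrite ler_wpM2l//; apply: le_trans (HE r rR0 kR0); exact: ln_phi_mono tR0 tk.
have [D D0 [r1 r11 HD]] := growth 1 (lexx _).
pose B : R := \sum_(j < n.+2) logp (cmod (a j 0)).
have B0 : 0 <= B by apply: sumr_ge0 => j _; exact: logp_ge0.
rewrite bE -[be]add0r.
have DB : 0 <= D * (1 + B) by rewrite mulr_ge0 ?addr_ge0 ?(ltW D0).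
(* Constant coefficients have characteristics bounded by [B] at all radii from 1 on, so the exponent
   x is 0 and the factor ln r alone accounts for beta. *)
apply: (@order_le R R0 phi aphi be f 0 (D * (1 + B)) 0) => //.
apply: filterS (ev_gt r1) => r rr1.
have lr : 0 <= ln r by rewrite ln_ge0// (le_trans r11)// ltW.
have h : charT f r <= D * (1 + B) * (ln r + 1).
  apply: HD => //; first exact: ltW.
  move=> t j /andP[t1 _] jn; have [c Hc] := cst j jn.
  have aE : a j = fun=> c by apply/funext.
  rewrite aE charT_cst ?(lt_le_trans ltr01)//.
  rewrite /B (bigD1 (Ordinal (jn : (j < n.+2)%N)))//= Hc lerDl.
  by apply: sumr_ge0 => i _; exact: logp_ge0.
apply: le_trans h _; rewrite mul0r expR0.
by rewrite ler_wpM2r ?addr_ge0// ler_peMr// lerDl.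
Qed.
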